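(* For $i\in\{1,2\}$ let $\theta_i\sim\mathbf f_{\theta_i}$ and let $\mathbf f_i=(\Phi_i)_\#\mathbf f_{\theta_i}$ be the distribution of the perturbed model of system $i$. Assume that for both systems the map $\theta_i\mapsto G_i(\theta_i):=\begin{bmatrix} N_i(\theta_i) \\ D_i(\theta_i) \end{bmatrix}$ is Fréchet differentiable, so that the right coprime factors $N_i(\theta_i),D_i(\theta_i)$ are continuously differentiable in $\theta_i$ in the sense of the $\mathcal{H}_\infty$ norm. Assume that there exist $\mathbf L_i>0$ such that $$\delta_g\left(\Phi_i(\theta_i),\Phi_i(\theta_i')\right)\le\mathbf L_i\|\theta_i-\theta_i'\|\qquad\text{for all }\theta_i,\theta_i'\in\mathrm{supp}(\mathbf f_{\theta_i}),\ i\in\{1,2\}.$$ Then for all $q\ge1$, $$\mathrm{dist}^{q}_{\Sigma_1,\Sigma_2,\delta_g}\ \le\ \left(\mathrm{dist}^{\mathrm{nom}}_{\Sigma_1,\Sigma_2}+\sum_{i=1}^2\mathbf L_i\left(\mathbb{E}\left[\|\theta_i-\bar\theta_i\|^q\right]\right)^{1/q}\right)^q.$$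
   Context: A plant model is a state-space triple $\Sigma=(A,B,C)$ with $A\in\mathbb{R}^{n\times n}$, $B\in\mathbb{R}^{n\times m}$, $C\in\mathbb{R}^{l\times n}$, i.e. $\dot x=Ax+Bu$, $y=Cx$, regarded as a point of $\mathbb{R}^{n^2+nm+ln}$; its transfer function is $\mathbf{TF}(\Sigma)(s)=C(sI-A)^{-1}B$. For $i\in\{1,2\}$, the nominal model is $\bar\Sigma_i=(A_i,B_i,C_i)$ and the perturbed model is $\Sigma_i(\theta_i)=(A_i(\theta_i),B_i(\theta_i),C_i(\theta_i))$, with a random parameter $\theta_i\in\Theta_i\subseteq\mathbb{R}^p$, $p\le n^2+nm+ln$, of distribution $\mathbf f_{\theta_i}$ (the paper's standing choice is Gaussian, $\mathbf f_{\theta_i}=\mathcal N(\mu_{\theta_i},\Sigma_{\theta_i})$). The measurable map $\Phi_i$ sends $\theta_i$ to $\Sigma_i(\theta_i)$, and $(\Phi_i)_\#$ denotes push-forward of measures. There is a parameter value $\bar\theta_i$ in the support of $\mathbf f_{\theta_i}$ with $\Sigma_i(\bar\theta_i)=\bar\Sigma_i$ (it need not equal $\mu_{\theta_i}$). Gap metric: let $\mathcal{H}_2$ be the space of Fourier transforms of $\mathcal{L}_2$ (finite-energy, vector-valued) signals supported on positive time. For a plant with real rational transfer matrix $P$, take a normalized right coprime factorisation $P=ND^{-1}$, where $N,D$ are proper, stable, real rational matrices, there are proper stable rational $X,Y$ with $XN+YD=I$, and $N^\star N+D^\star D=I$ (on the imaginary axis). The graph of $P$ is the closed subspace $\mathcal{G}_P=\{(u,y)\in\mathcal{H}_2\times\mathcal{H}_2: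 y=Pu\}=\begin{bmatrix} D \\ N \end{bmatrix}\mathcal{H}_2$, and $\Pi_{\mathcal{G}_P}$ is the orthogonal projection onto it. The gap metric is $\delta_g(P_1,P_2)=\|\Pi_{\mathcal{G}_{P_1}}-\Pi_{\mathcal{G}_{P_2}}\|$ (operator norm), and for state-space models $\delta_g(\Sigma_1,\Sigma_2)$ means $\delta_g(\mathbf{TF}(\Sigma_1),\mathbf{TF}(\Sigma_2))$. $N_i(\theta_i),D_i(\theta_i)$ denote the right coprime factors of the perturbed model $\Sigma_i(\theta_i)$. $\mathrm{dist}^{\mathrm{nom}}_{\Sigma_1,\Sigma_2}:=\delta_g(\bar\Sigma_1,\bar\Sigma_2)$. $\Pi(\mathbf f_1,\mathbf f_2)$ is the set of all joint distributions with marginals $\mathbf f_1$ and $\mathbf f_2$. The type-$q$ inter-system distance is $$\mathrm{dist}^{q}_{\Sigma_1,\Sigma_2,\delta_g}:=\inf_{\pi_{\mathbf f}\in\Pi(\mathbf f_1,\mathbf f_2)}\int_{\mathrm{supp}(\mathbf f_1)\times\mathrm{supp}(\mathbf f_2)}\delta_g(\Sigma_1,\Sigma_2)^q\,\pi_{\mathbf f}(d\Sigma_1,d\Sigma_2)$$ (the superscript $q$ is part of the notation; no $q$-th root is taken). *)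

(* Defs.v *)
From HB Require Import structures.
From mathcomp Require Import all_boot all_order all_algebra.
From mathcomp Require Import fraction complex.
From mathcomp Require Import all_classical all_reals all_analysis.

Set Implicit Arguments.
Unset Strict Implicit.
Unset Printing Implicit Defensive.

Import Order.TTheory GRing.Theory Num.Theory.
Import numFieldNormedType.Exports.

Local Open Scope classical_set_scope.
Local Open Scope ring_scope.

HB.instance Definition _ (T U : ptopologicalType) := Pointed.on (T * U)%type.

Definition borel (T : ptopologicalType) := g_sigma_algebraType (@open T).

(* Euclidean norms (the norm that the library puts on matrices is the sup
   norm). *)
Definition enorm (R : realType) (p : nat) (x : 'rV[R]_p) : R :=
  Num.sqrt (\sum_(j < p) x ord0 j ^+ 2).

Definition cenorm (R : realType) (k : nat) (x : 'cV[R[i]]_k) : R :=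
  Num.sqrt (\sum_(j < k)
    (complex.Re (x j ord0) ^+ 2 + complex.Im (x j ord0) ^+ 2)).

(* [rnum f / rden f] is [f] in lowest terms: the poles of [f] are exactly the
   roots of [rden f]. *)
Definition rnum (R : realType) (f : {fraction {poly R}}) : {poly R} :=
  let r : {ratio {poly R}} := repr f in
  ((frac r).1 %/ gcdp (frac r).1 (frac r).2)%R.

Definition rden (R : realType) (f : {fraction {poly R}}) : {poly R} :=
  let r : {ratio {poly R}} := repr f in
  ((frac r).2 %/ gcdp (frac r).1 (frac r).2)%R.

Definition ceval (R : realType) (q : {poly R}) (s : R[i]) : R[i] :=
  (map_poly (real_complex R) q).[s].

(* The value at a pole is irrelevant. *)
Definition reval (R : realType) (f : {fraction {poly R}}) (s : R[i]) : R[i] :=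
  ceval (rnum f) s / ceval (rden f) s.

Definition mxeval (R : realType) (a b : nat)
    (F : 'M[{fraction {poly R}}]_(a, b)) (s : R[i]) : 'M[R[i]]_(a, b) :=
  map_mx (fun f => reval f s) F.

Definition proper_stable (R : realType) (a b : nat)
    (F : 'M[{fraction {poly R}}]_(a, b)) : Prop :=
  forall i j, (size (rnum (F i j)) <= size (rden (F i j)))%N /\
    forall s : R[i], ceval (rden (F i j)) s = 0 -> complex.Re s < 0.

Definition right_coprime_factorization (R : realType) (l m : nat)
    (P : 'M[{fraction {poly R}}]_(l, m))
    (N : 'M[{fraction {poly R}}]_(l, m))
    (D : 'M[{fraction {poly R}}]_m) : Prop :=
  [/\ proper_stable N, proper_stable D, D \in unitmx, P = N *m invmx D &
    exists (X : 'M[{fraction {poly R}}]_(m, l))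
           (Y : 'M[{fraction {poly R}}]_m),
      [/\ proper_stable X, proper_stable Y & X *m N + Y *m D = 1%:M]].

(* (A, B, C), with the topology of R^(n^2 + n m + l n). *)
Definition plant (R : realType) (n m l : nat) :=
  ('M[R]_n * 'M[R]_(n, m) * 'M[R]_(l, n))%type.

Definition const_frac (R : realType) (a : R) : {fraction {poly R}} :=
  tofrac a%:P.

Definition transfer (R : realType) (n m l : nat) (S : plant R n m l) :
    'M[{fraction {poly R}}]_(l, m) :=
  let: (A, B, C) := S in
  map_mx (@const_frac R) C *m
  invmx ((tofrac 'X)%:M - map_mx (@const_frac R) A) *m
  map_mx (@const_frac R) B.

(* Signals are functions on the real line,
    implicitly taken up to almost everywhere equality; a spectrum is a function
    of w standing for the point i w of the imaginary axis. *)

Definition signal (R : realType) (k : nat) := R -> 'cV[R[i]]_k.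

Definition L2norm (R : realType) (k : nat) (f : signal R k) : \bar R :=
  Lnorm (@lebesgue_measure R) 2%:E (fun t => (cenorm (f t))%:E).

Definition L2 (R : realType) (k : nat) (f : signal R k) : Prop :=
  (forall j : 'I_k,
     measurable_fun setT (fun t : R => complex.Re (f t j ord0)) /\
     measurable_fun setT (fun t : R => complex.Im (f t j ord0))) /\
  (L2norm f < +oo)%E.

Definition cintegral (R : realType) (D : set R) (h : R -> R[i]) : R[i] :=
  ((\int[@lebesgue_measure R]_(t in D) complex.Re (h t)) +i*
   (\int[@lebesgue_measure R]_(t in D) complex.Im (h t)))%C.

Definition L2inner (R : realType) (k : nat) (f g : signal R k) : R[i] :=
  cintegral setT (fun t => \sum_(j < k) f t j ord0 * (g t j ord0)^*%C).

Definition truncated_fourier (R : realType) (k : nat) (f : signal R k) (T : R) :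
    signal R k :=
  fun w => \col_j cintegral `[- T, T]
    (fun t => f t j ord0 * (cos (w * t) -i* sin (w * t))%C).

(* Fourier transform on L_2 (Plancherel): F is the L_2-limit of the truncated
   Fourier integrals of f. *)
Definition is_fourier (R : realType) (k : nat) (f F : signal R k) : Prop :=
  L2norm (truncated_fourier f T \- F) @[T --> +oo] --> 0%E.

Definition H2 (R : realType) (k : nat) : set (signal R k) :=
  [set F | L2 F /\
    exists f : signal R k,
      [/\ L2 f, (forall t, t < 0 -> f t = 0) & is_fourier f F]].

(* H_2 x H_2 is identified with the H_2-space of stacked vectors (u, y).  This
   set is [D; N] H_2 for every right coprime factorization P = N D^-1.  On the
   imaginary axis P has finitely many poles, which the a.e. quantifier ignores. *)
Definition graph (R : realType) (l m : nat)
    (P : 'M[{fraction {poly R}}]_(l, m)) : set (signal R (m + l)) :=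
  [set w | exists (u : signal R m) (y : signal R l),
    [/\ H2 u, H2 y,
        {ae @lebesgue_measure R,
          forall t, y t = mxeval P (0 +i* t)%C *m u t} &
        w = fun t => col_mx (u t) (y t)]].

(* v is (a representative of) the orthogonal projection of w onto G. *)
Definition is_orth_proj (R : realType) (k : nat) (G : set (signal R k))
    (w v : signal R k) : Prop :=
  G v /\ forall g, G g -> L2inner (w \- v) g = 0.

(* Operator norm on H_2 x H_2 of the difference of the two projections.  Graphs
   are closed subspaces, so every w in H_2 x H_2 has projections v1 and v2,
   unique up to a.e. equality. *)
Definition gap (R : realType) (l m : nat)
    (P1 P2 : 'M[{fraction {poly R}}]_(l, m)) : \bar R :=
  ereal_sup [set x | exists w v1 v2 : signal R (m + l),
    [/\ H2 w, (L2norm w <= 1)%E,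
        is_orth_proj (graph P1) w v1, is_orth_proj (graph P2) w v2 &
        x = L2norm (v1 \- v2)]].

Definition gap_plant (R : realType) (n m l : nat) (S1 S2 : plant R n m l) :
    \bar R :=
  gap (transfer S1) (transfer S2).

(* Elements of
    H_infinity are matrix-valued functions of which only the values on the open
    right half-plane matter. *)

Definition opnorm2 (R : realType) (a b : nat) (M : 'M[R[i]]_(a, b)) : \bar R :=
  ereal_sup [set (cenorm (M *m x))%:E | x in [set x | cenorm x <= 1]].

Definition Hinf_norm (R : realType) (a b : nat) (F : R[i] -> 'M[R[i]]_(a, b)) :
    \bar R :=
  ereal_sup [set opnorm2 (F s) | s in [set s | 0 < complex.Re s]].

Definition Hinf (R : realType) (a b : nat) : set (R[i] -> 'M[R[i]]_(a, b)) :=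
  [set F : R[i] -> 'M[R[i]]_(a, b) |
          (forall i j (s : R[i]), 0 < complex.Re s ->
              derivable (fun z : R[i]^o => F z i j : R[i]^o) s 1) /\
          (Hinf_norm F < +oo)%E].

(* The derivative at x is the bounded linear map
   h |-> \sum_j h_j dG x j from R^p to H_infinity; limits are taken within
   Theta. *)
Definition Hinf_C1 (R : realType) (p a b : nat) (Theta : set 'rV[R]_p)
    (G : 'rV[R]_p -> R[i] -> 'M[R[i]]_(a, b)) : Prop :=
  exists dG : 'rV[R]_p -> 'I_p -> R[i] -> 'M[R[i]]_(a, b),
    [/\ (forall x, Theta x -> forall j, Hinf (dG x j)),
        (forall x, Theta x -> forall e : R, 0 < e ->
           exists2 d : R, 0 < d & forall y, Theta y -> enorm (y - x) < d ->
             (Hinf_norm (fun s => G y s - G x s -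
                \sum_(j < p) ((y - x) ord0 j)%:C%C *: dG x j s)%R
              <= (e * enorm (y - x))%:E)%E) &
        (forall x, Theta x -> forall j, forall e : R, 0 < e ->
           exists2 d : R, 0 < d & forall y, Theta y -> enorm (y - x) < d ->
             (Hinf_norm (fun s => dG y j s - dG x j s)%R <= e%:E)%E)].

(* Support of mu as a measure on the subspace E (which is to carry all the
   mass of mu). *)
Definition supp (R : realType) (T : ptopologicalType) (E : set T)
    (mu : set (borel T) -> \bar R) : set T :=
  [set x | E x /\ forall U, open U -> U x -> (0 < mu (E `&` U))%E].

(* Law of Phi(theta), where theta has law mu and Phi is only meaningful on
   Theta. *)
Definition law_on (R : realType) (T T' : ptopologicalType) (Theta : set T)
    (mu : set (borel T) -> \bar R) (Phi : T -> T') :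
    set (borel T') -> \bar R :=
  fun A => mu (Theta `&` Phi @^-1` A).

Definition couplings (R : realType) (T : ptopologicalType)
    (f1 f2 : set (borel T) -> \bar R) :
    set (probability (borel T * borel T)%type R) :=
  [set pi | forall A : set (borel T), measurable A ->
     pi (A `*` setT) = f1 A /\ pi (setT `*` A) = f2 A].

Definition dist_q (R : realType) (n m l : nat) (q : R)
    (f1 f2 : set (borel (plant R n m l)) -> \bar R) : \bar R :=
  ereal_inf
    [set (\int[pi]_(S in supp setT f1 `*` supp setT f2)
            poweR (gap_plant S.1 S.2) q)%E
    | pi in couplings f1 f2].

(* Main.v *)
From HB Require Import structures.
Require Import Defs.
From mathcomp Require Import all_boot all_order all_algebra.
From mathcomp Require Import fraction complex.
From mathcomp Require Import all_classical all_reals all_analysis.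
From mathcomp Require Import measurable_realfun.
From mathcomp Require Import ring lra.

Import Order.TTheory GRing.Theory Num.Theory.
Import numFieldNormedType.Exports.

Local Open Scope classical_set_scope.
Local Open Scope ring_scope.
Set Implicit Arguments.
Unset Strict Implicit.
Unset Printing Implicit Defensive.

(** The infimum over couplings is bounded by its value at one coupling, the law
    of [(Phi_1 theta_1, Phi_2 theta_2)] for independent [theta_1], [theta_2].
    Both parameters lie almost surely in their supports
    ([supp_negligible], [ae_prod]), and there the triangle inequality for the
    gap, with the two nominal plants as intermediate points, gives
    [gap (Phi_1 theta_1) (Phi_2 theta_2) <=
      L_1 |theta_1 - thetabar_1| + nominal gap + L_2 |theta_2 - thetabar_2|].
    Minkowski's inequality in [L^q] of the product law then separates the three
    terms, and the moments on the product are the moments of the factors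
    ([product_minkowski]).  The gap may fail to be measurable in the pair of
    plants; its integral is then a supremum over simple functions below it, and
    [integral_pushforward_le] bounds that supremum.

    The triangle inequality ([gap_triangle]) carries the analysis.  The gap
    between [P_1] and [P_3] is a supremum over triples [(w, v_1, v_3)] in which
    [v_i] is a projection of [w] onto the graph of [P_i]; the bound through [P_2]
    requires a projection of the same [w] onto the graph of [P_2].  This is the
    projection theorem ([orth_proj_exists]) and rests on the closedness of graphs
    in L2 ([graph_closed]).  A graph is cut out of a product of two H2 spaces by
    an equation that holds at almost every frequency, hence it is closed as soon
    as H2 is ([H2_closed]), because a sequence that converges fast enough in L2
    also converges almost everywhere ([energy_complete]).

    H2 is closed because the Fourier transform is bounded in both directions for
    the L2 norm: spectra converging in L2 are transforms of signals converging in
    L2, the limit signal still vanishes on negative times, and its transform is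
    the limit spectrum.  The two bounds are proved for integrable functions.
    Weighting the energy of the transform by [exp (- e |w|)] and applying
    Fubini's theorem turns it into a double integral against the Poisson kernel,
    whose mass is [2 pi]; letting [e] tend to 0 gives the upper bound
    ([fourier_energy_le]).  For the lower bound ([sqint_le_energy]), the Poisson
    smoothing of [a] is itself a transform of the weighted transform of [a], so
    the upper bound controls it; local averages of the smoothings converge to
    local averages of [a], and Lebesgue differentiation recovers [a].  The
    constant of the lower bound is a factor 2 from the optimal one, which is
    harmless for closedness. *)

(** * Abel weights and the Poisson kernel *)

Section signals.
Context {R : realType}.
Local Notation mu := (@lebesgue_measure R).
Implicit Types (e x w s t : R).
Definition abel (e w : R) : R := expR (- e * `|w|).
Definition poisson (e x : R) : R := 2 * e / (e ^+ 2 + x ^+ 2).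

Lemma continuous_abel e : continuous (abel e).
Proof.
move=> w; apply: continuous_comp; last exact: continuous_expR.
by apply: continuousM; [exact: cst_continuous|exact: norm_continuous].
Qed.

(** For nonnegative [w] the derivative is [abel e w * (1 + cos (w * x))], and the
    primitive vanishes at infinity. *)
Lemma is_derive_abel_primitive e x w : 0 < e ->
  is_derive w 1 (fun v => expR (- e * v) *
     ((x * sin (v * x) - e * cos (v * x)) / (e ^+ 2 + x ^+ 2) - e^-1))
    (expR (- e * w) * (1 + cos (w * x))).
Proof.
move=> e0; apply: is_derive_eq.
have d0 : e ^+ 2 + x ^+ 2 != 0.
  by rewrite gt_eqF// ltr_pwDl ?sqr_ge0// exprn_gt0.
rewrite /GRing.scale/=.
field.
by rewrite d0 gt_eqF.
Qed.

Lemma continuous_abel_cos e x : continuous (fun w => abel e w * (1 + cos (w * x))).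
Proof.
move=> w; apply: continuousM; first exact: continuous_abel.
apply: continuousD; first exact: cst_continuous.
apply: continuous_comp; last exact: continuous_cos.
by apply: continuousM; [exact: cvg_id|exact: cst_continuous].
Qed.

Lemma cvgy_expRN e : 0 < e -> expR (- e * w) @[w --> +oo] --> (0 : R).
Proof.
move=> e0.
rewrite (_ : (fun x => expR (- e * x)) =
             (fun z => expR (- z)) \o (fun z => e * z)); last first.
  by apply: eq_fun => x; rewrite mulNr.
apply: (@cvg_comp _ _ _ _ _ _ (pinfty_nbhs R)); last exact: cvgr_expR.
exact: gt0_cvgMry.
Qed.

(** The summand 1 makes the integrand nonnegative, as the fundamental theorem
    of calculus on a half-line requires. *)
Lemma integral_abel_cos e x : 0 < e ->
  (\int[mu]_w (abel e w * (1 + cos (w * x)))%:E = (2 / e + poisson e x)%:E)%E.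
Proof.
move=> e0.
have d0 : e ^+ 2 + x ^+ 2 != 0.
  by rewrite gt_eqF// ltr_pwDl ?sqr_ge0// exprn_gt0.
have f0 w : 0 <= abel e w * (1 + cos (w * x)).
  by rewrite mulr_ge0 ?expR_ge0// -lerBlDl sub0r cos_geN1.
rewrite ge0_symfun_integralT//; last 2 first.
- exact: continuous_abel_cos.
- by move=> w /=; rewrite /abel normrN (mulNr w x) cosN.
rewrite -set_itvcy.
pose F := (fun v => expR (- e * v) *
     ((x * sin (v * x) - e * cos (v * x)) / (e ^+ 2 + x ^+ 2) - e^-1)).
rewrite (@ge0_continuous_FTC2y _ _ F _ 0)//.
- rewrite -EFinB -EFinM; congr EFin.
  rewrite /F mulr0 expR0 mul0r sin0 cos0 /poisson; field.
  by rewrite d0 gt_eqF.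
- apply: continuous_subspaceT; exact: continuous_abel_cos.
- pose M := (`|x| + e) / (e ^+ 2 + x ^+ 2) + e^-1.
  have gt0d : 0 < e ^+ 2 + x ^+ 2 by rewrite ltr_pwDl ?sqr_ge0// exprn_gt0.
  have FM v : `|F v| <= expR (- e * v) * M.
    rewrite /F normrM ger0_norm ?expR_ge0// ler_wpM2l ?expR_ge0//.
    rewrite (le_trans (ler_normB _ _))//; apply: lerD; last first.
      by rewrite ger0_norm// invr_ge0 ltW.
    rewrite normrM (@ger0_norm _ (_^-1)) ?invr_ge0 ?(ltW gt0d)//.
    rewrite ler_wpM2r ?invr_ge0 ?(ltW gt0d)//.
    rewrite (le_trans (ler_normB _ _))// !normrM; apply: lerD.
      by rewrite ler_piMr// ler_norml sin_geN1 sin_le1.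
    by rewrite (ger0_norm (ltW e0)) ler_piMr ?(ltW e0)// ler_norml cos_geN1 cos_le1.
  have lim0 : expR (- e * v) * M @[v --> +oo] --> (0 : R).
    by rewrite -(mul0r M); apply: cvgM; [exact: cvgy_expRN|exact: cvg_cst].
  apply/norm_cvg0P; apply: (@squeeze_cvgr _ _ _ _ (cst 0) (fun v => expR (- e * v) * M)) => //.
  + by apply: nearW => v; rewrite normr_ge0 FM.
  + exact: cvg_cst.
- apply/cvg_at_right_filter.
  apply: differentiable_continuous; apply/derivable1_diffP.
  by apply: ex_derive; exact: is_derive_abel_primitive.
- move=> w; rewrite in_itv/= andbT => w0.
  rewrite derive1E (@derive_val _ _ _ _ _ _ _ (is_derive_abel_primitive x w e0)).
  by rewrite /abel ger0_norm// ltW.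
Qed.

Lemma poisson_ge0 e x : 0 < e -> 0 <= poisson e x.
Proof.
move=> e0; rewrite divr_ge0// ?mulr_ge0 ?(ltW e0)//.
by rewrite addr_ge0// sqr_ge0.
Qed.

Lemma poisson_le e x : 0 < e -> poisson e x <= 2 / e.
Proof.
move=> e0; have gt0d : 0 < e ^+ 2 + x ^+ 2 by rewrite ltr_pwDl ?sqr_ge0// exprn_gt0.
rewrite /poisson ler_pdivrMr// mulrAC ler_pdivlMr//.
have := sqr_ge0 x; nra.
Qed.

Lemma continuous_poisson e : 0 < e -> continuous (poisson e).
Proof.
move=> e0 x; apply: cvgM; first exact: cvg_cst.
apply: cvgV; first by rewrite gt_eqF// ltr_pwDl ?sqr_ge0// exprn_gt0.
by apply: cvgD; [exact: cvg_cst|exact: exprn_continuous].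
Qed.

Lemma measurable_poisson e : 0 < e -> measurable_fun setT (poisson e).
Proof. by move=> e0; apply: continuous_measurable_fun; exact: continuous_poisson. Qed.

Lemma poissonN e x : poisson e (- x) = poisson e x.
Proof. by rewrite /poisson sqrrN. Qed.

Lemma measurable_abel e : measurable_fun setT (abel e).
Proof. apply: continuous_measurable_fun; exact: continuous_abel. Qed.

Lemma integral_abel e : 0 < e -> (\int[mu]_w (abel e w)%:E = (2 / e)%:E)%E.
Proof.
move=> e0; have h := integral_abel_cos 0 e0.
have eqI w : (abel e w)%:E = ((2^-1)%:E * (abel e w * (1 + cos (w * 0)))%:E)%E.
  by rewrite mulr0 cos0 -EFinM; congr EFin; field.
under eq_integral do rewrite eqI.
rewrite ge0_integralZl//; last 2 first.
- by apply/measurable_EFinP; apply: continuous_measurable_fun; exact: continuous_abel_cos.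
- by move=> w _; rewrite lee_fin mulr0 cos0 mulr_ge0// expR_ge0.
rewrite h -EFinM /poisson; congr EFin; field; lra.
Qed.

Lemma integrable_abel e : 0 < e -> mu.-integrable setT (EFin \o abel e).
Proof.
move=> e0; apply/integrableP; split.
  by apply/measurable_EFinP; exact: measurable_abel.
under eq_integral do rewrite /= ger0_norm ?expR_ge0//.
by rewrite integral_abel// ltry.
Qed.

Lemma measurable_cosM x : measurable_fun setT (fun w : R => cos (w * x)).
Proof.
apply: continuous_measurable_fun => w; apply: continuous_comp; last exact: continuous_cos.
by apply: cvgM; [exact: cvg_id|exact: cvg_cst].
Qed.

Lemma measurable_sinM x : measurable_fun setT (fun w : R => sin (w * x)).
Proof.
apply: continuous_measurable_fun => w; apply: continuous_comp; last exact: continuous_sin.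
by apply: cvgM; [exact: cvg_id|exact: cvg_cst].
Qed.

Lemma integrable_abel_cos e x : 0 < e ->
  mu.-integrable setT (EFin \o (fun w => abel e w * cos (w * x))).
Proof.
move=> e0; apply: (@le_integrable _ _ _ mu _ measurableT _ (EFin \o abel e)).
- apply/measurable_EFinP; apply: measurable_funM; first exact: measurable_abel.
  exact: measurable_cosM.
- move=> w _ /=; rewrite lee_fin normrM ler_piMr//.
  by rewrite ler_norml cos_geN1 cos_le1.
- exact: integrable_abel.
Qed.

(** The Abel means of the plane waves are the Poisson kernel. *)
Lemma Rintegral_abel_cos e x : 0 < e ->
  \int[mu]_w (abel e w * cos (w * x)) = poisson e x.
Proof.
move=> e0; have ia := integrable_abel e0; have ic := integrable_abel_cos x e0.
have := integral_abel_cos x e0.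
under eq_integral do rewrite mulrDr mulr1 EFinD.
rewrite integralD// integral_abel//.
rewrite /Rintegral; case: integral (integrable_fin_num measurableT ic) => //= r _.
by rewrite -!EFinD => -[] /addrI.
Qed.

Lemma is_derive_atan_poisson e c x : 0 < e ->
  is_derive x 1 (fun y => 2 * atan ((y - c) / e)) (poisson e (x - c)).
Proof.
move=> e0.
have h : is_derive x 1 (fun y => (y - c) / e) e^-1.
  apply: is_derive_eq; rewrite /GRing.scale/=; field.
  by rewrite gt_eqF.
have h2 := @is_derive1_comp _ atan (fun y => (y - c) / e) x _ _ (is_derive1_atan _) h.
have h3 := @is_deriveZ _ _ _ _ 2 x 1 _ h2.
rewrite (_ : poisson e _ = 2 *: ((1 + ((x - c) / e) ^+ 2)^-1 * e^-1)); first exact: h3.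
have d0 : 0 < e ^+ 2 + (x - c) ^+ 2 by rewrite ltr_pwDl ?sqr_ge0// exprn_gt0.
rewrite /GRing.scale/= /poisson; field.
by rewrite !gt_eqF//= addrC.
Qed.

Lemma continuous_atan_poisson e c : 0 < e ->
  continuous (fun y : R => 2 * atan ((y - c) / e)).
Proof.
move=> e0 x; apply: differentiable_continuous; apply/derivable1_diffP.
by apply: ex_derive; exact: is_derive_atan_poisson.
Qed.

Lemma integral_poisson0 e : 0 < e -> (\int[mu]_t (poisson e t)%:E = (2 * pi)%:E)%E.
Proof.
move=> e0.
have der (x : R) : is_derive x 1 (fun y => 2 * atan ((y - 0) / e)) (poisson e x).
  by have := is_derive_atan_poisson 0 x e0; rewrite subr0.
rewrite ge0_symfun_integralT//; last 3 first.
- by move=> x; exact: poisson_ge0.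
- exact: continuous_poisson.
- by move=> x /=; rewrite poissonN.
rewrite -set_itvcy (@ge0_continuous_FTC2y _ _ (fun y => 2 * atan ((y - 0) / e)) _ (2 * (pi / 2)))//.
- by rewrite subr0 mul0r atan0 mulr0 -EFinB -EFinM subr0; congr EFin; field.
- by move=> x _; exact: poisson_ge0.
- apply: continuous_subspaceT; exact: continuous_poisson.
- apply: cvgM; first exact: cvg_cst.
  apply: (@cvg_comp _ _ _ (fun y => (y - 0) / e) atan _ (pinfty_nbhs R)); last exact: cvgy_atan.
  under eq_fun do rewrite subr0 mulrC.
  by apply: (@gt0_cvgMry R (pinfty_nbhs R) _ e^-1 id); [rewrite invr_gt0|exact: cvg_id].
- apply/cvg_at_right_filter.
  exact: (@continuous_atan_poisson e 0 e0 0).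
- move=> w; rewrite in_itv/= andbT => w0.
  by rewrite derive1E (@derive_val _ _ _ _ _ _ _ (der w)).
Qed.

Lemma integral_poisson e s : 0 < e ->
  (\int[mu]_t (poisson e (s - t))%:E = (2 * pi)%:E)%E.
Proof.
move=> e0; rewrite -(integral_poisson0 e0).
under eq_integral do rewrite -poissonN opprB.
have d1 x : is_derive x 1 (fun y : R => y - s) 1.
  by apply: is_derive_eq; rewrite subr0.
have dE : (fun t : R => t - s)^`()%classic = cst 1.
  by apply/funext => x; rewrite derive1E (@derive_val _ _ _ _ _ _ _ (d1 x)).
rewrite [RHS](@increasing_ge0_integration_by_substitutionT _ (fun t => t - s) (poisson e))//.
- by apply: eq_integral => x _ /=; rewrite /GRing.mul /= dE mulr1.
- by move=> x y xy; rewrite ltrD2r.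
- by rewrite dE; exact: cst_continuous.
- by rewrite dE; exact: is_cvg_cst.
- by rewrite dE; exact: is_cvg_cst.
- exact: cvg_addrr_Ny.
- exact: cvg_addrr.
- exact: continuous_poisson.
- by move=> x; exact: poisson_ge0.
Qed.

Lemma integral_poisson_itv e c (a b : R) : 0 < e -> a < b ->
  (\int[mu]_(x in `[a, b]) (poisson e (x - c))%:E =
   (2 * atan ((b - c) / e) - 2 * atan ((a - c) / e))%:E)%E.
Proof.
move=> e0 ab.
have der (x : R) := is_derive_atan_poisson c x e0.
have cont := @continuous_atan_poisson e c e0.
rewrite EFinB (@continuous_FTC2 _ _ (fun y => 2 * atan ((y - c) / e)))//.
- apply: continuous_subspaceT => x; apply: (@continuous_comp _ _ _ (fun y : R => y - c) (poisson e)); last exact: continuous_poisson.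
  by apply: cvgB; [exact: cvg_id|exact: cvg_cst].
- split.
  + by move=> x _; apply: ex_derive; exact: der.
  + by apply/cvg_at_right_filter; exact: cont.
  + by apply/cvg_at_left_filter; exact: cont.
- move=> w _.
  by rewrite derive1E (@derive_val _ _ _ _ _ _ _ (der w)).
Qed.

(** * Trigonometric transforms *)

(** A majorant of product form makes [f] integrable on the plane. *)
Lemma Rfubini_dominated (f : R -> R -> R) (g k : R -> R) :
    measurable_fun setT (fun z : R * R => f z.1 z.2) ->
    mu.-integrable setT (EFin \o g) -> mu.-integrable setT (EFin \o k) ->
    (forall x y, `|f x y| <= `|g x| * `|k y|) ->
  mu.-integrable setT (EFin \o (fun x => \int[mu]_y f x y)) /\
  \int[mu]_x \int[mu]_y f x y = \int[mu]_y \int[mu]_x f x y.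
Proof.
move=> mf ig ik fgk.
have mg : measurable_fun setT g by apply/measurable_EFinP; case/integrableP: ig.
have mk : measurable_fun setT k by apply/measurable_EFinP; case/integrableP: ik.
have mfe : measurable_fun setT (fun z : R * R => (f z.1 z.2)%:E).
  exact/measurable_EFinP.
have ifx x : mu.-integrable setT (EFin \o f x).
  apply: (@le_integrable _ _ _ mu _ measurableT _ (EFin \o (fun y => g x * k y))).
  - apply/measurable_EFinP.
    exact: (measurableT_comp mf (pair1_measurable x)).
  - by move=> y _ /=; rewrite lee_fin normrM.
  - exact: (integrableZl measurableT (g x) ik).
have ify y : mu.-integrable setT (EFin \o f ^~ y).
  apply: (@le_integrable _ _ _ mu _ measurableT _ (EFin \o (fun x => g x * k y))).
  - apply/measurable_EFinP.
    exact: (measurableT_comp mf (pair2_measurable y)).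
  - by move=> x _ /=; rewrite lee_fin normrM.
  - exact: (integrableZr measurableT (k y) ig).
have iff : (mu \x mu)%E.-integrable setT (fun z : R * R => (f z.1 z.2)%:E).
  apply/(integrable12ltyP mu mu mfe) => /=.
  apply: (@le_lt_trans _ _ (\int[mu]_x (`|g x|%:E * \int[mu]_y `|k y|%:E))%E).
    apply: ge0_le_integral => //.
    - by move=> x _; exact: integral_ge0.
    - apply: (@measurable_fun_fubini_tonelli_F _ _ _ _ _ mu (fun z : R * R => `|(f z.1 z.2)%:E|%E)) => //.
      exact: measurableT_comp.
    - apply: emeasurable_funM => //; apply/measurable_EFinP; exact: measurableT_comp.
    - move=> x _; rewrite -ge0_integralZl//; last first.
        by apply/measurable_EFinP; exact: measurableT_comp.
      apply: ge0_le_integral => //.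
      + apply/measurable_EFinP; apply: measurableT_comp => //; apply/measurable_EFinP.
        by case/integrableP: (ifx x).
      + by apply: emeasurable_funM => //; apply/measurable_EFinP; exact: measurableT_comp.
      + by move=> y _; rewrite -EFinM lee_fin.
  case/integrableP: ik => _ ik; case/integrableP: ig => _ ig.
  rewrite ge0_integralZr//; last 2 first.
    by apply/measurable_EFinP; exact: measurableT_comp.
    exact: integral_ge0.
  apply: lte_mul_pinfty => //.
    by apply: integral_ge0.
    by rewrite ge0_fin_numE//; exact: integral_ge0.
have EF : (fun x => \int[mu]_y (f x y)%:E)%E = EFin \o (fun x => \int[mu]_y f x y).
  by apply/funext => x /=; rewrite /Rintegral fineK//; exact: integrable_fin_num (ifx x).
have EG : (fun y => \int[mu]_x (f x y)%:E)%E = EFin \o (fun y => \int[mu]_x f x y).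
  by apply/funext => y /=; rewrite /Rintegral fineK//; exact: integrable_fin_num (ify y).
have iF := @integrable_fubini_F _ _ _ _ _ mu mu _ iff.
have fub := @Fubini _ _ _ _ _ mu mu _ iff.
split.
- by rewrite -EF.
- congr fine.
  transitivity (\int[mu]_x \int[mu]_y (f x y)%:E)%E.
    by apply: eq_integral => x _; rewrite -[RHS]/((fun x => \int[mu]_y (f x y)%:E)%E x) EF.
  rewrite [LHS]fub.
  by apply: eq_integral => y _; rewrite -[LHS]/((fun y => \int[mu]_x (f x y)%:E)%E y) EG.
Qed.

Definition cosT (a : R -> R) (w : R) : R := \int[mu]_t (a t * cos (w * t)).
Definition sinT (a : R -> R) (w : R) : R := \int[mu]_t (a t * sin (w * t)).

Lemma integrable_bounded_mul (a b : R -> R) (M : R) :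
  mu.-integrable setT (EFin \o a) -> measurable_fun setT b ->
  (forall t, `|b t| <= M) -> mu.-integrable setT (EFin \o (fun t => a t * b t)).
Proof.
move=> ia mb bM; apply: (@le_integrable _ _ _ mu _ measurableT _ (EFin \o (fun t => M * a t))).
- apply/measurable_EFinP; apply: measurable_funM => //.
  by apply/measurable_EFinP; case/integrableP: ia.
- move=> t _ /=; rewrite lee_fin !normrM mulrC ler_wpM2r//.
  by rewrite (le_trans (bM t))// ler_norm.
- exact: (integrableZl measurableT M ia).
Qed.

Lemma norm_cos_le1 x : `|cos x| <= 1. Proof. by rewrite ler_norml cos_geN1 cos_le1. Qed.
Lemma norm_sin_le1 x : `|sin x| <= 1. Proof. by rewrite ler_norml sin_geN1 sin_le1. Qed.

Lemma measurable_cosMr w : measurable_fun setT (fun t : R => cos (w * t)).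
Proof. by under eq_fun do rewrite mulrC; exact: measurable_cosM. Qed.

Lemma measurable_sinMr w : measurable_fun setT (fun t : R => sin (w * t)).
Proof. by under eq_fun do rewrite mulrC; exact: measurable_sinM. Qed.

Lemma integrable_mul_cos (a : R -> R) w : mu.-integrable setT (EFin \o a) ->
  mu.-integrable setT (EFin \o (fun t => a t * cos (w * t))).
Proof.
move=> ia; apply: (@integrable_bounded_mul _ _ 1) => //; first exact: measurable_cosMr.
by move=> t; exact: norm_cos_le1.
Qed.

Lemma integrable_mul_sin (a : R -> R) w : mu.-integrable setT (EFin \o a) ->
  mu.-integrable setT (EFin \o (fun t => a t * sin (w * t))).
Proof.
move=> ia; apply: (@integrable_bounded_mul _ _ 1) => //; first exact: measurable_sinMr.
by move=> t; exact: norm_sin_le1.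
Qed.

Lemma norm_Rintegral_mul_le (a b : R -> R) : mu.-integrable setT (EFin \o a) ->
  measurable_fun setT b -> (forall t, `|b t| <= 1) ->
  `|\int[mu]_t (a t * b t)| <= \int[mu]_t `|a t|.
Proof.
move=> ia mb b1; have iab := integrable_bounded_mul ia mb b1.
rewrite (le_trans (le_normr_Rintegral measurableT iab))//.
apply: le_Rintegral => //.
- exact: (integrable_norm iab).
- exact: (integrable_norm ia).
- by move=> t _; rewrite normrM ler_piMr.
Qed.

Lemma measurable_fun_plane (h : R -> R) : continuous h ->
  measurable_fun setT (fun z : R * R => h (z.1 * z.2)).
Proof.
move=> ch; apply: (measurableT_comp (continuous_measurable_fun ch)).
by apply: measurable_funM; [exact: measurable_fst|exact: measurable_snd].
Qed.

(** Weighted by the integrable function [abel 1], the transform is a partial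
    integral of an integrable function of two variables, hence measurable; the
    weight is then divided out. *)
Lemma measurable_kernel_transform (k : R * R -> R) (M : R) (a : R -> R) :
  measurable_fun setT k -> (forall z, `|k z| <= M) ->
  mu.-integrable setT (EFin \o a) ->
  measurable_fun setT (fun s : R => \int[mu]_t (a t * k (s, t))).
Proof.
move=> mk kM ia.
have ma : measurable_fun setT a by apply/measurable_EFinP; case/integrableP: ia.
have mks s : measurable_fun setT (fun t => k (s, t)).
  exact: (measurableT_comp mk (pair1_measurable s)).
have mf : measurable_fun setT (fun z : R * R => abel 1 z.1 * (a z.2 * k (z.1, z.2))).
  apply: measurable_funM; first exact: (measurableT_comp (measurable_abel 1) measurable_fst).
  apply: measurable_funM; first exact: (measurableT_comp ma measurable_snd).
  by under eq_fun do rewrite -surjective_pairing.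
have hb s t : `|abel 1 s * (a t * k (s, t))| <= `|abel 1 s| * `|M * a t|.
  rewrite normrM ler_wpM2l// !normrM mulrC ler_wpM2r//.
  by rewrite (le_trans (kM _))// ler_norm.
have [iF _] := Rfubini_dominated (f := fun s t => abel 1 s * (a t * k (s, t))) mf
  (integrable_abel ltr01) (integrableZl measurableT M ia) hb.
rewrite (_ : (fun s => _) = fun s => expR (1 * `|s|) * \int[mu]_t (abel 1 s * (a t * k (s, t)))).
  apply: measurable_funM; last by apply/measurable_EFinP; case/integrableP: iF.
  apply: continuous_measurable_fun => s; apply: continuous_comp; last exact: continuous_expR.
  by apply: cvgM; [exact: cvg_cst|exact: norm_continuous].
apply/funext => s.
rewrite (RintegralZl _ measurableT (integrable_bounded_mul ia (mks s) (fun t => kM (s, t)))).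
by rewrite mulrA /abel -expRD mulNr addrN expR0 mul1r.
Qed.

Lemma measurable_cosT (a : R -> R) : mu.-integrable setT (EFin \o a) ->
  measurable_fun setT (cosT a).
Proof.
move=> ia; apply: (@measurable_kernel_transform (fun z => cos (z.1 * z.2)) 1) => //.
  exact: (measurable_fun_plane (@continuous_cos R)).
by move=> z; exact: norm_cos_le1.
Qed.

Lemma measurable_sinT (a : R -> R) : mu.-integrable setT (EFin \o a) ->
  measurable_fun setT (sinT a).
Proof.
move=> ia; apply: (@measurable_kernel_transform (fun z => sin (z.1 * z.2)) 1) => //.
  exact: (measurable_fun_plane (@continuous_sin R)).
by move=> z; exact: norm_sin_le1.
Qed.

Lemma cosT_bounded (a : R -> R) w : mu.-integrable setT (EFin \o a) ->
  `|cosT a w| <= \int[mu]_t `|a t|.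
Proof.
move=> ia; apply: norm_Rintegral_mul_le => //; first exact: measurable_cosMr.
by move=> t; exact: norm_cos_le1.
Qed.

Lemma sinT_bounded (a : R -> R) w : mu.-integrable setT (EFin \o a) ->
  `|sinT a w| <= \int[mu]_t `|a t|.
Proof.
move=> ia; apply: norm_Rintegral_mul_le => //; first exact: measurable_sinMr.
by move=> t; exact: norm_sin_le1.
Qed.

Lemma trig_transform_shift (a : R -> R) w s : mu.-integrable setT (EFin \o a) ->
  \int[mu]_t (a t * cos (w * (s - t))) =
  cosT a w * cos (w * s) + sinT a w * sin (w * s).
Proof.
move=> ia.
have ic := integrable_mul_cos w ia; have is_ := integrable_mul_sin w ia.
rewrite mulrC [sinT a w * _]mulrC -(RintegralZl _ measurableT ic) -(RintegralZl _ measurableT is_).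
rewrite -RintegralD//; last 2 first.
  exact: (integrableZl measurableT (cos (w * s)) ic).
  exact: (integrableZl measurableT (sin (w * s)) is_).
by apply: eq_Rintegral => t _; rewrite mulrBr cosB; ring.
Qed.

(** Abel-summed Fourier inversion: exchanging the integrals leaves the cosine
    transform of the weight, which is the Poisson kernel. *)
Lemma Abel_inversion e (a : R -> R) s : 0 < e -> mu.-integrable setT (EFin \o a) ->
  \int[mu]_w (abel e w * (cosT a w * cos (w * s) + sinT a w * sin (w * s))) =
  \int[mu]_t (a t * poisson e (s - t)).
Proof.
move=> e0 ia.
have ma : measurable_fun setT a by apply/measurable_EFinP; case/integrableP: ia.
have mf : measurable_fun setT (fun z : R * R => abel e z.1 * (a z.2 * cos (z.1 * (s - z.2)))).
  apply: measurable_funM; first exact: (measurableT_comp (measurable_abel e) measurable_fst).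
  apply: measurable_funM; first exact: (measurableT_comp ma measurable_snd).
  apply: (measurableT_comp (continuous_measurable_fun (@continuous_cos R))).
  apply: measurable_funM; first exact: measurable_fst.
  by apply: measurable_funB => //; exact: measurable_snd.
have hb w t : `|abel e w * (a t * cos (w * (s - t)))| <= `|abel e w| * `|a t|.
  by rewrite normrM ler_wpM2l// normrM ler_piMr// norm_cos_le1.
have [_] := Rfubini_dominated (f := fun w t => abel e w * (a t * cos (w * (s - t)))) mf (integrable_abel e0) ia hb.
have icw w : mu.-integrable setT (EFin \o (fun t => a t * cos (w * (s - t)))).
  apply: (@integrable_bounded_mul _ _ 1) => //; last by move=> t; exact: norm_cos_le1.
  apply: (measurableT_comp (continuous_measurable_fun (@continuous_cos R))).
  by apply: measurable_funM => //; exact: measurable_funB.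
under [in LHS]eq_Rintegral do rewrite (RintegralZl _ measurableT (icw _)) (trig_transform_shift _ _ ia).
move=> ->; apply: eq_Rintegral => t _.
under eq_Rintegral do rewrite mulrCA.
rewrite (RintegralZl _ measurableT (integrable_abel_cos _ e0)).
by rewrite Rintegral_abel_cos.
Qed.

(** * Upper Plancherel bound *)

Definition poissonT (e : R) (a : R -> R) (s : R) : R := \int[mu]_t (a t * poisson e (s - t)).

Lemma measurable_poissonB e s : 0 < e -> measurable_fun setT (fun t => poisson e (s - t)).
Proof.
move=> e0; apply: (measurableT_comp (measurable_poisson e0)).
exact: measurable_funB.
Qed.

Lemma integrable_mul_poisson e (a : R -> R) s : 0 < e -> mu.-integrable setT (EFin \o a) ->
  mu.-integrable setT (EFin \o (fun t => a t * poisson e (s - t))).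
Proof.
move=> e0 ia; apply: (@integrable_bounded_mul _ _ (2 / e)) => //.
  exact: measurable_poissonB.
by move=> t; rewrite ger0_norm ?poisson_ge0// poisson_le.
Qed.

(** [Abel_inversion] paired with [a]; a second exchange of integrals rebuilds the
    squares of the two transforms. *)
Lemma abel_energy e (a : R -> R) : 0 < e -> mu.-integrable setT (EFin \o a) ->
  [/\ mu.-integrable setT (EFin \o (fun w => abel e w * (cosT a w ^+ 2 + sinT a w ^+ 2))),
      mu.-integrable setT (EFin \o (fun s => a s * poissonT e a s)) &
      \int[mu]_w (abel e w * (cosT a w ^+ 2 + sinT a w ^+ 2)) =
      \int[mu]_s (a s * poissonT e a s)].
Proof.
move=> e0 ia.
have ma : measurable_fun setT a by apply/measurable_EFinP; case/integrableP: ia.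
pose M := \int[mu]_t `|a t|.
have mc := measurable_cosT ia; have ms := measurable_sinT ia.
pose G w s := abel e w * (cosT a w * cos (w * s) + sinT a w * sin (w * s)).
have mG : measurable_fun setT (fun z : R * R => G z.1 z.2).
  apply: measurable_funM; first exact: (measurableT_comp (measurable_abel e) measurable_fst).
  apply: measurable_funD; apply: measurable_funM.
  - exact: (measurableT_comp mc measurable_fst).
  - exact: (measurable_fun_plane (@continuous_cos R)).
  - exact: (measurableT_comp ms measurable_fst).
  - exact: (measurable_fun_plane (@continuous_sin R)).
have M0 : 0 <= M by apply: Rintegral_ge0.
have GM w s : `|G w s| <= `|abel e w| * (2 * M).
  rewrite normrM ler_wpM2l// (le_trans (ler_normD _ _))// !normrM.
  have h1 : `|cosT a w| * `|cos (w * s)| <= M.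
    by rewrite -[leRHS]mulr1 ler_pM// ?cosT_bounded// norm_cos_le1.
  have h2 : `|sinT a w| * `|sin (w * s)| <= M.
    by rewrite -[leRHS]mulr1 ler_pM// ?sinT_bounded// norm_sin_le1.
  lra.
have mf : measurable_fun setT (fun z : R * R => a z.2 * G z.1 z.2).
  by apply: measurable_funM mG; exact: (measurableT_comp ma measurable_snd).
have hb w s : `|a s * G w s| <= `|abel e w| * `|2 * M * a s|.
  rewrite normrM [X in _ <= _ * X]normrM mulrA mulrC ler_wpM2r//.
  by rewrite (le_trans (GM _ _))// ler_wpM2l// ler_norm.
have i2 := integrableZl measurableT (2 * M) ia.
have [iF] := Rfubini_dominated (f := fun w s => a s * G w s) mf (integrable_abel e0) i2 hb.
have mf' : measurable_fun setT (fun z : R * R => a z.1 * G z.2 z.1).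
  apply: measurable_funM; first exact: (measurableT_comp ma measurable_fst).
  exact: (measurableT_comp (f := fun z : R * R => G z.1 z.2) (g := fun z : R * R => (z.2, z.1)) mG (measurable_fun_pair measurable_snd measurable_fst)).
have hb' s w : `|a s * G w s| <= `|2 * M * a s| * `|abel e w|.
  by rewrite [leRHS]mulrC.
have [iF' _] := Rfubini_dominated (f := fun s w => a s * G w s) mf' i2 (integrable_abel e0) hb'.
have iG s : mu.-integrable setT (EFin \o G ^~ s).
  apply: (@le_integrable _ _ _ mu _ measurableT _ (EFin \o (fun w => abel e w * (2 * M)))).
  - apply/measurable_EFinP; exact: (measurableT_comp mG (pair2_measurable s)).
  - by move=> w _ /=; rewrite lee_fin (le_trans (GM _ _))// normrM ler_wpM2l// ler_norm.
  - exact: (integrableZr measurableT (2 * M) (integrable_abel e0)).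
have EG s : \int[mu]_w (a s * G w s) = a s * poissonT e a s.
  by rewrite (RintegralZl _ measurableT (iG s)) /poissonT -(Abel_inversion s e0 ia).
have EF w : \int[mu]_s (a s * G w s) = abel e w * (cosT a w ^+ 2 + sinT a w ^+ 2).
  have ic := integrable_mul_cos w ia; have is_ := integrable_mul_sin w ia.
  transitivity (\int[mu]_s (abel e w * cosT a w * (a s * cos (w * s)) +
                            abel e w * sinT a w * (a s * sin (w * s)))).
    by apply: eq_Rintegral => s _; rewrite /G; ring.
  rewrite RintegralD//; last 2 first.
    exact: (integrableZl measurableT (abel e w * cosT a w) ic).
    exact: (integrableZl measurableT (abel e w * sinT a w) is_).
  rewrite (RintegralZl _ measurableT ic) (RintegralZl _ measurableT is_).
  by rewrite -/(cosT a w) -/(sinT a w); ring.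
move: iF; rewrite (_ : (fun w => _) = fun w => abel e w * (cosT a w ^+ 2 + sinT a w ^+ 2)); last first.
  by apply/funext => w.
move: iF'; rewrite (_ : (fun s => _) = fun s => a s * poissonT e a s); last first.
  by apply/funext => s.
move=> i3 i4 E; split=> //.
Qed.

Definition sqint (a : R -> R) : \bar R := (\int[mu]_t ((a t) ^+ 2)%:E)%E.

Lemma ge0_integral_EFin (f : R -> R) : mu.-integrable setT (EFin \o f) ->
  (\int[mu]_t (f t)%:E)%E = (\int[mu]_t f t)%:E.
Proof. by move=> i_; rewrite /Rintegral fineK//; exact: integrable_fin_num i_. Qed.

Lemma measurable_poissonB2 e : 0 < e ->
  measurable_fun setT (fun z : R * R => poisson e (z.1 - z.2)).
Proof.
move=> e0; apply: (measurableT_comp (measurable_poisson e0)).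
by apply: measurable_funB; [exact: measurable_fst|exact: measurable_snd].
Qed.

Lemma integral_half_poisson e c s : 0 < e -> 0 <= c ->
  (\int[mu]_t (2^-1 * (c * poisson e (s - t)))%:E = pi%:E * c%:E)%E.
Proof.
move=> e0 c0.
under eq_integral do rewrite mulrA EFinM.
rewrite ge0_integralZl//; last 3 first.
- by apply/measurable_EFinP; exact: measurable_poissonB.
- by move=> t _; rewrite lee_fin poisson_ge0.
- by rewrite lee_fin mulr_ge0.
by rewrite integral_poisson// -!EFinM; congr EFin; field.
Qed.

(** In the double integral of [a s * a t * poisson e (s - t)] the product
    [a s * a t] is at most [(a s ^+ 2 + a t ^+ 2) / 2], and the kernel has mass
    [2 * pi] in each variable. *)
Lemma abel_energy_le e (a : R -> R) : 0 < e -> mu.-integrable setT (EFin \o a) ->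
  (\int[mu]_w (abel e w * (cosT a w ^+ 2 + sinT a w ^+ 2))%:E <=
   (2 * pi)%:E * sqint a)%E.
Proof.
move=> e0 ia; have [i1 i2 E] := abel_energy e0 ia.
have ma : measurable_fun setT a by apply/measurable_EFinP; case/integrableP: ia.
have ma2 : measurable_fun setT (fun t => a t ^+ 2) by exact: measurable_funX.
have mp := measurable_poissonB2 e0.
rewrite ge0_integral_EFin// E -ge0_integral_EFin//.
pose P z := poisson e (z.1 - z.2).
have P0 z : 0 <= P z by exact: poisson_ge0.
have mA1 : measurable_fun setT (fun z : R * R => (2^-1 * (a z.1 ^+ 2 * P z))%:E).
  apply/measurable_EFinP; apply: measurable_funM => //; apply: measurable_funM => //.
  exact: (measurableT_comp ma2 measurable_fst).
have mA2 : measurable_fun setT (fun z : R * R => (2^-1 * (a z.2 ^+ 2 * P z))%:E).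
  apply/measurable_EFinP; apply: measurable_funM => //; apply: measurable_funM => //.
  exact: (measurableT_comp ma2 measurable_snd).
have A10 z : (0 <= (2^-1 * (a z.1 ^+ 2 * P z))%:E)%E.
  by rewrite lee_fin mulr_ge0// mulr_ge0// sqr_ge0.
have A20 z : (0 <= (2^-1 * (a z.2 ^+ 2 * P z))%:E)%E.
  by rewrite lee_fin mulr_ge0// mulr_ge0// sqr_ge0.
pose F1 s := (\int[mu]_t (2^-1 * (a s ^+ 2 * P (s, t)))%:E)%E.
pose F2 s := (\int[mu]_t (2^-1 * (a t ^+ 2 * P (s, t)))%:E)%E.
have mF1 : measurable_fun setT F1.
  exact: (@measurable_fun_fubini_tonelli_F _ _ _ _ _ mu (fun z : R * R => (2^-1 * (a z.1 ^+ 2 * P z))%:E)).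
have mF2 : measurable_fun setT F2.
  exact: (@measurable_fun_fubini_tonelli_F _ _ _ _ _ mu (fun z : R * R => (2^-1 * (a z.2 ^+ 2 * P z))%:E)).
have F10 s : (0 <= F1 s)%E by apply: integral_ge0 => t _; exact: (A10 (s, t)).
have F20 s : (0 <= F2 s)%E by apply: integral_ge0 => t _; exact: (A20 (s, t)).
have Ipi : (\int[mu]_s (pi%:E * ((a s) ^+ 2)%:E) = pi%:E * sqint a)%E.
  rewrite ge0_integralZl ?lee_fin ?pi_ge0//; first exact/measurable_EFinP.
  by move=> t _; rewrite lee_fin sqr_ge0.
have I1 : (\int[mu]_s F1 s = pi%:E * sqint a)%E.
  rewrite -Ipi; apply: eq_integral => s _; rewrite /F1 /P /=.
  by rewrite integral_half_poisson// sqr_ge0.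
have I2 : (\int[mu]_s F2 s = pi%:E * sqint a)%E.
  have -> : (\int[mu]_s F2 s = \int[mu]_t \int[mu]_s (2^-1 * (a t ^+ 2 * P (s, t)))%:E)%E.
    exact: (@fubini_tonelli _ _ _ _ _ mu mu (fun z : R * R => (2^-1 * (a z.2 ^+ 2 * P z))%:E)).
  rewrite -Ipi; apply: eq_integral => t _; rewrite /P /=.
  under eq_integral do rewrite -poissonN opprB.
  by rewrite integral_half_poisson// sqr_ge0.
have -> : ((2 * pi)%:E * sqint a = \int[mu]_s (F1 s + F2 s))%E.
  rewrite ge0_integralD// I1 I2 -ge0_muleDl ?lee_fin ?pi_ge0// -EFinD.
  by congr (_%:E * _)%E; ring.
apply: (@le_trans _ _ (\int[mu]_s `|(a s * poissonT e a s)%:E|)%E).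
  apply: (le_trans (lee_abs _)); apply: le_abse_integral => //.
  by case/integrableP: i2.
apply: ge0_le_integral => //.
- by apply: measurableT_comp => //; case/integrableP: i2.
- exact: emeasurable_funD.
move=> s _.
have ip := integrable_mul_poisson s e0 ia.
rewrite EFinM abseM /poissonT -ge0_integral_EFin//.
apply: (@le_trans _ _ (`|a s|%:E * \int[mu]_t `|(a t * poisson e (s - t))%:E|)%E).
  apply: lee_wpmul2l => //; apply: le_abse_integral => //.
  by case/integrableP: ip.
rewrite -ge0_integralZl//; last first.
  by apply: measurableT_comp => //; case/integrableP: ip.
rewrite /F1 /F2 -ge0_integralD//; last 4 first.
- by move=> t _; exact: (A10 (s, t)).
- exact: (measurableT_comp mA1 (pair1_measurable s)).
- by move=> t _; exact: (A20 (s, t)).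
- exact: (measurableT_comp mA2 (pair1_measurable s)).
apply: ge0_le_integral => //.
- apply: emeasurable_funM => //; apply: measurableT_comp => //; by case/integrableP: ip.
- apply: emeasurable_funD.
    exact: (measurableT_comp mA1 (pair1_measurable s)).
  exact: (measurableT_comp mA2 (pair1_measurable s)).
move=> t _ /=; rewrite -EFinM -EFinD lee_fin normrM (ger0_norm (P0 (s, t))) /=.
have := mulr_ge0 (P0 (s, t)) (sqr_ge0 (`|a s| - `|a t|)).
rewrite -(real_normK (num_real (a s))) -(real_normK (num_real (a t))).
set p := P _; set x := `|a s|; set y := `|a t|; lra.
Qed.

(** Upper bounds on nonnegative integrals survive almost everywhere limits. *)
Lemma fatou_le (f_ : nat -> R -> R) (f : R -> R) (B : \bar R) :
  (forall n, measurable_fun setT (f_ n)) -> measurable_fun setT f ->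
  (forall n x, 0 <= f_ n x) -> (forall x, 0 <= f x) ->
  {ae mu, forall x, f_ n x @[n --> \oo] --> f x} ->
  (forall n, (\int[mu]_x (f_ n x)%:E <= B)%E) ->
  (\int[mu]_x (f x)%:E <= B)%E.
Proof.
move=> mf_ mf f0_ f0 ff bd.
have mf_E n : measurable_fun setT (EFin \o f_ n) by exact/measurable_EFinP.
apply: (@le_trans _ _ (\int[mu]_x limn_einf (fun n => (f_ n x)%:E))%E).
  apply: ae_ge0_le_integral => //.
  - by move=> x _; rewrite lee_fin.
  - exact/measurable_EFinP.
  - move=> x _; rewrite limn_einf_lim; apply: lime_ge; first exact: is_cvg_einfs.
    apply: nearW => n; apply: le_ereal_inf_tmp => _ [m /= _ <-]; by rewrite lee_fin.
  - have -> : (fun x => limn_einf (fun n => (f_ n x)%:E)) =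
              (fun x => - limn_esup (fun n => - (f_ n x)%:E))%E.
      apply/funext => x; rewrite -limn_einfN; congr limn_einf.
      by apply/funext => n /=; rewrite ?opprK ?oppeK.
    apply: measurableT_comp => //.
    by apply: (@measurable_fun_limn_esup _ _ _ _ (fun n x => (- (f_ n x)%:E)%E)) => n; apply: measurableT_comp => //; exact: mf_E.
  - move: ff; apply: filterS; first exact: (ae_filter_ringOfSetsType mu).
    move=> x fx _.
    have : (f_ n x)%:E @[n --> \oo] --> (f x)%:E by apply: cvg_EFin => //; exact: nearW.
    by move=> /cvg_limn_einf_sup [-> _].
have f0E n x : setT x -> (0 <= (EFin \o f_ n) x)%E by rewrite lee_fin.
have := fatou mu measurableT mf_E f0E; move=> /le_trans; apply.
rewrite limn_einf_lim; apply: lime_le; first exact: is_cvg_einfs.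
by apply: nearW => n; apply: le_trans (bd n); apply: ereal_inf_lbound; exists n => /=.
Qed.

Lemma cvg_invSn : (n.+1%:R^-1 : R) @[n --> \oo] --> (0 : R).
Proof. exact: cvg_harmonic. Qed.

(** Plancherel, upper bound: the Abel weights increase to 1. *)
Lemma fourier_energy_le (a : R -> R) : mu.-integrable setT (EFin \o a) ->
  (\int[mu]_w (cosT a w ^+ 2 + sinT a w ^+ 2)%:E <= (2 * pi)%:E * sqint a)%E.
Proof.
move=> ia.
have mE : measurable_fun setT (fun w => cosT a w ^+ 2 + sinT a w ^+ 2).
  by apply: measurable_funD; apply: measurable_funX; [exact: measurable_cosT|exact: measurable_sinT].
apply: (@fatou_le (fun n w => abel n.+1%:R^-1 w * (cosT a w ^+ 2 + sinT a w ^+ 2))) => //.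
- by move=> n; apply: measurable_funM => //; exact: measurable_abel.
- by move=> n w; rewrite mulr_ge0 ?expR_ge0// addr_ge0// sqr_ge0.
- by move=> w; rewrite addr_ge0// sqr_ge0.
- apply: aeW => w; rewrite -[X in _ --> X]mul1r; apply: cvgM; last exact: cvg_cst.
  rewrite /abel -[X in _ --> X]expR0; apply: continuous_cvg; first exact: continuous_expR.
  rewrite -[X in _ --> X](mul0r `|w|); apply: cvgM; last exact: cvg_cst.
  by rewrite -[X in _ --> X]oppr0; apply: cvgN; exact: cvg_invSn.
- by move=> n; apply: abel_energy_le.
Qed.

(** * Lower Plancherel bound *)

Lemma measurable_poissonT e (a : R -> R) : 0 < e -> mu.-integrable setT (EFin \o a) ->
  measurable_fun setT (poissonT e a).
Proof.
move=> e0 ia.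
apply: (@measurable_kernel_transform (fun z => poisson e (z.1 - z.2)) (2 / e)) => //.
  exact: measurable_poissonB2.
by move=> z; rewrite ger0_norm ?poisson_ge0// poisson_le.
Qed.

Lemma poissonT_bounded e (a : R -> R) s : 0 < e -> mu.-integrable setT (EFin \o a) ->
  `|poissonT e a s| <= 2 / e * \int[mu]_t `|a t|.
Proof.
move=> e0 ia; have ip := integrable_mul_poisson s e0 ia.
have ina := integrable_norm ia.
rewrite (le_trans (le_normr_Rintegral measurableT ip))//.
rewrite -(RintegralZl _ measurableT ina).
apply: le_Rintegral => //.
- exact: (integrable_norm ip).
- exact: (integrableZl measurableT (2 / e) ina).
- move=> t _; rewrite normrM mulrC ler_wpM2r// ger0_norm ?poisson_ge0//.
  exact: poisson_le.
Qed.

Lemma sqint_le (a b : R -> R) : measurable_fun setT a -> measurable_fun setT b ->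
  (forall t, `|a t| <= `|b t|) -> (sqint a <= sqint b)%E.
Proof.
move=> ma mb ab; apply: ge0_le_integral => //.
- by move=> t _; rewrite lee_fin sqr_ge0.
- by apply/measurable_EFinP; exact: measurable_funX.
- by apply/measurable_EFinP; exact: measurable_funX.
- move=> t _; rewrite lee_fin -(real_normK (num_real (a t))) -(real_normK (num_real (b t))).
  by rewrite ler_sqr ?nnegrE.
Qed.

Lemma sqint_ge0 a : (0 <= sqint a)%E.
Proof. by apply: integral_ge0 => t _; rewrite lee_fin sqr_ge0. Qed.

Lemma sqintD_le (a b : R -> R) : measurable_fun setT a -> measurable_fun setT b ->
  (sqint (fun t => a t + b t)%R <= 2%:E * (sqint a + sqint b))%E.
Proof.
move=> ma mb.
have ma2 : measurable_fun setT (fun t => ((a t) ^+ 2)%:E).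
  by apply/measurable_EFinP; exact: measurable_funX.
have mb2 : measurable_fun setT (fun t => ((b t) ^+ 2)%:E).
  by apply/measurable_EFinP; exact: measurable_funX.
rewrite /sqint -ge0_integralD//; last 2 first.
- by move=> t _; rewrite lee_fin sqr_ge0.
- by move=> t _; rewrite lee_fin sqr_ge0.
rewrite -ge0_integralZl//; last 2 first.
- exact: emeasurable_funD.
- by move=> t _; rewrite -EFinD lee_fin addr_ge0// sqr_ge0.
apply: ge0_le_integral => //.
- by move=> t _; rewrite lee_fin sqr_ge0.
- by apply/measurable_EFinP; apply: measurable_funX; exact: measurable_funD.
- by apply: emeasurable_funM => //; exact: emeasurable_funD.
- move=> t _; rewrite -EFinD -EFinM lee_fin.
  have := sqr_ge0 (a t - b t); nra.
Qed.

Lemma measurable_fun_sqD (f g : R -> R) : measurable_fun setT f -> measurable_fun setT g ->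
  measurable_fun setT (fun w => f w ^+ 2 + g w ^+ 2).
Proof. by move=> mf mg; apply: measurable_funD; [exact: (measurable_funX _ mf)|exact: (measurable_funX _ mg)]. Qed.

(** Smoothing by the Poisson kernel is an Abel-weighted inverse transform, so the
    upper Plancherel bound applies to it a second time. *)
Lemma poissonT_energy e (a : R -> R) : 0 < e -> mu.-integrable setT (EFin \o a) ->
  (sqint (poissonT e a) <=
   (4 * pi)%:E * \int[mu]_w (cosT a w ^+ 2 + sinT a w ^+ 2)%:E)%E.
Proof.
move=> e0 ia.
have mc := measurable_cosT ia; have ms := measurable_sinT ia.
have abel_le1 w : `|abel e w| <= 1.
  rewrite ger0_norm ?expR_ge0// /abel -expR0 ler_expR mulNr oppr_le0.
  by rewrite mulr_ge0// ltW.
pose u w := abel e w * cosT a w; pose v w := abel e w * sinT a w.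
have iu : mu.-integrable setT (EFin \o u).
  by apply: (integrable_bounded_mul (integrable_abel e0) mc) => t; exact: cosT_bounded.
have iv : mu.-integrable setT (EFin \o v).
  by apply: (integrable_bounded_mul (integrable_abel e0) ms) => t; exact: sinT_bounded.
have mu_ : measurable_fun setT u by apply/measurable_EFinP; case/integrableP: iu.
have mv : measurable_fun setT v by apply/measurable_EFinP; case/integrableP: iv.
have -> : poissonT e a = fun s => cosT u s + sinT v s.
  apply/funext => s; rewrite /poissonT -(Abel_inversion s e0 ia) -RintegralD//.
  - by apply: eq_Rintegral => w _; rewrite /u /v ![s * w]mulrC; ring.
  - exact: integrable_mul_cos.
  - exact: integrable_mul_sin.
have mcu := measurable_cosT iu; have msu := measurable_sinT iu.
have mcv := measurable_cosT iv; have msv := measurable_sinT iv.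
have mX (f : R -> R) : measurable_fun setT f -> measurable_fun setT (fun w => ((f w) ^+ 2)%:E).
  by move=> mf; apply/measurable_EFinP; exact: measurable_funX.
have X0 (f : R -> R) t : (0 <= ((f t) ^+ 2)%:E)%E by rewrite lee_fin sqr_ge0.
have leu : (sqint (cosT u) <= (2 * pi)%:E * sqint (cosT a))%E.
  apply: le_trans (le_trans (fourier_energy_le iu) _); last first.
    apply: lee_wpmul2l; first by rewrite lee_fin mulr_ge0// pi_ge0.
    by apply: sqint_le => // t; rewrite /u normrM ler_piMl.
  apply: ge0_le_integral => //; first exact: mX.
    by apply/measurable_EFinP; exact: (measurable_fun_sqD mcu msu).
  by move=> t _; rewrite lee_fin lerDl sqr_ge0.
have lev : (sqint (sinT v) <= (2 * pi)%:E * sqint (sinT a))%E.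
  apply: le_trans (le_trans (fourier_energy_le iv) _); last first.
    apply: lee_wpmul2l; first by rewrite lee_fin mulr_ge0// pi_ge0.
    by apply: sqint_le => // t; rewrite /v normrM ler_piMl.
  apply: ge0_le_integral => //; first exact: mX.
    by apply/measurable_EFinP; exact: (measurable_fun_sqD mcv msv).
  by move=> t _; rewrite lee_fin lerDr sqr_ge0.
under eq_integral do rewrite EFinD.
rewrite ge0_integralD//; [|exact: mX|exact: mX].
apply: (le_trans (sqintD_le mcu msv)).
rewrite (_ : 4 * pi = 2 * (2 * pi)); last by ring.
rewrite [in leRHS](EFinM 2) -muleA lee_pmul2l ?lte_fin//.
rewrite ge0_muleDr ?sqint_ge0//.
exact: (leeD leu lev).
Qed.

Definition box (d y : R) : R := (`|y| < d)%R%:R.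
(** Local averages, up to the factor [2 * d]. *)
Definition boxT (d : R) (h : R -> R) (s : R) : R := \int[mu]_x (h x * box d (s - x)).

Lemma box_ge0 d y : 0 <= box d y. Proof. by rewrite /box ler0n. Qed.
Lemma box_le1 d y : `|box d y| <= 1. Proof. by rewrite /box; case: (_ < _); rewrite ?normr1 ?normr0. Qed.

Lemma measurable_box d : measurable_fun setT (box d).
Proof.
have mb : measurable_fun setT (fun y : R => `|y| < d).
  by apply: measurable_fun_ltr => //; exact: measurableT_comp.
rewrite (_ : box d = fun y => if `|y| < d then 1 else 0); last by apply/funext => y; rewrite /box; case: ifP.
by apply: measurable_fun_ifT.
Qed.

Lemma measurable_boxB2 d : measurable_fun setT (fun z : R * R => box d (z.1 - z.2)).
Proof.
apply: (measurableT_comp (measurable_box d)).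
by apply: measurable_funB; [exact: measurable_fst|exact: measurable_snd].
Qed.

Lemma measurable_boxB d s : measurable_fun setT (fun t => box d (s - t)).
Proof. by apply: (measurableT_comp (measurable_box d)); exact: measurable_funB. Qed.

Lemma integral_mul_box d s (h : R -> R) :
  (\int[mu]_x (h x * box d (s - x))%:E = \int[mu]_(x in ball s d) (h x)%:E)%E.
Proof.
rewrite [RHS]integral_mkcond; apply: eq_integral => x _.
rewrite patchE /box.
have -> : (x \in (ball s d : set R)) = (`|s - x| < d) by apply/idP/idP; rewrite inE.
by case: ifP; rewrite ?mulr1 ?mulr0.
Qed.

Lemma integral_box d s : 0 < d -> (\int[mu]_x (box d (s - x))%:E = (2 * d)%:E)%E.
Proof.
move=> d0; transitivity (\int[mu]_(x in ball s d) (1%R : R)%:E)%E.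
  by rewrite -(integral_mul_box d s (cst 1)); apply: eq_integral => x _; rewrite mul1r.
rewrite integral_cst//=; last exact: measurable_ball.
by rewrite mul1e lebesgue_measure_ball ?(ltW d0)// mulrC mulr_natr.
Qed.

Lemma integrable_box d s : 0 < d -> mu.-integrable setT (EFin \o (fun x => box d (s - x))).
Proof.
move=> d0; apply/integrableP; split; first by apply/measurable_EFinP; exact: measurable_boxB.
under eq_integral do rewrite /= ger0_norm ?box_ge0//.
by rewrite integral_box// ltry.
Qed.

Lemma integrable_mul_box d s (h : R -> R) : mu.-integrable setT (EFin \o h) ->
  mu.-integrable setT (EFin \o (fun x => h x * box d (s - x))).
Proof.
move=> ih; apply: (integrable_bounded_mul ih (measurable_boxB d s)) => t; exact: box_le1.
Qed.

Lemma measurable_boxT d (h : R -> R) : mu.-integrable setT (EFin \o h) ->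
  measurable_fun setT (boxT d h).
Proof.
move=> ih; apply: (@measurable_kernel_transform (fun z => box d (z.1 - z.2)) 1) => //.
  exact: measurable_boxB2.
by move=> z; exact: box_le1.
Qed.

(** Cauchy-Schwarz on a ball: integrate [2 * c * h <= h ^+ 2 + c ^+ 2] with [c]
    the mean value of [h]. *)
Lemma boxT_sqr_le d (h : R -> R) (M : R) s : 0 < d -> measurable_fun setT h ->
  (forall x, `|h x| <= M) ->
  boxT d h s ^+ 2 <= 2 * d * \int[mu]_x (h x ^+ 2 * box d (s - x)).
Proof.
move=> d0 mh hM; have ib := integrable_box s d0.
have mb := measurable_boxB d s.
have i1 : mu.-integrable setT (EFin \o (fun x => h x * box d (s - x))).
  under eq_fun do rewrite mulrC.
  exact: (integrable_bounded_mul ib mh hM).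
have i2 : mu.-integrable setT (EFin \o (fun x => h x ^+ 2 * box d (s - x))).
  under eq_fun do rewrite mulrC.
  apply: (@integrable_bounded_mul _ _ (M ^+ 2) ib); first exact: (measurable_funX _ mh).
  move=> x; rewrite ger0_norm ?sqr_ge0// -(real_normK (num_real (h x))).
  by rewrite ler_sqr ?nnegrE// (le_trans (normr_ge0 _) (hM x)).
(* The mean value of h on the ball. *)
pose c := boxT d h s / (2 * d).
have Ib : \int[mu]_x box d (s - x) = 2 * d by rewrite /Rintegral integral_box.
set J := \int[mu]_x _.
have : \int[mu]_x (2 * c * (h x * box d (s - x))) <=
       \int[mu]_x (h x ^+ 2 * box d (s - x) + c ^+ 2 * box d (s - x)).
  apply: le_Rintegral => //.
  - exact: (integrableZl measurableT (2 * c) i1).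
  - exact: (integrableD measurableT i2 (integrableZl measurableT (c ^+ 2) ib)).
  - move=> x _; have := mulr_ge0 (box_ge0 d (s - x)) (sqr_ge0 (h x - c)); nra.
rewrite (RintegralZl _ measurableT i1) RintegralD//; last exact: (integrableZl measurableT (c ^+ 2) ib).
rewrite (RintegralZl _ measurableT ib) Ib -/(boxT d h s) -/J.
have -> : boxT d h s = c * (2 * d) by rewrite /c divfK// gt_eqF// mulr_gt0.
move=> h1; have h2 : 0 <= 2 * d * (J + c ^+ 2 * (2 * d) - 2 * c * (c * (2 * d))).
  by rewrite mulr_ge0// ?subr_ge0// mulr_ge0// ltW.
nra.
Qed.

Lemma boxN d y : box d (- y) = box d y. Proof. by rewrite /box normrN. Qed.

Lemma sqint_boxT_le d (h : R -> R) (M : R) : 0 < d -> measurable_fun setT h ->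
  (forall x, `|h x| <= M) -> measurable_fun setT (boxT d h) ->
  (sqint (boxT d h) <= ((2 * d) ^+ 2)%:E * sqint h)%E.
Proof.
move=> d0 mh hM mbh.
have d2 : 0 <= 2 * d by rewrite mulr_ge0// ltW.
have mh2 : measurable_fun setT (fun x => h x ^+ 2) by exact: measurable_funX.
have mF : measurable_fun setT (fun z : R * R => (2 * d * (h z.2 ^+ 2 * box d (z.1 - z.2)))%:E).
  apply/measurable_EFinP; apply: measurable_funM => //; apply: measurable_funM.
    exact: (measurableT_comp mh2 measurable_snd).
  exact: measurable_boxB2.
have F0 z : (0 <= (2 * d * (h z.2 ^+ 2 * box d (z.1 - z.2)))%:E)%E.
  rewrite lee_fin; apply: mulr_ge0 => //; apply: mulr_ge0; [exact: sqr_ge0|exact: box_ge0].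
apply: (@le_trans _ _ (\int[mu]_s \int[mu]_x (2 * d * (h x ^+ 2 * box d (s - x)))%:E)%E).
  apply: ge0_le_integral => //.
  - by move=> s _; rewrite lee_fin sqr_ge0.
  - by apply/measurable_EFinP; exact: (measurable_funX _ mbh).
  - exact: (measurable_fun_fubini_tonelli_F (m2 := mu) _ mF F0).
  move=> s _.
  have i2 : mu.-integrable setT (EFin \o (fun x => h x ^+ 2 * box d (s - x))).
    under eq_fun do rewrite mulrC.
    apply: (@integrable_bounded_mul _ _ (M ^+ 2) (integrable_box s d0)) => //.
    move=> x; rewrite ger0_norm ?sqr_ge0// -(real_normK (num_real (h x))).
    by rewrite ler_sqr ?nnegrE// (le_trans (normr_ge0 _) (hM x)).
  have i3 : mu.-integrable setT (EFin \o (fun x => 2 * d * (h x ^+ 2 * box d (s - x)))).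
    exact: (integrableZl measurableT (2 * d) i2).
  rewrite (ge0_integral_EFin i3) lee_fin (RintegralZl _ measurableT i2).
  exact: (boxT_sqr_le s d0 mh hM).
rewrite (fubini_tonelli (m1 := mu) (m2 := mu) _ mF F0) /sqint -ge0_integralZl//; last 3 first.
- exact/measurable_EFinP.
- by move=> t _; rewrite lee_fin sqr_ge0.
- by rewrite lee_fin sqr_ge0.
rewrite le_eqVlt; apply/orP; left; apply/eqP; apply: eq_integral => x _ /=.
under eq_integral do rewrite mulrA EFinM -boxN opprB.
rewrite ge0_integralZl//; last 3 first.
- by apply/measurable_EFinP; exact: measurable_boxB.
- by move=> t _; rewrite lee_fin box_ge0.
- by rewrite lee_fin; apply: mulr_ge0 => //; exact: sqr_ge0.
by rewrite integral_box// -!EFinM; congr EFin; ring.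
Qed.

(** The mass that the Poisson kernel centred at [t] gives to the ball of radius
    [d] around [s]. *)
Definition atan_window (e d s t : R) : R :=
  2 * atan ((s + d - t) / e) - 2 * atan ((s - d - t) / e).

(** Averaging turns the unbounded family of kernels into windows bounded by
    [2 * pi] uniformly in [e]. *)
Lemma boxT_poissonT d e (a : R -> R) s : 0 < d -> 0 < e ->
  mu.-integrable setT (EFin \o a) ->
  boxT d (poissonT e a) s = \int[mu]_t (a t * atan_window e d s t).
Proof.
move=> d0 e0 ia.
have ma : measurable_fun setT a by apply/measurable_EFinP; case/integrableP: ia.
have mf : measurable_fun setT (fun z : R * R => box d (s - z.1) * (a z.2 * poisson e (z.1 - z.2))).
  apply: measurable_funM; first exact: (measurableT_comp (measurable_boxB d s) measurable_fst).
  apply: measurable_funM; first exact: (measurableT_comp ma measurable_snd).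
  exact: measurable_poissonB2.
have hb x t : `|box d (s - x) * (a t * poisson e (x - t))| <=
    `|box d (s - x)| * `|2 / e * a t|.
  rewrite normrM ler_wpM2l// (normrM (a t)) (normrM (2 / e)) mulrC ler_wpM2r//.
  by rewrite ger0_norm ?poisson_ge0// (le_trans (poisson_le _ e0))// ler_norm.
have [_] := Rfubini_dominated (f := fun x t => box d (s - x) * (a t * poisson e (x - t))) mf
  (integrable_box s d0) (integrableZl measurableT (2 / e) ia) hb.
under [in LHS]eq_Rintegral do rewrite (RintegralZl _ measurableT (integrable_mul_poisson _ e0 ia)) mulrC.
rewrite -/(boxT d _ s) => ->.
apply: eq_Rintegral => t _.
have mpt : measurable_fun setT (fun x => poisson e (x - t)).
  by under eq_fun do rewrite -poissonN opprB; exact: measurable_poissonB.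
have ip : mu.-integrable setT (EFin \o (fun x => box d (s - x) * poisson e (x - t))).
  apply: (@integrable_bounded_mul _ _ (2 / e) (integrable_box s d0) mpt).
  by move=> x; rewrite ger0_norm ?poisson_ge0// poisson_le.
under eq_Rintegral do rewrite mulrCA.
rewrite (RintegralZl _ measurableT ip); congr *%R.
rewrite /Rintegral; under eq_integral do rewrite mulrC.
rewrite (integral_mul_box d s (fun x => poisson e (x - t))).
have sd : s - d < s + d by rewrite ltrD2l; lra.
rewrite ball_itv -(@integral_itv_bndoo _ _ _ _ true false) ?integral_poisson_itv//=.
by apply/measurable_EFinP; exact: (measurable_funTS mpt).
Qed.

Lemma cvg_atan_scale (x : R) : x != 0 ->
  atan (x / n.+1%:R^-1) @[n --> \oo] --> Num.sg x * (pi / 2).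
Proof.
have pos (y : R) : 0 < y -> atan (y / n.+1%:R^-1) @[n --> \oo] --> pi / 2.
  move=> y0; apply: (@cvg_comp _ _ _ (fun n : nat => y / n.+1%:R^-1) atan _ (pinfty_nbhs R)); last exact: cvgy_atan.
  under eq_fun do rewrite invrK.
  have hn : (n.+1%:R : R) @[n --> \oo] --> +oo.
    by have := @cvgr_idn R; rewrite -(cvg_shiftn 1); under eq_fun do rewrite addn1.
  have hy : y * x @[x --> +oo] --> +oo.
    by apply: (@gt0_cvgMry R (pinfty_nbhs R) _ y id) => //; exact: cvg_id.
  exact: (cvg_comp _ _ hn hy).
rewrite neq_lt => /orP[x0|x0]; last by rewrite gtr0_sg// mul1r; exact: pos.
rewrite ltr0_sg// mulN1r.
rewrite (_ : (fun n => _) = (fun n => - atan (- x / n.+1%:R^-1))); last first.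
  by apply/funext => n; rewrite mulNr atanN opprK.
by apply: cvgN; apply: pos; rewrite oppr_gt0.
Qed.

Lemma norm_atan_window e d s t : `|atan_window e d s t| <= 2 * pi.
Proof.
rewrite /atan_window.
have := atan_ltpi2 ((s + d - t) / e); have := atan_gtNpi2 ((s + d - t) / e).
have := atan_ltpi2 ((s - d - t) / e); have := atan_gtNpi2 ((s - d - t) / e).
set x := atan _; set y := atan _ => ? ? ? ?.
by rewrite ler_norml; apply/andP; split; lra.
Qed.

Lemma measurable_atan_window e d s : 0 < e -> measurable_fun setT (atan_window e d s).
Proof.
move=> e0.
have h c : measurable_fun setT (fun t : R => 2 * atan ((c - t) / e)).
  under eq_fun do rewrite -opprB mulNr atanN mulrN.
  by apply: measurableT_comp => //; apply: continuous_measurable_fun; exact: continuous_atan_poisson.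
exact: measurable_funB (h (s + d)) (h (s - d)).
Qed.

Lemma cvg_atan_window d s t : 0 < d -> t != s + d -> t != s - d ->
  atan_window n.+1%:R^-1 d s t @[n --> \oo] --> 2 * pi * box d (s - t).
Proof.
move=> d0 t1 t2.
have n1 : s + d - t != 0 by rewrite subr_eq0 eq_sym.
have n2 : s - d - t != 0 by rewrite subr_eq0 eq_sym.
have -> : 2 * pi * box d (s - t) = 2 * (Num.sg (s + d - t) * (pi / 2)) - 2 * (Num.sg (s - d - t) * (pi / 2)).
  rewrite /box ltr_norml.
  have [h1|h1|h1] := ltgtP (s + d - t) 0; last by rewrite h1 eqxx in n1.
    rewrite (ltr0_sg h1) (@ltr0_sg _ (s - d - t)); last by lra.
    by rewrite (_ : - d < s - t = false) /= ?mulr0 ?subrr//; apply/negbTE; rewrite -leNgt; lra.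
  have [h2|h2|h2] := ltgtP (s - d - t) 0; last by rewrite h2 eqxx in n2.
    rewrite (ltr0_sg h2) (gtr0_sg h1) (_ : - d < s - t) /=; last by lra.
    by rewrite (_ : s - t < d) /=; [field|lra].
  rewrite (gtr0_sg h1) (gtr0_sg h2) (_ : s - t < d = false) ?andbF ?mulr0 ?subrr//.
  by apply/negbTE; rewrite -leNgt; lra.
by apply: cvgB; (apply: cvgM; [exact: cvg_cst|exact: cvg_atan_scale]).
Qed.

(** The windows converge to [2 * pi] times the indicator of the ball, except at
    its two endpoints, and dominated convergence applies. *)
Lemma cvg_boxT_poissonT d (a : R -> R) s : 0 < d -> mu.-integrable setT (EFin \o a) ->
  boxT d (poissonT n.+1%:R^-1 a) s @[n --> \oo] --> 2 * pi * boxT d a s.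
Proof.
move=> d0 ia.
have ma : measurable_fun setT a by apply/measurable_EFinP; case/integrableP: ia.
have n0 n : 0 < n.+1%:R^-1 :> R by rewrite invr_gt0.
under eq_fun do rewrite (boxT_poissonT s d0 (n0 _) ia).
have iw n : mu.-integrable setT (EFin \o (fun t => a t * atan_window n.+1%:R^-1 d s t)).
  apply: (integrable_bounded_mul ia (measurable_atan_window d s (n0 n))).
  by move=> t; exact: norm_atan_window.
have il : mu.-integrable setT (EFin \o (fun t => a t * (2 * pi * box d (s - t)))).
  under eq_fun do rewrite mulrCA.
  exact: (integrableZl measurableT (2 * pi) (integrable_mul_box d s ia)).
have nm (c : R) : {ae mu, forall t : R, t != c}.
  exists [set c]; split => //; first exact: lebesgue_measure_set1.
  by move=> t /= /negP; rewrite negbK => /eqP.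
have H1 : {ae mu, forall t, setT t ->
    (a t * atan_window n.+1%:R^-1 d s t)%:E @[n --> \oo] --> (a t * (2 * pi * box d (s - t)))%:E}.
  have := nm (s - d); apply: filter_app; first exact: (ae_filter_ringOfSetsType mu).
  have := nm (s + d); apply: filterS; first exact: (ae_filter_ringOfSetsType mu).
  move=> t t1 t2 _; apply: cvg_EFin; first exact: nearW.
  by apply: cvgM; [exact: cvg_cst|exact: cvg_atan_window].
have H2 : {ae mu, forall t n, setT t ->
    (`|(a t * atan_window n.+1%:R^-1 d s t)%:E| <= (2 * pi * `|a t|)%:E)%E}.
  apply: aeW => t n _ /=; rewrite lee_fin normrM mulrC ler_wpM2r//.
  exact: norm_atan_window.
have [_ _ H] := @dominated_convergence _ _ _ mu setT measurableT
  (fun n t => (a t * atan_window n.+1%:R^-1 d s t)%:E)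
  (fun t => (a t * (2 * pi * box d (s - t)))%:E) (fun t => (2 * pi * `|a t|)%:E)
  (fun n => measurable_int mu (iw n)) (measurable_int mu il) H1
  (integrableZl measurableT (2 * pi) (integrable_norm ia)) H2.
have -> : 2 * pi * boxT d a s = fine (\int[mu]_t (a t * (2 * pi * box d (s - t)))%:E)%E.
  rewrite -/(Rintegral mu setT (fun t => a t * (2 * pi * box d (s - t)))).
  under eq_Rintegral do rewrite mulrCA.
  by rewrite (RintegralZl _ measurableT (integrable_mul_box d s ia)).
by apply: fine_cvg; rewrite fineK ?(integrable_fin_num measurableT il).
Qed.

(** For real [a] the transform at [w] is [cosT a w - i sinT a w]. *)
Definition fourier_energy (a : R -> R) : \bar R :=
  (\int[mu]_w (cosT a w ^+ 2 + sinT a w ^+ 2)%:E)%E.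

Lemma sqintZ (c : R) (a : R -> R) : measurable_fun setT a ->
  (sqint (fun t => c * a t)%R = (c ^+ 2)%:E * sqint a)%E.
Proof.
move=> ma; rewrite /sqint -ge0_integralZl//.
- by apply: eq_integral => t _; rewrite exprMn EFinM.
- by apply/measurable_EFinP; exact: measurable_funX.
- by move=> t _; rewrite lee_fin sqr_ge0.
- by rewrite lee_fin sqr_ge0.
Qed.

Lemma measurable_boxT_poissonT d e (a : R -> R) : 0 < d -> 0 < e ->
  mu.-integrable setT (EFin \o a) -> measurable_fun setT (boxT d (poissonT e a)).
Proof.
move=> d0 e0 ia.
rewrite (_ : boxT d _ = fun s => \int[mu]_t (a t * atan_window e d s t)); last first.
  by apply/funext => s; exact: boxT_poissonT.
apply: (@measurable_kernel_transform (fun z => atan_window e d z.1 z.2) (2 * pi)) => //; last first.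
  by move=> z; exact: norm_atan_window.
have h c : measurable_fun setT (fun z : R * R => 2 * atan ((z.1 + c - z.2) / e)).
  apply: measurable_funM => //.
  apply: (measurableT_comp (continuous_measurable_fun (@continuous_atan R))).
  apply: measurable_funM => //; apply: measurable_funB; last exact: measurable_snd.
  by apply: measurable_funD => //; exact: measurable_fst.
exact: measurable_funB (h d) (h (- d)).
Qed.

Lemma sqint_boxT_le_energy d (a : R -> R) : 0 < d -> mu.-integrable setT (EFin \o a) ->
  (sqint (boxT d a) <= ((2 * d) ^+ 2 / pi)%:E * fourier_energy a)%E.
Proof.
move=> d0 ia.
have n0 n : 0 < n.+1%:R^-1 :> R by rewrite invr_gt0.
have mb := measurable_boxT d ia.
have key : (sqint (fun s => 2 * pi * boxT d a s)%R <=
    ((2 * d) ^+ 2)%:E * ((4 * pi)%:E * fourier_energy a))%E.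
  apply: (@fatou_le (fun n s => boxT d (poissonT n.+1%:R^-1 a) s ^+ 2)).
  - by move=> n; apply: measurable_funX; exact: measurable_boxT_poissonT.
  - by apply: measurable_funX; exact: measurable_funM.
  - by move=> n x; exact: sqr_ge0.
  - by move=> x; exact: sqr_ge0.
  - apply: aeW => s; rewrite expr2; under eq_fun do rewrite expr2.
    by apply: cvgM; exact: cvg_boxT_poissonT.
  - move=> n; have mp := measurable_poissonT (n0 n) ia.
    have mbp := measurable_boxT_poissonT d0 (n0 n) ia.
    apply: (le_trans (sqint_boxT_le d0 mp (fun s => poissonT_bounded s (n0 n) ia) mbp)).
    apply: lee_wpmul2l; first by rewrite lee_fin sqr_ge0.
    exact: poissonT_energy.
have p0 : pi != 0 :> R by rewrite gt_eqF// pi_gt0.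
rewrite sqintZ// in key.
have := lee_wpmul2l (x := (((2 * pi) ^+ 2)^-1)%:E) _ key.
rewrite !muleA -!EFinM mulVf ?mul1e ?expf_neq0 ?mulf_neq0// => h.
apply: le_trans (h _) _; first by rewrite lee_fin invr_ge0 sqr_ge0.
rewrite le_eqVlt; apply/orP; left; apply/eqP; congr (_%:E * _)%E.
by move: p0; generalize (@pi R) => P p0; field.
Qed.

(** Plancherel, lower bound: [a] is almost everywhere the limit of its normalized
    local averages, by Lebesgue differentiation. *)
Lemma sqint_le_energy (a : R -> R) : mu.-integrable setT (EFin \o a) ->
  (sqint a <= (pi^-1)%:E * fourier_energy a)%E.
Proof.
move=> ia.
have ma : measurable_fun setT a by apply/measurable_EFinP; case/integrableP: ia.
have n0 n : 0 < n.+1%:R^-1 :> R by rewrite invr_gt0.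
have la : locally_integrable setT a by apply: open_integrable_locally => //; exact: openT.
pose E (x : R) n : set R := ball x n.+1%:R^-1.
have hE x : nicely_shrinking x (E x).
  split; first by move=> n; exact: measurable_ball.
  exists (1, fun n => PosNum (n0 n)); split => //=.
  - exact: cvg_invSn.
  - by move=> n; exact: subset_refl.
  - by move=> n; rewrite mul1e.
apply: (@fatou_le (fun n s => ((2 * n.+1%:R^-1)^-1 * boxT n.+1%:R^-1 a s) ^+ 2)) => //.
- move=> n; apply: measurable_funX; apply: measurable_funM => //; exact: measurable_boxT.
- by apply: measurable_funX.
- by move=> n x; exact: sqr_ge0.
- by move=> x; exact: sqr_ge0.
- have := lebesgue_differentiation la; apply: filterS; first exact: (ae_filter_ringOfSetsType mu).
  move=> x lx; rewrite expr2; under eq_fun do rewrite expr2.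
  have h := nice_lebesgue_differentiation hE la lx.
  suff h2 : (2 * n.+1%:R^-1)^-1 * boxT n.+1%:R^-1 a x @[n --> \oo] --> a x by exact: cvgM.
  rewrite (_ : (fun n => _) = (fun n => fine ((mu (E x n))^-1 * \int[mu]_(y in E x n) (a y)%:E)%E)); first exact: (fine_cvg h).
  apply/funext => n.
  rewrite /E -integral_mul_box (ge0_integral_EFin (integrable_mul_box _ _ ia)).
  rewrite lebesgue_measure_ball ?(ltW (n0 n))// inver mulrn_eq0/= gt_eqF//=.
  by rewrite /boxT; congr (_^-1 * _); rewrite -[RHS]mulr_natl.
- move=> n; rewrite -/(sqint (fun s => (2 * n.+1%:R^-1)^-1 * boxT n.+1%:R^-1 a s)).
  rewrite sqintZ; last exact: measurable_boxT.
  apply: (@le_trans _ _ (((2 * n.+1%:R^-1)^-1 ^+ 2)%:E * (((2 * n.+1%:R^-1) ^+ 2 / pi)%:E * fourier_energy a))%E).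
    apply: lee_wpmul2l; first by rewrite lee_fin sqr_ge0.
    exact: sqint_boxT_le_energy.
  rewrite muleA -EFinM le_eqVlt; apply/orP; left; apply/eqP; congr (_%:E * _)%E.
  by rewrite mulrA -exprMn mulVf ?expr1n ?mul1r// gt_eqF// mulr_gt0.
Qed.

Lemma integral_reflect (G : R -> \bar R) : measurable_fun setT G -> (forall x, 0 <= G x)%E ->
  (\int[mu]_w G (- w)%R = \int[mu]_w G w)%E.
Proof.
move=> mG G0.
have mN : measurable_fun setT (-%R : measurableTypeR R -> measurableTypeR R).
  by apply: continuous_measurable_fun; exact: opp_continuous.
transitivity (\int[pushforward mu (-%R : measurableTypeR R -> measurableTypeR R)]_w G w)%E.
  by rewrite (ge0_integral_pushforward mN).
by apply: eq_measure_integral => //= A mA _; exact: lebesgue_measureN.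
Qed.

Lemma cosT_even (a : R -> R) w : cosT a (- w) = cosT a w.
Proof. by apply: eq_Rintegral => t _; rewrite mulNr cosN. Qed.

Lemma sinT_odd (a : R -> R) w : mu.-integrable setT (EFin \o a) ->
  sinT a (- w) = - sinT a w.
Proof.
move=> ia; rewrite -[RHS]mulN1r -(RintegralZl _ measurableT (integrable_mul_sin w ia)).
by apply: eq_Rintegral => t _; rewrite mulNr sinN mulrN mulN1r.
Qed.

Lemma sqint_add (f g : R -> R) : measurable_fun setT f -> measurable_fun setT g ->
  (sqint f + sqint g = \int[mu]_w (f w ^+ 2 + g w ^+ 2)%:E)%E.
Proof.
move=> mf mg; rewrite /sqint -ge0_integralD//.
- by move=> w _; rewrite lee_fin sqr_ge0.
- by apply/measurable_EFinP; exact: (measurable_funX _ mf).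
- by move=> w _; rewrite lee_fin sqr_ge0.
- by apply/measurable_EFinP; exact: (measurable_funX _ mg).
Qed.

(** The transform of [a + i b] is [A + i B] with [A = cosT a + sinT b] and
    [B = cosT b - sinT a]; the cross terms of [A ^+ 2 + B ^+ 2] are odd. *)
Lemma complex_fourier_energy (a b : R -> R) :
  mu.-integrable setT (EFin \o a) -> mu.-integrable setT (EFin \o b) ->
  (sqint (fun w => cosT a w + sinT b w)%R + sqint (fun w => cosT b w - sinT a w)%R =
   fourier_energy a + fourier_energy b)%E.
Proof.
move=> ia ib.
have ca := measurable_cosT ia; have sa := measurable_sinT ia.
have cb := measurable_cosT ib; have sb := measurable_sinT ib.
pose A w := cosT a w + sinT b w; pose B w := cosT b w - sinT a w.
have mA : measurable_fun setT A by exact: measurable_funD.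
have mB : measurable_fun setT B by exact: measurable_funB.
pose G w := (A w ^+ 2 + B w ^+ 2)%:E.
have mG : measurable_fun setT G by apply/measurable_EFinP; exact: measurable_fun_sqD.
have G0 w : (0 <= G w)%E by rewrite lee_fin addr_ge0// sqr_ge0.
rewrite (sqint_add mA mB).
pose H w := ((cosT a w ^+ 2 + sinT a w ^+ 2) + (cosT b w ^+ 2 + sinT b w ^+ 2))%:E.
have mH1 := measurable_fun_sqD ca sa; have mH2 := measurable_fun_sqD cb sb.
have mH : measurable_fun setT H by apply/measurable_EFinP; exact: (measurable_funD mH1 mH2).
have H0 w : (0 <= H w)%E by rewrite lee_fin !addr_ge0// sqr_ge0.
have -> : (fourier_energy a + fourier_energy b = \int[mu]_w H w)%E.
  rewrite /fourier_energy -ge0_integralD//; last 4 first.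
  - by move=> w _; rewrite lee_fin addr_ge0// sqr_ge0.
  - exact/measurable_EFinP.
  - by move=> w _; rewrite lee_fin addr_ge0// sqr_ge0.
  - exact/measurable_EFinP.
have mGN : measurable_fun setT (fun w => G (- w)) by apply: (measurableT_comp mG); apply: continuous_measurable_fun; exact: opp_continuous.
have GH w : (G w + G (- w)%R = 2%:E * H w)%E.
  rewrite /G /A /B !cosT_even !sinT_odd// -EFinD -EFinM; congr EFin; ring.
have h : (2%:E * \int[mu]_w G w = 2%:E * \int[mu]_w H w)%E.
  rewrite -[RHS]ge0_integralZl//.
  transitivity (\int[mu]_w (G w + G (- w)%R))%E.
    by rewrite ge0_integralD// integral_reflect// -mule2n -mule_natl.
  by apply: eq_integral => w _.
have := congr1 (fun z => (2^-1)%:E * z)%E h.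
by rewrite !muleA -!EFinM mulVf// !mul1e.
Qed.

(** * Completeness of L2 *)

(** The hypothesis bounds the increments by a geometric sequence of ratio 1/2. *)
Lemma cvg_of_weighted_sqr (u : nat -> R) (M : R) :
  (forall n, 4 ^+ n * (u n.+1 - u n) ^+ 2 <= M) -> cvgn u.
Proof.
move=> uM.
have M0 : 0 <= M.
  by apply: le_trans (uM 0%N); rewrite mulr_ge0 ?sqr_ge0// exprn_ge0.
have step n : `|u n.+1 - u n| <= (1 + M) * 2^-1 ^+ n.
  rewrite -ler_sqr ?nnegrE// ?mulr_ge0 ?exprn_ge0 ?addr_ge0//.
  rewrite real_normK ?num_real// exprMn -exprM mulnC exprM.
  have -> : (2^-1 : R) ^+ 2 = 4^-1 by field.
  rewrite exprVn ler_pdivlMr ?exprn_gt0// mulrC (le_trans (uM n))//.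
  by have := M0; nra.
have : cvgn [series `|u k.+1 - u k|]_k.
  apply: (@series_le_cvg _ _ (geometric (1 + M) 2^-1)) => //.
  - by move=> n /=; exact: normr_ge0.
  - by move=> n; rewrite /= mulr_ge0 ?exprn_ge0 ?addr_ge0.
  - apply: is_cvg_geometric_series; by rewrite ger0_norm// invf_lt1// ltr1n.
move=> /normed_cvg h.
rewrite (_ : u = (fun n => u 0%N + series (telescope u) n)); last first.
  by apply/funext => n; exact: eq_sum_telescope.
by apply: is_cvgD; [exact: is_cvg_cst|exact: h].
Qed.

(** The functions [4 ^+ n * (f n.+1 - f n) ^+ 2] have integrals at most
    [2^-1 ^+ n], so their sum is finite almost everywhere and [f] converges
    there; Fatou's lemma gives the distance to the limit. *)
Lemma sqint_complete (f : nat -> R -> R) :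
  (forall n, measurable_fun setT (f n)) ->
  (forall n m, (n <= m)%N -> (sqint (f m \- f n)%R <= (8^-1 ^+ n)%:E)%E) ->
  exists g : R -> R, [/\ measurable_fun setT g,
    {ae mu, forall x, f n x @[n --> \oo] --> g x} &
    forall n, (sqint (g \- f n)%R <= (8^-1 ^+ n)%:E)%E].
Proof.
move=> mf fC.
pose D n x := 4 ^+ n * (f n.+1 x - f n x) ^+ 2.
have D0 n x : 0 <= D n x by rewrite mulr_ge0 ?sqr_ge0// exprn_ge0.
have mB m n : measurable_fun setT (f m \- f n) by exact: measurable_funB.
have mD n : measurable_fun setT (D n).
  by apply: measurable_funM => //; apply: measurable_funX; exact: mB.
pose S x := (\sum_(0 <= n <oo) (D n x)%:E)%E.
have mDE n : measurable_fun setT (EFin \o D n) by exact/measurable_EFinP.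
have mS : measurable_fun setT S.
  apply: (@ge0_emeasurable_sum _ _ _ setT (fun n x => (D n x)%:E) xpredT) => //.
    by move=> k x _ _; rewrite lee_fin.
  by move=> k _; exact: mDE.
have S0 x : (0 <= S x)%E by apply: nneseries_ge0 => n _ _; rewrite lee_fin.
have IS : (\int[mu]_x S x < +oo)%E.
  rewrite /S integral_nneseries//; last by move=> n x _; rewrite lee_fin.
  apply: (@le_lt_trans _ _ (\sum_(0 <= n <oo) (2 / (2 ^ (n + 1))%:R : R)%:E)%E).
    apply: lee_nneseries => n _; first by move=> _; apply: integral_ge0 => x _; rewrite lee_fin.
    rewrite /D; under eq_integral do rewrite EFinM.
    rewrite ge0_integralZl//; last 2 first.
    - by apply/measurable_EFinP; apply: measurable_funX; exact: mB.
    - by move=> x _; rewrite lee_fin sqr_ge0.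
    apply: (@le_trans _ _ ((4 ^+ n)%:E * (8^-1 ^+ n)%:E)%E).
      by apply: lee_wpmul2l; [rewrite lee_fin exprn_ge0|exact: fC].
    rewrite -EFinM -exprMn lee_fin; rewrite natrX exprD expr1 invfM mulrCA divff// mulr1.
    by rewrite -exprVn; suff -> : 4 * 8^-1 = 2^-1 :> R by []; field.
  have /cvg_lim -> // := @cvg_geometric_eseries_half R 2 0.
  exact: ltry.
have finS : {ae mu, forall x, S x \is a fin_num}.
  have iS : mu.-integrable setT S.
    apply/integrableP; split => //.
    by under eq_integral do rewrite gee0_abs//.
  have := integrable_ae measurableT iS; apply: filterS.
  by move=> x /(_ I).
(* The upper limit is measurable everywhere and is the limit where f converges. *)
pose g x := fine (limn_esup (fun n => (f n x)%:E)).
have mg : measurable_fun setT g.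
  apply: (measurableT_comp (f := fine)) => //.
  apply: (@measurable_fun_limn_esup _ _ _ _ (fun n x => (f n x)%:E)) => n.
  exact/measurable_EFinP.
have cv : {ae mu, forall x, f n x @[n --> \oo] --> g x}.
  move: finS; apply: filterS; first exact: (ae_filter_ringOfSetsType mu).
  move=> x Sx.
  have cf : cvgn (fun n => f n x).
    apply: (@cvg_of_weighted_sqr _ (fine (S x))) => n.
    rewrite -lee_fin fineK//.
    apply: (@le_trans _ _ (\sum_(0 <= k < n.+1) (D k x)%:E)%E).
      rewrite big_nat_recr//= leeDr//.
      by apply: sume_ge0 => k _; rewrite lee_fin.
    by apply: nneseries_lim_ge => k _; rewrite lee_fin.
  have cE : (f n x)%:E @[n --> \oo] --> (limn (fun n => f n x))%:E.
    by apply: cvg_EFin; [exact: nearW|exact: cf].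
  by rewrite /g (cvg_limn_einf_sup cE).2 /=.
exists g; split => // n.
apply: (@fatou_le (fun k x => (f (n + k)%N x - f n x) ^+ 2)) => //.
- by move=> k; apply: measurable_funX; exact: mB.
- by apply: measurable_funX; exact: measurable_funB.
- by move=> k x; exact: sqr_ge0.
- by move=> x; exact: sqr_ge0.
- move: cv; apply: filterS; first exact: (ae_filter_ringOfSetsType mu).
  move=> x fx; have h : f (n + k)%N x - f n x @[k --> \oo] --> g x - f n x.
    apply: cvgB; last exact: cvg_cst.
    by under eq_fun do rewrite addnC; rewrite -(cvg_shiftn n) in fx.
  by rewrite expr2; under eq_fun do rewrite expr2; exact: cvgM.
- by move=> k; apply: fC; exact: leq_addr.
Qed.

(** * Energy of vector-valued signals *)

Definition nsq (k : nat) (v : 'cV[R[i]]_k) : R :=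
  \sum_(j < k) (complex.Re (v j ord0) ^+ 2 + complex.Im (v j ord0) ^+ 2).

Definition energy (k : nat) (f : signal R k) : \bar R := (\int[mu]_t (nsq (f t))%:E)%E.

Definition reS (k : nat) (f : signal R k) (j : 'I_k) (t : R) : R := complex.Re (f t j ord0).
Definition imS (k : nat) (f : signal R k) (j : 'I_k) (t : R) : R := complex.Im (f t j ord0).

Definition measurable_signal (k : nat) (f : signal R k) : Prop :=
  forall j, measurable_fun setT (reS f j) /\ measurable_fun setT (imS f j).

Lemma nsq_ge0 (k : nat) (v : 'cV[R[i]]_k) : 0 <= nsq v.
Proof. by apply: sumr_ge0 => j _; rewrite addr_ge0// sqr_ge0. Qed.

Lemma nsq0 (k : nat) : nsq (0 : 'cV[R[i]]_k) = 0.
Proof. by rewrite /nsq big1// => j _; rewrite mxE /= expr0n addr0. Qed.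

Lemma cenorm_sqr (k : nat) (v : 'cV[R[i]]_k) : cenorm v ^+ 2 = nsq v.
Proof. by rewrite sqr_sqrtr// nsq_ge0. Qed.

Lemma nsqD_le (k : nat) (u v : 'cV[R[i]]_k) : nsq (u + v) <= 2 * (nsq u + nsq v).
Proof.
rewrite /nsq -big_split/= mulr_sumr; apply: ler_sum => j _; rewrite !mxE.
case: (u j ord0) (v j ord0) => [x y] [z w] /=.
have := sqr_ge0 (x - z); have := sqr_ge0 (y - w); nra.
Qed.

Lemma nsqZ (k : nat) (c : R[i]) (v : 'cV[R[i]]_k) :
  nsq (c *: v) = (complex.Re c ^+ 2 + complex.Im c ^+ 2) * nsq v.
Proof.
rewrite /nsq mulr_sumr; apply: eq_bigr => j _; rewrite mxE.
by case: c (v j ord0) => [x y] [z w] /=; ring.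
Qed.

Lemma nsqN (k : nat) (v : 'cV[R[i]]_k) : nsq (- v) = nsq v.
Proof. by rewrite -scaleN1r nsqZ /= oppr0 sqrrN expr1n expr0n addr0 mul1r. Qed.

Lemma nsq_parallelogram (k : nat) (u v : 'cV[R[i]]_k) :
  nsq (u + v) + nsq (u - v) = 2 * nsq u + 2 * nsq v.
Proof.
rewrite /nsq !mulr_sumr -!big_split/=; apply: eq_bigr => j _; rewrite !mxE.
by case: (u j ord0) (v j ord0) => [x y] [z w] /=; ring.
Qed.

Lemma measurable_nsq (k : nat) (f : signal R k) : measurable_signal f ->
  measurable_fun setT (fun t => nsq (f t)).
Proof.
move=> mf; apply: measurable_sum => j; have [mr mi] := mf j.
exact: (measurable_fun_sqD mr mi).
Qed.

Lemma energy_ge0 (k : nat) (f : signal R k) : (0 <= energy f)%E.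
Proof. by apply: integral_ge0 => t _; rewrite lee_fin nsq_ge0. Qed.

Lemma energy_sum (k : nat) (f : signal R k) : measurable_signal f ->
  energy f = (\sum_(j < k) (sqint (reS f j) + sqint (imS f j)))%E.
Proof.
move=> mf; rewrite /energy /nsq.
under eq_integral do rewrite -sumEFin.
rewrite ge0_integral_sum//.
- by apply: eq_bigr => j _; have [mr mi] := mf j; rewrite (sqint_add mr mi).
- move=> j; have [mr mi] := mf j.
  by apply/measurable_EFinP; exact: (measurable_fun_sqD mr mi).
- by move=> j t _; rewrite lee_fin addr_ge0// sqr_ge0.
Qed.

Lemma L2normE (k : nat) (f : signal R k) : L2norm f = poweR (energy f) (2^-1).
Proof.
rewrite /L2norm unlock /Lnorm /energy; congr poweR.
apply: eq_integral => t _; rewrite abse_EFin poweR_EFin; congr EFin.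
by rewrite ger0_norm ?sqrtr_ge0// powR_mulrn ?sqrtr_ge0// cenorm_sqr.
Qed.

Lemma L2P (k : nat) (f : signal R k) :
  L2 f <-> measurable_signal f /\ (energy f < +oo)%E.
Proof.
rewrite /L2 L2normE; split=> -[mf h]; split=> //.
  by apply: (lty_poweRy _ h).
by apply: poweR_lty.
Qed.

Lemma measurable_signalD (k : nat) (f g : signal R k) (c : R[i]) :
  measurable_signal f -> measurable_signal g ->
  measurable_signal (fun t => f t + c *: g t).
Proof.
move=> mf mg j; have [fr fi] := mf j; have [gr gi] := mg j; split.
  rewrite (_ : reS _ j = fun t => reS f j t + (complex.Re c * reS g j t - complex.Im c * imS g j t)).
    by apply: measurable_funD => //; apply: measurable_funB; apply: measurable_funM.
  by apply/funext => t; rewrite /reS /imS !mxE; case: c (f t j ord0) (g t j ord0) => [? ?] [? ?] [? ?].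
rewrite (_ : imS _ j = fun t => imS f j t + (complex.Re c * imS g j t + complex.Im c * reS g j t)).
  by apply: measurable_funD => //; apply: measurable_funD; apply: measurable_funM.
by apply/funext => t; rewrite /reS /imS !mxE; case: c (f t j ord0) (g t j ord0) => [? ?] [? ?] [? ?].
Qed.

Lemma signal_subE (k : nat) (f g : signal R k) : f \- g = (fun t => f t + (-1) *: g t).
Proof. by apply/funext => t /=; rewrite scaleN1r. Qed.

Lemma measurable_signalB (k : nat) (f g : signal R k) :
  measurable_signal f -> measurable_signal g -> measurable_signal (f \- g).
Proof. by move=> mf mg; rewrite signal_subE; exact: measurable_signalD. Qed.

Lemma le_energy (k k' : nat) (f : signal R k) (g : signal R k') :
  measurable_signal f -> measurable_signal g ->
  (forall t, nsq (f t) <= nsq (g t)) -> (energy f <= energy g)%E.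
Proof.
move=> mf mg fg; apply: ge0_le_integral => //.
- by move=> t _; rewrite lee_fin nsq_ge0.
- by apply/measurable_EFinP; exact: measurable_nsq.
- by apply/measurable_EFinP; exact: measurable_nsq.
- by move=> t _; rewrite lee_fin.
Qed.

Lemma energyD_le (k : nat) (f g : signal R k) :
  measurable_signal f -> measurable_signal g ->
  (energy (fun t => f t + g t)%R <= 2%:E * (energy f + energy g))%E.
Proof.
move=> mf mg; have mf' := measurable_nsq mf; have mg' := measurable_nsq mg.
have mfg : measurable_signal (fun t => f t + g t).
  by have := measurable_signalD 1 mf mg; under [X in measurable_signal X -> _]eq_fun do rewrite scale1r.
rewrite /energy -ge0_integralD//; last 4 first.
- by move=> t _; rewrite lee_fin nsq_ge0.
- exact/measurable_EFinP.
- by move=> t _; rewrite lee_fin nsq_ge0.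
- exact/measurable_EFinP.
rewrite -ge0_integralZl//; last 2 first.
- by apply: emeasurable_funD; exact/measurable_EFinP.
- by move=> t _; rewrite -EFinD lee_fin addr_ge0// nsq_ge0.
apply: ge0_le_integral => //.
- by move=> t _; rewrite lee_fin nsq_ge0.
- by apply/measurable_EFinP; exact: measurable_nsq.
- by apply/measurable_EFinP; apply: measurable_funM => //; exact: measurable_funD.
- by move=> t _; rewrite -EFinD -EFinM lee_fin nsqD_le.
Qed.

Lemma energyZ (k : nat) (c : R[i]) (f : signal R k) : measurable_signal f ->
  energy (fun t => c *: f t)%R =
  ((complex.Re c ^+ 2 + complex.Im c ^+ 2)%:E * energy f)%E.
Proof.
move=> mf; rewrite /energy -ge0_integralZl//.
- by apply: eq_integral => t _; rewrite nsqZ EFinM.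
- by apply/measurable_EFinP; exact: measurable_nsq.
- by move=> t _; rewrite lee_fin nsq_ge0.
- by rewrite lee_fin addr_ge0// sqr_ge0.
Qed.

Lemma energyN (k : nat) (f g : signal R k) : energy (f \- g) = energy (g \- f).
Proof. by apply: eq_integral => t _ /=; rewrite -nsqN opprB. Qed.

Lemma energyB_le (k : nat) (f g h : signal R k) :
  measurable_signal f -> measurable_signal g -> measurable_signal h ->
  (energy (f \- h)%R <= 2%:E * (energy (f \- g)%R + energy (g \- h)%R))%E.
Proof.
move=> mf mg mh.
have -> : f \- h = fun t => (f \- g) t + (g \- h) t.
  by apply/funext => t /=; rewrite addrA subrK.
by apply: energyD_le; exact: measurable_signalB.
Qed.

Lemma ae_imply (P Q : R -> Prop) : (forall t, P t -> Q t) ->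
  {ae mu, forall t, P t} -> {ae mu, forall t, Q t}.
Proof. by move=> PQ; apply: filterS; first exact: (ae_filter_ringOfSetsType mu). Qed.

Lemma ae_imply2 (P Q S : R -> Prop) : (forall t, P t -> Q t -> S t) ->
  {ae mu, forall t, P t} -> {ae mu, forall t, Q t} -> {ae mu, forall t, S t}.
Proof. by move=> PQ; apply: filterS2; first exact: (ae_filter_ringOfSetsType mu). Qed.

Lemma ae_eq_forall (I : finType) (P : I -> R -> Prop) :
  (forall i, {ae mu, forall t, P i t}) -> {ae mu, forall t, forall i, P i t}.
Proof.
move=> aeP.
suff : {ae mu, forall t, forall i, i \in enum I -> P i t}.
  by apply: ae_imply => t Pt i; apply: Pt; rewrite mem_enum.
elim: (enum I) => [|i s IH]; first exact: aeW.
apply: ae_imply2 (aeP i) IH => t Pi Ps j; rewrite inE => /orP[/eqP ->//|]; exact: Ps.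
Qed.

Lemma sqint_reS_le (k : nat) (f : signal R k) j : measurable_signal f ->
  (sqint (reS f j) <= energy f)%E /\ (sqint (imS f j) <= energy f)%E.
Proof.
move=> mf; have [mr mi] := mf j.
have mX (h : R -> R) : measurable_fun setT h -> measurable_fun setT (fun t => (h t ^+ 2)%:E).
  by move=> mh; apply/measurable_EFinP; exact: (measurable_funX _ mh).
have mn : measurable_fun setT (fun t => (nsq (f t))%:E).
  by apply/measurable_EFinP; exact: measurable_nsq.
have le_nsq t : reS f j t ^+ 2 + imS f j t ^+ 2 <= nsq (f t).
  rewrite /nsq (bigD1 j)//= lerDl; apply: sumr_ge0 => i _.
  by rewrite addr_ge0// sqr_ge0.
split; apply: ge0_le_integral => //.
- by move=> t _; rewrite lee_fin sqr_ge0.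
- exact: mX.
- by move=> t _; rewrite lee_fin (le_trans _ (le_nsq t))// lerDl sqr_ge0.
- by move=> t _; rewrite lee_fin sqr_ge0.
- exact: mX.
- by move=> t _; rewrite lee_fin (le_trans _ (le_nsq t))// lerDr sqr_ge0.
Qed.

Definition signal_of (k : nat) (a b : 'I_k -> R -> R) : signal R k :=
  fun t => \col_j (a j t +i* b j t)%C.

Lemma reS_signal_of (k : nat) (a b : 'I_k -> R -> R) j : reS (signal_of a b) j = a j.
Proof. by apply/funext => t; rewrite /reS mxE. Qed.

Lemma imS_signal_of (k : nat) (a b : 'I_k -> R -> R) j : imS (signal_of a b) j = b j.
Proof. by apply/funext => t; rewrite /imS mxE. Qed.

Lemma reSB (k : nat) (f g : signal R k) j : reS (f \- g) j = reS f j \- reS g j.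
Proof.
apply/funext => t; rewrite /reS !mxE /=.
by case: (f t j ord0) (g t j ord0) => [? ?] [? ?].
Qed.

Lemma imSB (k : nat) (f g : signal R k) j : imS (f \- g) j = imS f j \- imS g j.
Proof.
apply/funext => t; rewrite /imS !mxE /=.
by case: (f t j ord0) (g t j ord0) => [? ?] [? ?].
Qed.

(** Coordinatewise completeness: a signal has [2 * k] real coordinates. *)
Lemma energy_complete (k : nat) (f : nat -> signal R k) :
  (forall n, measurable_signal (f n)) ->
  (forall n m, (n <= m)%N -> (energy (f m \- f n)%R <= (8^-1 ^+ n)%:E)%E) ->
  exists g : signal R k, [/\ measurable_signal g,
    {ae mu, forall t, forall j, reS (f n) j t @[n --> \oo] --> reS g j t /\
                                imS (f n) j t @[n --> \oo] --> imS g j t} &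
    forall n, (energy (g \- f n)%R <= (2 * k%:R * 8^-1 ^+ n)%:E)%E].
Proof.
move=> mf fC.
have mB n m : measurable_signal (f m \- f n) by exact: measurable_signalB.
have hr j : exists g : R -> R, [/\ measurable_fun setT g,
    {ae mu, forall x, reS (f n) j x @[n --> \oo] --> g x} &
    forall n, (sqint (g \- reS (f n) j)%R <= (8^-1 ^+ n)%:E)%E].
  apply: sqint_complete => [n|n m nm]; first by have [] := mf n j.
  by rewrite -reSB; apply: le_trans (fC _ _ nm); have [] := sqint_reS_le j (mB n m).
have hi j : exists g : R -> R, [/\ measurable_fun setT g,
    {ae mu, forall x, imS (f n) j x @[n --> \oo] --> g x} &
    forall n, (sqint (g \- imS (f n) j)%R <= (8^-1 ^+ n)%:E)%E].
  apply: sqint_complete => [n|n m nm]; first by have [] := mf n j.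
  by rewrite -imSB; apply: le_trans (fC _ _ nm); have [] := sqint_reS_le j (mB n m).
have [a ha] := choice hr; have [b hb] := choice hi.
exists (signal_of a b).
have mab : measurable_signal (signal_of a b).
  by move=> j; rewrite reS_signal_of imS_signal_of; case: (ha j) (hb j) => ? _ _ [].
split => //.
- apply: ae_eq_forall => j.
  case: (ha j) (hb j) => _ ca _ [_ cb _].
  apply: ae_imply2 ca cb => t ca cb.
  by rewrite reS_signal_of imS_signal_of.
- move=> n; rewrite energy_sum; last exact: measurable_signalB.
  have -> : (2 * k%:R * 8^-1 ^+ n)%:E = (\sum_(j < k) ((8^-1 ^+ n)%:E + (8^-1 ^+ n)%:E))%E :> \bar R.
    rewrite -EFinD sumEFin sumr_const card_ord; congr EFin.
    by rewrite -[RHS]mulr_natr; ring.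
  apply: lee_sum => j _; rewrite reSB imSB reS_signal_of imS_signal_of.
  by apply: leeD; [have [] := ha j|have [] := hb j].
Qed.

(** * The Fourier transform on L2 and the closedness of H2 *)

(** A truncated transform is the full transform of a truncation, which is
    integrable when the signal is square integrable. *)
Definition cut (T : R) (h : R -> R) (t : R) : R := h t * (`|t| <= T)%R%:R.

Lemma Rintegral_cut (T : R) (h g : R -> R) :
  \int[mu]_(t in `[- T, T]) (h t * g t) = \int[mu]_t (cut T h t * g t).
Proof.
rewrite Rintegral_mkcond; apply: eq_Rintegral => t _; rewrite patchE /cut.
have -> : (t \in `[- T, T]%classic) = (`|t| <= T) by rewrite mem_setE in_itv/= ler_norml.
by case: ifP; rewrite ?mulr1// mulr0 mul0r.
Qed.

Lemma measurable_cut T h : measurable_fun setT h -> measurable_fun setT (cut T h).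
Proof.
move=> mh; apply: measurable_funM => //.
have mb : measurable_fun setT (fun y : R => `|y| <= T).
  by apply: measurable_fun_ler => //; exact: measurableT_comp.
rewrite (_ : (fun _ => _) = fun y : R => if `|y| <= T then 1 else 0); last by apply/funext => y; case: ifP.
by apply: measurable_fun_ifT.
Qed.

Lemma cut_sqr_le T h t : cut T h t ^+ 2 <= h t ^+ 2.
Proof. by rewrite /cut; case: (`|t| <= T) => /=; rewrite ?mulr1// mulr0 expr0n sqr_ge0. Qed.

Lemma integrable_cut T h : measurable_fun setT h -> (sqint h < +oo)%E ->
  mu.-integrable setT (EFin \o cut T h).
Proof.
move=> mh hoo.
have i2 : mu.-integrable setT (EFin \o (fun t => h t ^+ 2)).
  apply/integrableP; split; first by apply/measurable_EFinP; exact: (measurable_funX _ mh).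
  by under eq_integral do rewrite /= ger0_norm ?sqr_ge0//.
have i1 : mu.-integrable setT (EFin \o (\1_(`[- T, T]) : R -> R)).
  exact: integrable_indic_itv.
apply: (@le_integrable _ _ _ mu _ measurableT _ (EFin \o (fun t => \1_(`[- T, T]) t + h t ^+ 2))).
- by apply/measurable_EFinP; exact: measurable_cut.
- move=> t _ /=; rewrite lee_fin (@ger0_norm _ (_ + _)); last by rewrite addr_ge0 ?sqr_ge0// indicE.
  rewrite /cut indicE mem_setE in_itv/= -ler_norml.
  case: (`|t| <= T) => /=; last by rewrite mulr0 normr0 add0r sqr_ge0.
  rewrite mulr1 -(real_normK (num_real (h t))).
  have := sqr_ge0 (`|h t| - 1); have := normr_ge0 (h t); nra.
- exact: (integrableD measurableT i1 i2).
Qed.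

Section truncated.
Variables (k : nat) (f : signal R k) (T : R).
Hypothesis f2 : L2 f.

Lemma measurable_L2 : measurable_signal f.
Proof. by move/L2P: f2 => []. Qed.

Lemma sqint_comp_lty j : (sqint (reS f j) < +oo)%E /\ (sqint (imS f j) < +oo)%E.
Proof.
move/L2P: f2 => [mf foo]; have [h1 h2] := sqint_reS_le j mf.
by split; exact: le_lt_trans foo.
Qed.

Lemma integrable_cut_reS j : mu.-integrable setT (EFin \o cut T (reS f j)).
Proof. by apply: integrable_cut; [have [] := measurable_L2 j|have [] := sqint_comp_lty j]. Qed.

Lemma integrable_cut_imS j : mu.-integrable setT (EFin \o cut T (imS f j)).
Proof. by apply: integrable_cut; [have [] := measurable_L2 j|have [] := sqint_comp_lty j]. Qed.

Lemma reS_truncated_fourier j : reS (truncated_fourier f T) j =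
  fun w => cosT (cut T (reS f j)) w + sinT (cut T (imS f j)) w.
Proof.
apply/funext => w; rewrite /reS mxE /= -RintegralD//.
- transitivity (\int[mu]_(t in `[- T, T]) ((reS f j t * cos (w * t) + imS f j t * sin (w * t)) * cst 1 t)).
    apply: eq_Rintegral => t _; rewrite /reS /imS.
    by case: (f t j ord0) => x y /=; rewrite mulr1 mulrN opprK.
  rewrite Rintegral_cut; apply: eq_Rintegral => t _; rewrite /cut/=; ring.
- exact: (integrable_mul_cos w (integrable_cut_reS j)).
- exact: (integrable_mul_sin w (integrable_cut_imS j)).
Qed.

Lemma imS_truncated_fourier j : imS (truncated_fourier f T) j =
  fun w => cosT (cut T (imS f j)) w - sinT (cut T (reS f j)) w.
Proof.
apply/funext => w; rewrite /imS mxE /= -RintegralB//.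
- transitivity (\int[mu]_(t in `[- T, T]) ((imS f j t * cos (w * t) - reS f j t * sin (w * t)) * cst 1 t)).
    apply: eq_Rintegral => t _; rewrite /reS /imS.
    by case: (f t j ord0) => x y /=; rewrite mulr1 mulrN addrC.
  rewrite Rintegral_cut; apply: eq_Rintegral => t _; rewrite /cut/=; ring.
- exact: (integrable_mul_cos w (integrable_cut_imS j)).
- exact: (integrable_mul_sin w (integrable_cut_reS j)).
Qed.

Lemma measurable_truncated_fourier : measurable_signal (truncated_fourier f T).
Proof.
move=> j; rewrite reS_truncated_fourier imS_truncated_fourier.
have ir := integrable_cut_reS j; have ii := integrable_cut_imS j.
split; first exact: (measurable_funD (measurable_cosT ir) (measurable_sinT ii)).
exact: (measurable_funB (measurable_cosT ii) (measurable_sinT ir)).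
Qed.

Definition cutS : signal R k := signal_of (fun j => cut T (reS f j)) (fun j => cut T (imS f j)).

Lemma measurable_cutS : measurable_signal cutS.
Proof.
by move=> j; rewrite reS_signal_of imS_signal_of; have [? ?] := measurable_L2 j;
  split; exact: measurable_cut.
Qed.

Lemma truncated_fourier_energy : energy (truncated_fourier f T) =
  (\sum_(j < k) (fourier_energy (cut T (reS f j)) + fourier_energy (cut T (imS f j))))%E.
Proof.
rewrite energy_sum; last exact: measurable_truncated_fourier.
apply: eq_bigr => j _; rewrite reS_truncated_fourier imS_truncated_fourier.
exact: complex_fourier_energy (integrable_cut_reS j) (integrable_cut_imS j).
Qed.

Lemma truncated_fourier_energy_le :
  (energy (truncated_fourier f T) <= (2 * pi)%:E * energy f)%E.
Proof.
have pi2 : (0 <= (2 * pi : R)%:E)%E by rewrite lee_fin mulr_ge0// pi_ge0.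
rewrite truncated_fourier_energy (energy_sum measurable_L2) ge0_sume_distrr; last first.
  by move=> j _; rewrite adde_ge0// sqint_ge0.
apply: lee_sum => j _; have [mr mi] := measurable_L2 j.
have h (a : R -> R) : measurable_fun setT a -> mu.-integrable setT (EFin \o cut T a) ->
    (fourier_energy (cut T a) <= (2 * pi)%:E * sqint a)%E.
  move=> ma ia; apply: (le_trans (fourier_energy_le ia)); apply: lee_wpmul2l => //.
  apply: sqint_le => //; first exact: measurable_cut.
  by move=> t; rewrite -ler_sqr ?nnegrE// !real_normK ?num_real// cut_sqr_le.
rewrite ge0_muleDr ?sqint_ge0//.
exact: (leeD (h _ mr (integrable_cut_reS j)) (h _ mi (integrable_cut_imS j))).
Qed.

Lemma energy_cutS_le : (energy cutS <= (pi^-1)%:E * energy (truncated_fourier f T))%E.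
Proof.
have fe0 a : (0 <= fourier_energy a)%E.
  by apply: integral_ge0 => t _; rewrite lee_fin addr_ge0// sqr_ge0.
rewrite truncated_fourier_energy (energy_sum measurable_cutS) ge0_sume_distrr; last first.
  by move=> j _; rewrite adde_ge0.
apply: lee_sum => j _; rewrite reS_signal_of imS_signal_of ge0_muleDr//.
exact: (leeD (sqint_le_energy (integrable_cut_reS j)) (sqint_le_energy (integrable_cut_imS j))).
Qed.

End truncated.

Lemma energy_L2norm (k : nat) (f : signal R k) (s : R) : 0 <= s ->
  (L2norm f <= s%:E)%E <-> (energy f <= (s ^+ 2)%:E)%E.
Proof.
move=> s0; rewrite L2normE; split=> h.
- have -> : energy f = poweR (poweR (energy f) 2^-1) 2.
    by rewrite -poweRrM mulVf// poweRe1// energy_ge0.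
  have -> : (s ^+ 2)%:E = poweR s%:E 2 by rewrite poweR_EFin powR_mulrn.
  apply: gt0_ler_poweR => //; rewrite ?in_itv/= ?leey ?andbT ?poweR_ge0 ?lee_fin//.
- have -> : s%:E = poweR (s ^+ 2)%:E 2^-1.
    by rewrite poweR_EFin -powR_mulrn// -powRrM divff// powRr1.
  apply: gt0_ler_poweR => //; rewrite ?in_itv/= ?leey ?andbT ?energy_ge0 ?lee_fin ?sqr_ge0//.
Qed.

(** Convergence in norm, restated for the energy so that the square root does not
    occur in the estimates. *)
Lemma is_fourierP (k : nat) (f F : signal R k) :
  is_fourier f F <-> forall e : R, 0 < e -> exists T0 : R, forall T, T0 <= T ->
    (energy (truncated_fourier f T \- F)%R <= e%:E)%E.
Proof.
split=> [/fine_cvgP [fin /cvgr0Pnorm_le h] e e0|h].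
- have se0 : 0 < Num.sqrt e by rewrite sqrtr_gt0.
  have [T0 [_ HT]] : \forall T \near +oo%R, (L2norm (truncated_fourier f T \- F)%R <= (Num.sqrt e)%:E)%E.
    move: (h _ se0) fin; apply: filterS2 => T /= hT fT.
    by rewrite -(fineK fT) lee_fin (le_trans (ler_norm _)).
  exists (T0 + 1) => T TT; rewrite -(sqr_sqrtr (ltW e0)).
  by apply/energy_L2norm; [exact: sqrtr_ge0|apply: HT; lra].
- have hs (s : R) : 0 < s -> \forall T \near +oo%R, (L2norm (truncated_fourier f T \- F)%R <= s%:E)%E.
    move=> s0; have [T0 HT] := h _ (exprn_gt0 2 s0).
    exists T0; split; first exact: num_real.
    by move=> T /ltW TT; apply/energy_L2norm; [exact: ltW|exact: HT].
  have L0 T : (0 <= L2norm (truncated_fourier f T \- F)%R)%E by exact: Lnorm_ge0.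
  apply/fine_cvgP; split.
    move: (hs _ ltr01); apply: filterS => T hT.
    by rewrite ge0_fin_numE// (le_lt_trans hT)// ltry.
  apply/cvgr0Pnorm_le => s s0; move: (hs s s0); apply: filterS => T hT /=.
  rewrite ger0_norm ?fine_ge0// -lee_fin fineK//.
  by rewrite ge0_fin_numE// (le_lt_trans hT)// ltry.
Qed.

Lemma cosT_lin (a b : R -> R) (x w : R) :
  mu.-integrable setT (EFin \o a) -> mu.-integrable setT (EFin \o b) ->
  cosT (fun t => a t + x * b t) w = cosT a w + x * cosT b w.
Proof.
move=> ia ib; have ica := integrable_mul_cos w ia; have icb := integrable_mul_cos w ib.
rewrite /cosT -(RintegralZl _ measurableT icb) -RintegralD//; last exact: (integrableZl measurableT x icb).
by apply: eq_Rintegral => t _; rewrite mulrDl mulrA.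
Qed.

Lemma sinT_lin (a b : R -> R) (x w : R) :
  mu.-integrable setT (EFin \o a) -> mu.-integrable setT (EFin \o b) ->
  sinT (fun t => a t + x * b t) w = sinT a w + x * sinT b w.
Proof.
move=> ia ib; have ica := integrable_mul_sin w ia; have icb := integrable_mul_sin w ib.
rewrite /sinT -(RintegralZl _ measurableT icb) -RintegralD//; last exact: (integrableZl measurableT x icb).
by apply: eq_Rintegral => t _; rewrite mulrDl mulrA.
Qed.

Lemma L2_lin (k : nat) (f g : signal R k) (c : R[i]) : L2 f -> L2 g ->
  L2 (fun t => f t + c *: g t).
Proof.
move=> /L2P [mf fo] /L2P [mg go]; apply/L2P.
have mcg : measurable_signal (fun t => c *: g t).
  have := measurable_signalB (measurable_signalD c mf mg) mf.
  suff -> : (fun t => f t + c *: g t) \- f = (fun t => c *: g t) by [].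
  by apply/funext => t /=; rewrite addrC addKr.
split; first exact: measurable_signalD.
apply: le_lt_trans (energyD_le mf mcg) _.
rewrite energyZ// lte_mul_pinfty// lte_add_pinfty// lte_mul_pinfty//.
by rewrite lee_fin addr_ge0// sqr_ge0.
Qed.

Lemma Re_axpy (x c y : R[i]) : complex.Re (x + c * y) =
  complex.Re x + (complex.Re c * complex.Re y - complex.Im c * complex.Im y).
Proof. by case: x c y => [? ?] [? ?] [? ?]. Qed.

Lemma Im_axpy (x c y : R[i]) : complex.Im (x + c * y) =
  complex.Im x + (complex.Re c * complex.Im y + complex.Im c * complex.Re y).
Proof. by case: x c y => [? ?] [? ?] [? ?]. Qed.

Lemma complex_eqP (x y : R[i]) : complex.Re x = complex.Re y ->
  complex.Im x = complex.Im y -> x = y.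
Proof. by case: x y => [? ?] [? ?] /= -> ->. Qed.

Lemma truncated_fourier_lin (k : nat) (f g : signal R k) (c : R[i]) (T : R) :
  L2 f -> L2 g ->
  truncated_fourier (fun t => f t + c *: g t) T =
  fun w => truncated_fourier f T w + c *: truncated_fourier g T w.
Proof.
move=> f2 g2; have fg2 := L2_lin c f2 g2.
apply/funext => w; apply/matrixP => j z; rewrite (ord1 z).
have ifr := integrable_cut_reS T f2 j; have ifi := integrable_cut_imS T f2 j.
have igr := integrable_cut_reS T g2 j; have igi := integrable_cut_imS T g2 j.
pose h := fun t => f t + c *: g t.
have cr : cut T (reS h j) = fun t => (cut T (reS f j) t + complex.Re c * cut T (reS g j) t) +
    (- complex.Im c) * cut T (imS g j) t.
  apply/funext => t; rewrite /cut /h /reS /imS !mxE.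
  by rewrite Re_axpy; ring.
have ci : cut T (imS h j) = fun t => (cut T (imS f j) t + complex.Re c * cut T (imS g j) t) +
    complex.Im c * cut T (reS g j) t.
  apply/funext => t; rewrite /cut /h /reS /imS !mxE.
  by rewrite Im_axpy; ring.
have i1 := integrableD measurableT ifr (integrableZl measurableT (complex.Re c) igr).
have i2 := integrableD measurableT ifi (integrableZl measurableT (complex.Re c) igi).
have eqre : reS (truncated_fourier h T) j w =
    reS (fun w => truncated_fourier f T w + c *: truncated_fourier g T w) j w.
  rewrite (reS_truncated_fourier T fg2) cr ci.
  rewrite (cosT_lin _ _ i1 igi) (cosT_lin _ _ ifr igr) (sinT_lin _ _ i2 igr) (sinT_lin _ _ ifi igi).
  transitivity (reS (truncated_fourier f T) j w +
    (complex.Re c * reS (truncated_fourier g T) j w - complex.Im c * imS (truncated_fourier g T) j w)).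
    by rewrite !reS_truncated_fourier// imS_truncated_fourier//; ring.
  by rewrite /reS /imS -Re_axpy; congr complex.Re; rewrite !mxE.
have eqim : imS (truncated_fourier h T) j w =
    imS (fun w => truncated_fourier f T w + c *: truncated_fourier g T w) j w.
  rewrite (imS_truncated_fourier T fg2) cr ci.
  rewrite (cosT_lin _ _ i2 igr) (cosT_lin _ _ ifi igi) (sinT_lin _ _ i1 igi) (sinT_lin _ _ ifr igr).
  transitivity (imS (truncated_fourier f T) j w +
    (complex.Re c * imS (truncated_fourier g T) j w + complex.Im c * reS (truncated_fourier g T) j w)).
    by rewrite !imS_truncated_fourier// reS_truncated_fourier//; ring.
  by rewrite /reS /imS -Im_axpy; congr complex.Im; rewrite !mxE.
exact: complex_eqP eqre eqim.
Qed.

(** The lower Plancherel bound for truncations, then Fatou's lemma as the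
    truncations exhaust the line. *)
Lemma energy_le_fourier (k : nat) (f F : signal R k) : L2 f -> measurable_signal F ->
  is_fourier f F -> (energy f <= energy F)%E.
Proof.
move=> f2 mF /is_fourierP fF.
have mf := measurable_L2 f2.
apply/lee_addgt0Pr => e e0.
have [T0 HT] := fF e e0.
apply: (@fatou_le (fun n t => nsq (cutS f (`|T0| + n%:R) t))).
- by move=> n; apply: measurable_nsq; exact: measurable_cutS.
- exact: measurable_nsq.
- by move=> n t; exact: nsq_ge0.
- by move=> t; exact: nsq_ge0.
- apply: aeW => t; apply: cvg_near_cst.
  near=> n; rewrite /nsq; apply: eq_bigr => j _; rewrite /cutS /signal_of mxE /= /cut.
  have -> : `|t| <= `|T0| + n%:R.
    by rewrite ler_wpDl//; near: n; exact: nbhs_infty_ger.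
  by rewrite !mulr1.
- move=> n; set T := _ + _.
  have mt := measurable_truncated_fourier T f2.
  apply: (le_trans (energy_cutS_le T f2)).
  have pi0 : (0 <= (pi^-1 : R)%:E)%E by rewrite lee_fin invr_ge0 pi_ge0.
  apply: (@le_trans _ _ ((pi^-1)%:E * (2%:E * (e%:E + energy F)))%E).
    apply: lee_wpmul2l => //.
    have -> : truncated_fourier f T = fun w => (truncated_fourier f T \- F) w + F w.
      by apply/funext => w /=; rewrite subrK.
    apply: (le_trans (energyD_le (measurable_signalB mt mF) mF)).
    apply: lee_wpmul2l => //; apply: leeD => //; apply: HT.
    by rewrite /T (le_trans (ler_norm _))// lerDl.
  rewrite muleA -EFinM addeC -[leRHS]mul1e; apply: lee_wpmul2r.
    by rewrite adde_ge0 ?energy_ge0// lee_fin ltW.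
  (* The constant 2 / pi is at most 1. *)
  by rewrite lee_fin mulrC ler_pdivrMr ?pi_gt0// mul1r pi_ge2.
Unshelve. all: by end_near. Qed.

Lemma energy0 (k : nat) : energy (fun=> 0 : 'cV[R[i]]_k) = 0%E.
Proof. by rewrite /energy; under eq_integral do rewrite nsq0; rewrite integral0. Qed.

Lemma measurable_signal0 (k : nat) : measurable_signal (fun=> 0 : 'cV[R[i]]_k).
Proof.
by move=> j; split; (rewrite (_ : _ (fun=> 0) j = cst 0) ;
  [exact: measurable_cst|apply/funext => t; rewrite /reS /imS mxE]).
Qed.

Lemma L2_0 (k : nat) : L2 (fun=> 0 : 'cV[R[i]]_k).
Proof. by apply/L2P; split; [exact: measurable_signal0|rewrite energy0]. Qed.

Lemma is_fourier_lin (k : nat) (f g F G : signal R k) (c : R[i]) :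
  L2 f -> L2 g -> measurable_signal F -> measurable_signal G ->
  is_fourier f F -> is_fourier g G ->
  is_fourier (fun t => f t + c *: g t) (fun t => F t + c *: G t).
Proof.
move=> f2 g2 mF mG /is_fourierP fF /is_fourierP gG; apply/is_fourierP => e e0.
pose C := complex.Re c ^+ 2 + complex.Im c ^+ 2.
have C0 : 0 <= C by rewrite addr_ge0// sqr_ge0.
have e4 : 0 < e / 4 by rewrite divr_gt0.
have eC : 0 < e / (4 * (C + 1)) by rewrite divr_gt0// mulr_gt0// ltr_wpDl.
have [T1 h1] := fF _ e4; have [T2 h2] := gG _ eC.
exists (Num.max T1 T2) => T; rewrite ge_max => /andP[TT1 TT2].
have mt1 := measurable_truncated_fourier T f2; have mt2 := measurable_truncated_fourier T g2.
have mB1 := measurable_signalB mt1 mF; have mB2 := measurable_signalB mt2 mG.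
have mB0 := @measurable_signal0 k.
have mcB : measurable_signal (fun t => c *: (truncated_fourier g T \- G) t).
  have := measurable_signalD c mB0 mB2.
  by under [X in measurable_signal X -> _]eq_fun do rewrite add0r.
rewrite truncated_fourier_lin//.
rewrite (_ : _ \- _ = fun w => (truncated_fourier f T \- F) w + c *: (truncated_fourier g T \- G) w); last first.
  by apply/funext => w /=; rewrite scalerBr opprD addrACA.
apply: (le_trans (energyD_le mB1 mcB)).
rewrite energyZ// -/C.
apply: (@le_trans _ _ (2%:E * ((e / 4)%:E + C%:E * (e / (4 * (C + 1)))%:E))%E).
  apply: lee_wpmul2l => //; apply: leeD; first exact: h1.
  by apply: lee_wpmul2l; [rewrite lee_fin|exact: h2].
rewrite -(EFinM C) -(EFinD (e / 4)) -(EFinM 2) lee_fin.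
have C1 : C / (C + 1) <= 1 by rewrite ler_pdivrMr ?mul1r ?lerDl ?ltr_wpDl.
have -> : C * (e / (4 * (C + 1))) = (e / 4) * (C / (C + 1)).
  by field; rewrite gt_eqF// ltr_wpDl.
by nra.
Qed.

Lemma H2_lin (k : nat) (F G : signal R k) (c : R[i]) : H2 F -> H2 G ->
  H2 (fun t => F t + c *: G t).
Proof.
move=> [F2 [f [f2 f0 fF]]] [G2 [g [g2 g0 gG]]]; split; first exact: L2_lin.
exists (fun t => f t + c *: g t); split.
- exact: L2_lin.
- by move=> t t0; rewrite f0// g0// scaler0 addr0.
- by apply: is_fourier_lin => //; exact: measurable_L2.
Qed.

Lemma H2_0 (k : nat) : H2 (fun=> 0 : 'cV[R[i]]_k).
Proof.
split; first exact: L2_0.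
exists (fun=> 0); split => //; first exact: L2_0.
apply/is_fourierP => e e0; exists 0 => T _.
rewrite (_ : _ \- _ = fun=> 0) ?energy0 ?lee_fin ?(ltW e0)//.
apply/funext => w; apply/matrixP => j z; rewrite !mxE subr0 /cintegral.
rewrite (_ : (fun t : R => complex.Re _) = cst 0); last first.
  by apply/funext => t; rewrite mul0r.
rewrite (_ : (fun t : R => complex.Im _) = cst 0); last first.
  by apply/funext => t; rewrite mul0r.
by rewrite Rintegral_cst//= mul0r.
Qed.

Lemma small_geometric (K e : R) : 0 < e -> exists n : nat, K * 8^-1 ^+ n <= e.
Proof.
move=> e0; have : geometric K 8^-1 n @[n --> \oo] --> (0 : R).
  by apply: cvg_geometric; rewrite ger0_norm// invf_lt1// ltr1n.
move=> /cvgr0Pnorm_le /(_ e e0) [n _ hn]; exists n.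
by apply: le_trans (hn n (leqnn n)); exact: ler_norm.
Qed.

Lemma energyB_lty (k : nat) (f g : signal R k) (c : R) : measurable_signal f -> L2 g ->
  (energy (f \- g)%R <= c%:E)%E -> L2 f.
Proof.
move=> mf /L2P [mg goo] fg; apply/L2P; split=> //.
rewrite (_ : f = fun t => (f \- g) t + g t); last by apply/funext => t /=; rewrite subrK.
apply: (le_lt_trans (energyD_le (measurable_signalB mf mg) mg)).
by rewrite lte_mul_pinfty// lte_add_pinfty// (le_lt_trans fg)// ltry.
Qed.

Lemma is_fourierB (k : nat) (f g F G : signal R k) :
  L2 f -> L2 g -> measurable_signal F -> measurable_signal G ->
  is_fourier f F -> is_fourier g G -> is_fourier (f \- g) (F \- G).
Proof. by move=> *; rewrite !signal_subE; exact: is_fourier_lin. Qed.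

Lemma L2B (k : nat) (f g : signal R k) : L2 f -> L2 g -> L2 (f \- g).
Proof. by move=> *; rewrite signal_subE; exact: L2_lin. Qed.

(** By the Plancherel bounds, spectra converging in L2 come from signals
    converging in L2, and the limit signal has the limit spectrum. *)
Lemma H2_closed (k : nat) (F_ : nat -> signal R k) (F : signal R k) (C : R) :
  (forall n, H2 (F_ n)) -> measurable_signal F ->
  (forall n m, (n <= m)%N -> (energy (F_ m \- F_ n)%R <= (8^-1 ^+ n)%:E)%E) ->
  (forall n, (energy (F \- F_ n)%R <= (C * 8^-1 ^+ n)%:E)%E) -> H2 F.
Proof.
move=> HF mF FC FL.
have L2F_ n : L2 (F_ n) by case: (HF n).
have mF_ n := measurable_L2 (L2F_ n).
have L2F : L2 F by exact: (energyB_lty mF (L2F_ 0%N) (FL 0%N)).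
split=> //.
have [f_ hf_] : exists f_ : nat -> signal R k, forall n,
    [/\ L2 (f_ n), (forall t, t < 0 -> f_ n t = 0) & is_fourier (f_ n) (F_ n)].
  have hf n : exists f : signal R k,
      [/\ L2 f, (forall t, t < 0 -> f t = 0) & is_fourier f (F_ n)] by case: (HF n).
  by have [f_ ?] := choice hf; exists f_.
have f2 n : L2 (f_ n) by case: (hf_ n).
have f0 n t : t < 0 -> f_ n t = 0 by case: (hf_ n) => _ + _; exact.
have fF n : is_fourier (f_ n) (F_ n) by case: (hf_ n).
have mf n := measurable_L2 (f2 n).
have fC n m : (n <= m)%N -> (energy (f_ m \- f_ n)%R <= (8^-1 ^+ n)%:E)%E.
  move=> nm; apply: le_trans (FC _ _ nm).
  apply: energy_le_fourier; first exact: L2B.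
    exact: measurable_signalB.
  exact: is_fourierB.
have [g [mg _ gL]] := energy_complete mf fC.
(* The limit is determined only almost everywhere, so it is reset to 0 on
   negative times. *)
pose f : signal R k := fun t => if t < 0 then 0 else g t.
have mlt0 : measurable_fun setT (fun t : R => t < 0) by exact: measurable_fun_ltr.
have mff : measurable_signal f.
  move=> j; have [mr mi] := mg j; split.
    rewrite (_ : reS f j = fun t => if t < 0 then 0 else reS g j t); first exact: measurable_fun_ifT.
    by apply/funext => t; rewrite /reS /f; case: ifP => //; rewrite mxE.
  rewrite (_ : imS f j = fun t => if t < 0 then 0 else imS g j t); first exact: measurable_fun_ifT.
  by apply/funext => t; rewrite /imS /f; case: ifP => //; rewrite mxE.
have ffL n : (energy (f \- f_ n)%R <= (2 * k%:R * 8^-1 ^+ n)%:E)%E.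
  apply: le_trans (gL n); apply: le_energy; [exact: measurable_signalB|exact: measurable_signalB|].
  move=> t; rewrite /f /=; case: ifP => // t0.
  by rewrite f0// subr0 nsq0 nsq_ge0.
have ff2 : L2 f by exact: (energyB_lty mff (f2 0%N) (ffL 0%N)).
exists f; split=> //; first by move=> t t0; rewrite /f t0.
apply/is_fourierP => e e0.
(* The n-th signal carries the estimate: the three distances below add up to
   e / 2 plus the constant of this line times 8^-n. *)
have [n Kn] := small_geometric (8 * pi * k%:R + 4 * C) (divr_gt0 e0 (ltr0n _ 2)).
have e8 : 0 < e / 8 by rewrite divr_gt0.
have [T0 HT] := (is_fourierP _ _).1 (fF n) _ e8.
exists T0 => T /HT {}HT.
have mt := measurable_truncated_fourier T ff2; have mtn := measurable_truncated_fourier T (f2 n).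
apply: (le_trans (energyB_le mt mtn mF)).
have h1 : (energy (truncated_fourier f T \- truncated_fourier (f_ n) T)%R <=
           (2 * pi)%:E * (2 * k%:R * 8^-1 ^+ n)%:E)%E.
  have -> : truncated_fourier f T \- truncated_fourier (f_ n) T = truncated_fourier (f \- f_ n) T.
    rewrite [in RHS]signal_subE truncated_fourier_lin//.
    by apply/funext => w /=; rewrite scaleN1r.
  apply: (le_trans (truncated_fourier_energy_le T (L2B ff2 (f2 n)))).
  by apply: lee_wpmul2l; [rewrite lee_fin mulr_ge0// pi_ge0|exact: ffL].
have h2 : (energy (truncated_fourier (f_ n) T \- F)%R <=
           2%:E * ((e / 8)%:E + (C * 8^-1 ^+ n)%:E))%E.
  apply: (le_trans (energyB_le mtn (mF_ n) mF)); apply: lee_wpmul2l => //.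
  by apply: leeD => //; rewrite energyN.
apply: (@le_trans _ _ (2%:E * ((2 * pi)%:E * (2 * k%:R * 8^-1 ^+ n)%:E +
    2%:E * ((e / 8)%:E + (C * 8^-1 ^+ n)%:E)))%E).
  by apply: lee_wpmul2l => //; exact: leeD.
suff : 2 * ((2 * pi) * (2 * k%:R * 8^-1 ^+ n) + 2 * (e / 8 + C * 8^-1 ^+ n)) <= e.
  by rewrite -lee_fin.
move: Kn; set z := 8^-1 ^+ n; set P := pi * k%:R * z.
have -> : (8 * pi * k%:R + 4 * C) * z = 8 * P + 4 * (C * z) by rewrite /P; ring.
have -> : 2 * pi * (2 * k%:R * z) = 4 * P by rewrite /P; ring.
lra.
Qed.

(** * Graphs and orthogonal projections *)

Lemma nsq_col (m l : nat) (u : 'cV[R[i]]_m) (y : 'cV[R[i]]_l) :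
  nsq (col_mx u y) = nsq u + nsq y.
Proof.
rewrite /nsq big_split_ord/=; congr (_ + _); apply: eq_bigr => j _.
  by rewrite col_mxEu.
by rewrite col_mxEd.
Qed.

Lemma measurable_signal_col (m l : nat) (u : signal R m) (y : signal R l) :
  measurable_signal u -> measurable_signal y ->
  measurable_signal (fun t => col_mx (u t) (y t)).
Proof.
move=> mu_ my j; rewrite /reS /imS -(splitK j); case: (fintype.split j) => i /=.
  have [mr mi] := mu_ i.
  by split; [under eq_fun do rewrite col_mxEu|under eq_fun do rewrite col_mxEu].
have [mr mi] := my i.
by split; [under eq_fun do rewrite col_mxEd|under eq_fun do rewrite col_mxEd].
Qed.

Lemma energy_col (m l : nat) (u : signal R m) (y : signal R l) :
  measurable_signal u -> measurable_signal y ->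
  energy (fun t => col_mx (u t) (y t)) = (energy u + energy y)%E.
Proof.
move=> mu_ my; rewrite /energy -ge0_integralD//.
- by apply: eq_integral => t _; rewrite nsq_col EFinD.
- by move=> t _; rewrite lee_fin nsq_ge0.
- by apply/measurable_EFinP; exact: measurable_nsq.
- by move=> t _; rewrite lee_fin nsq_ge0.
- by apply/measurable_EFinP; exact: measurable_nsq.
Qed.

Section graph.
Variables (l m : nat) (P : 'M[{fraction {poly R}}]_(l, m)).

Lemma graph_L2 g : graph P g -> L2 g.
Proof.
move=> [u [y [[/L2P [mu_ uoo] _] [/L2P [my yoo] _] _ ->]]]; apply/L2P; split.
  exact: measurable_signal_col.
by rewrite energy_col// lte_add_pinfty.
Qed.

Lemma graph0 : graph P (fun=> 0).
Proof.
exists (fun=> 0), (fun=> 0); split; [exact: H2_0|exact: H2_0| |].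
  by apply: aeW => t; rewrite mulmx0.
by apply/funext => t; rewrite col_mx0.
Qed.

Lemma graph_lin f g (c : R[i]) : graph P f -> graph P g ->
  graph P (fun t => f t + c *: g t).
Proof.
move=> [u [y [hu hy e ->]]] [u' [y' [hu' hy' e' ->]]].
exists (fun t => u t + c *: u' t), (fun t => y t + c *: y' t); split.
- exact: H2_lin.
- exact: H2_lin.
- apply: ae_imply2 e e' => t -> ->.
  by rewrite mulmxDr scalemxAr.
- by apply/funext => t; rewrite scale_col_mx add_col_mx.
Qed.

Lemma Re_sum (I : finType) (F : I -> R[i]) : complex.Re (\sum_i F i) = \sum_i complex.Re (F i).
Proof. by apply: (big_morph (@complex.Re R)) => [[? ?] [? ?]|]. Qed.

Lemma Im_sum (I : finType) (F : I -> R[i]) : complex.Im (\sum_i F i) = \sum_i complex.Im (F i).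
Proof. by apply: (big_morph (@complex.Im R)) => [[? ?] [? ?]|]. Qed.

Definition cvg_coords (k : nat) (u_ : nat -> 'cV[R[i]]_k) (u : 'cV[R[i]]_k) : Prop :=
  forall j, (complex.Re (u_ n j ord0) @[n --> \oo] --> complex.Re (u j ord0)) /\
            (complex.Im (u_ n j ord0) @[n --> \oo] --> complex.Im (u j ord0)).

Lemma cvg_sum_fin (I : finType) (f : I -> nat -> R) (a : I -> R) :
  (forall i, f i n @[n --> \oo] --> a i) -> (\sum_i f i n) @[n --> \oo] --> \sum_i a i.
Proof.
move=> fa; rewrite (_ : (fun n => _) = \sum_i f i); last first.
  by apply/funext => n; rewrite fct_sumE.
elim/big_ind2: _ => //; first exact: cvg_cst.
by move=> x y z w hx hz; exact: cvgD.
Qed.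

Lemma cvg_coords_mulmx (M : 'M[R[i]]_(l, m)) (u_ : nat -> 'cV[R[i]]_m) (u : 'cV[R[i]]_m) :
  cvg_coords u_ u -> cvg_coords (fun n => M *m u_ n) (M *m u).
Proof.
move=> h j; split.
  rewrite !mxE Re_sum; under eq_fun do rewrite mxE Re_sum.
  apply: cvg_sum_fin => i; have [hr hi] := h i.
  case: (M j i) => x y.
  have E (z : R[i]) : complex.Re ((x +i* y)%C * z) = x * complex.Re z - y * complex.Im z by case: z.
  by rewrite E; under eq_fun do rewrite E; apply: cvgB; apply: cvgM => //; exact: cvg_cst.
rewrite !mxE Im_sum; under eq_fun do rewrite mxE Im_sum.
apply: cvg_sum_fin => i; have [hr hi] := h i.
case: (M j i) => x y.
have E (z : R[i]) : complex.Im ((x +i* y)%C * z) = x * complex.Im z + y * complex.Re z by case: z.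
by rewrite E; under eq_fun do rewrite E; apply: cvgD; apply: cvgM => //; exact: cvg_cst.
Qed.

Lemma cvg_coords_unique (k : nat) (u_ : nat -> 'cV[R[i]]_k) (u v : 'cV[R[i]]_k) :
  cvg_coords u_ u -> cvg_coords u_ v -> u = v.
Proof.
move=> hu hv; apply/matrixP => j z; rewrite (ord1 z).
have [ur ui] := hu j; have [vr vi] := hv j.
by apply: complex_eqP; [exact: (cvg_unique _ ur vr)|exact: (cvg_unique _ ui vi)].
Qed.

Lemma cvg_coords_nsq (k : nat) (u_ : nat -> 'cV[R[i]]_k) (u v : 'cV[R[i]]_k) :
  cvg_coords u_ u -> nsq (v - u_ n) @[n --> \oo] --> nsq (v - u).
Proof.
move=> h; rewrite /nsq; apply: cvg_sum_fin => j; have [hr hi] := h j.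
have Er (z : 'cV[R[i]]_k) : complex.Re ((v - z) j ord0) = complex.Re (v j ord0) - complex.Re (z j ord0).
  by rewrite !mxE; case: (v j ord0) (z j ord0) => [? ?] [? ?].
have Ei (z : 'cV[R[i]]_k) : complex.Im ((v - z) j ord0) = complex.Im (v j ord0) - complex.Im (z j ord0).
  by rewrite !mxE; case: (v j ord0) (z j ord0) => [? ?] [? ?].
rewrite Er Ei; under eq_fun do rewrite Er Ei.
apply: cvgD; rewrite expr2; under eq_fun do rewrite expr2.
  by apply: cvgM; (apply: cvgB; [exact: cvg_cst|exact: hr]).
by apply: cvgM; (apply: cvgB; [exact: cvg_cst|exact: hi]).
Qed.

(** A relation between spectra that holds at almost every frequency passes to
    limits along an almost everywhere convergent sequence. *)
Lemma graph_closed (F_ : nat -> signal R (m + l)) (F : signal R (m + l)) (C : R) :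
  (forall n, graph P (F_ n)) -> measurable_signal F ->
  (forall n k, (n <= k)%N -> (energy (F_ k \- F_ n)%R <= (8^-1 ^+ n)%:E)%E) ->
  (forall n, (energy (F \- F_ n)%R <= (C * 8^-1 ^+ n)%:E)%E) ->
  {ae mu, forall t, cvg_coords (F_ ^~ t) (F t)} ->
  graph P F.
Proof.
move=> GF mF FC FL ae_cv.
have hF n : exists uy : signal R m * signal R l, [/\ H2 uy.1, H2 uy.2,
    {ae mu, forall t, uy.2 t = mxeval P (0 +i* t)%C *m uy.1 t} &
    F_ n = fun t => col_mx (uy.1 t) (uy.2 t)].
  by have [u [y [? ? ? ?]]] := GF n; exists (u, y).
have [uy huy] := choice hF.
pose u_ n := (uy n).1; pose y_ n := (uy n).2.
have Hu n : H2 (u_ n) by case: (huy n).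
have Hy n : H2 (y_ n) by case: (huy n).
have EF n : F_ n = fun t => col_mx (u_ n t) (y_ n t) by case: (huy n).
pose u : signal R m := fun t => usubmx (F t); pose y : signal R l := fun t => dsubmx (F t).
have FE t : F t = col_mx (u t) (y t) by rewrite /u /y vsubmxK.
have mu_ : measurable_signal u.
  by move=> j; have := mF (lshift l j); rewrite /reS /imS /u; under eq_fun do rewrite -[F _]vsubmxK col_mxEu; under [X in _ /\ measurable_fun _ X]eq_fun do rewrite -[F _]vsubmxK col_mxEu.
have my : measurable_signal y.
  by move=> j; have := mF (rshift m j); rewrite /reS /imS /y; under eq_fun do rewrite -[F _]vsubmxK col_mxEd; under [X in _ /\ measurable_fun _ X]eq_fun do rewrite -[F _]vsubmxK col_mxEd.
have mun n : measurable_signal (u_ n) by case: (Hu n) => /L2P [].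
have myn n : measurable_signal (y_ n) by case: (Hy n) => /L2P [].
have mFn n : measurable_signal (F_ n) by rewrite EF; exact: measurable_signal_col.
have colB (a b : signal R m) (c d : signal R l) (f g : signal R (m + l)) :
    measurable_signal a -> measurable_signal b -> measurable_signal c -> measurable_signal d ->
    (forall t, f t = col_mx (a t) (c t)) -> (forall t, g t = col_mx (b t) (d t)) ->
    energy (f \- g) = (energy (a \- b)%R + energy (c \- d)%R)%E.
  move=> ma mb mc md Ef Eg; rewrite -energy_col; [|exact: measurable_signalB|exact: measurable_signalB].
  congr energy; apply/funext => t /=.
  by rewrite Ef Eg opp_col_mx add_col_mx.
have EFn n t : F_ n t = col_mx (u_ n t) (y_ n t) by rewrite EF.
have HuF : H2 u.
  apply: (H2_closed Hu mu_ _ (C := C)) => [n k nk|n].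
    apply: le_trans (FC _ _ nk).
    by rewrite (colB (u_ k) (u_ n) (y_ k) (y_ n))// leeDl// energy_ge0.
  apply: le_trans (FL n).
  by rewrite (colB u (u_ n) y (y_ n))// leeDl// energy_ge0.
have HyF : H2 y.
  apply: (H2_closed Hy my _ (C := C)) => [n k nk|n].
    apply: le_trans (FC _ _ nk).
    by rewrite (colB (u_ k) (u_ n) (y_ k) (y_ n))// leeDr// energy_ge0.
  apply: le_trans (FL n).
  by rewrite (colB u (u_ n) y (y_ n))// leeDr// energy_ge0.
exists u, y; split => //; last exact/funext.
have ae_n : {ae mu, forall t, forall n, y_ n t = mxeval P (0 +i* t)%C *m u_ n t}.
  by apply: ae_foralln => n; case: (huy n).
apply: ae_imply2 ae_n ae_cv => t ent cvt.
have cu : cvg_coords (u_ ^~ t) (u t).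
  move=> j; have [cr ci] := cvt (lshift l j); rewrite /u !mxE.
  by move: cr ci; under eq_fun do rewrite EFn col_mxEu; under [X in _ -> X @ _ --> _ -> _]eq_fun do rewrite EFn col_mxEu.
have cy : cvg_coords (y_ ^~ t) (y t).
  move=> j; have [cr ci] := cvt (rshift m j); rewrite /y !mxE.
  by move: cr ci; under eq_fun do rewrite EFn col_mxEd; under [X in _ -> X @ _ --> _ -> _]eq_fun do rewrite EFn col_mxEd.
apply: (cvg_coords_unique cy).
rewrite (_ : y_ ^~ t = fun n => mxeval P (0 +i* t)%C *m u_ n t); last by apply/funext.
exact: cvg_coords_mulmx.
Qed.

(** The real part of the Hermitian product, that is, the Euclidean product of the
    underlying real vectors. *)
Definition rdot (k : nat) (v w : 'cV[R[i]]_k) : R :=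
  complex.Re (\sum_(j < k) v j ord0 * (w j ord0)^*%C).

Lemma rdotE (k : nat) (v w : 'cV[R[i]]_k) : rdot v w =
  \sum_(j < k) (complex.Re (v j ord0) * complex.Re (w j ord0) +
                complex.Im (v j ord0) * complex.Im (w j ord0)).
Proof.
rewrite /rdot Re_sum; apply: eq_bigr => j _.
by case: (v j ord0) (w j ord0) => [? ?] [? ?] /=; ring.
Qed.

Lemma nsqB_expand (k : nat) (v w : 'cV[R[i]]_k) (s : R) :
  nsq (v - (s%:C)%C *: w) = nsq v - 2 * s * rdot v w + s ^+ 2 * nsq w.
Proof.
rewrite rdotE /nsq !mulr_sumr -sumrN -!big_split/=; apply: eq_bigr => j _; rewrite !mxE.
by case: (v j ord0) (w j ord0) => [? ?] [? ?] /=; ring.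
Qed.

Lemma norm_rdot_le (k : nat) (v w : 'cV[R[i]]_k) : `|rdot v w| <= nsq v + nsq w.
Proof.
rewrite ler_norml; have h (s : R) : 0 <= nsq v - 2 * s * rdot v w + s ^+ 2 * nsq w.
  by rewrite -nsqB_expand nsq_ge0.
have := h 1; have := h (-1); have := nsq_ge0 v; have := nsq_ge0 w => *.
by apply/andP; split; lra.
Qed.

Lemma measurable_rdot (k : nat) (f g : signal R k) :
  measurable_signal f -> measurable_signal g ->
  measurable_fun setT (fun t => rdot (f t) (g t)).
Proof.
move=> mf mg; under eq_fun do rewrite rdotE; apply: measurable_sum => j.
have [fr fi] := mf j; have [gr gi] := mg j.
exact: (measurable_funD (measurable_funM fr gr) (measurable_funM fi gi)).
Qed.

Lemma integrable_nsq (k : nat) (f : signal R k) : L2 f ->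
  mu.-integrable setT (EFin \o (fun t => nsq (f t))).
Proof.
move=> /L2P [mf foo]; apply/integrableP; split.
  by apply/measurable_EFinP; exact: measurable_nsq.
by under eq_integral do rewrite /= ger0_norm ?nsq_ge0//.
Qed.

Lemma integrable_rdot (k : nat) (f g : signal R k) : L2 f -> L2 g ->
  mu.-integrable setT (EFin \o (fun t => rdot (f t) (g t))).
Proof.
move=> f2 g2; apply: (@le_integrable _ _ _ mu _ measurableT _ (EFin \o (fun t => nsq (f t) + nsq (g t)))).
- by apply/measurable_EFinP; apply: measurable_rdot; exact: measurable_L2.
- move=> t _ /=; rewrite lee_fin (le_trans (norm_rdot_le _ _))// ler_norm//.
- exact: (integrableD measurableT (integrable_nsq f2) (integrable_nsq g2)).
Qed.

Definition renergy (k : nat) (f : signal R k) : R := \int[mu]_t nsq (f t).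

Lemma renergyE (k : nat) (f : signal R k) : L2 f -> energy f = (renergy f)%:E.
Proof. by move=> f2; rewrite /renergy -ge0_integral_EFin//; exact: integrable_nsq. Qed.

Lemma renergy_ge0 (k : nat) (f : signal R k) : 0 <= renergy f.
Proof. by apply: Rintegral_ge0 => t _; exact: nsq_ge0. Qed.

Lemma renergyB_expand (k : nat) (f g : signal R k) (s : R) : L2 f -> L2 g ->
  renergy (fun t => f t - (s%:C)%C *: g t) =
  renergy f - 2 * s * complex.Re (L2inner f g) + s ^+ 2 * renergy g.
Proof.
move=> f2 g2; rewrite /L2inner /=.
have i1 := integrable_nsq f2; have i2 := integrable_nsq g2; have i3 := integrable_rdot f2 g2.
have i3s := integrableZl measurableT (2 * s) i3.
rewrite -/(Rintegral mu setT (fun t => rdot (f t) (g t))).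
rewrite -(RintegralZl _ measurableT i3) -(RintegralZl _ measurableT i2).
rewrite -RintegralB// -RintegralD//.
- by apply: eq_Rintegral => t _; rewrite nsqB_expand.
- exact: (integrableB measurableT i1 i3s).
- exact: (integrableZl measurableT (s ^+ 2) i2).
Qed.

Lemma renergy_parallelogram (k : nat) (f g : signal R k) : L2 f -> L2 g ->
  renergy (fun t => f t + g t) + renergy (f \- g) = 2 * renergy f + 2 * renergy g.
Proof.
move=> f2 g2.
have fg2 : L2 (fun t => f t + g t).
  by have := L2_lin 1 f2 g2; under [X in L2 X -> _]eq_fun do rewrite scale1r.
have i1 := integrable_nsq f2; have i2 := integrable_nsq g2.
rewrite /renergy -(RintegralZl _ measurableT i1) -(RintegralZl _ measurableT i2).
rewrite -RintegralD//; [|exact: integrable_nsq|exact: (integrable_nsq (L2B f2 g2))].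
rewrite -RintegralD//; [|exact: (integrableZl measurableT 2 i1)|exact: (integrableZl measurableT 2 i2)].
by apply: eq_Rintegral => t _; exact: nsq_parallelogram.
Qed.

(** A quadratic polynomial in [s] that is minimal at 0 has no linear term. *)
Lemma minimizer_orthogonal (k : nat) (x h : signal R k) : L2 x -> L2 h ->
  (forall s : R, renergy x <= renergy (fun t => x t - (s%:C)%C *: h t)) ->
  complex.Re (L2inner x h) = 0.
Proof.
move=> x2 h2 min; set D := complex.Re _; set e := renergy h.
have e0 : 0 <= e by exact: renergy_ge0.
have e1 : 0 < e + 1 by rewrite ltr_wpDl.
(* The polynomial is minimal at D / e; with e + 1 the denominator is nonzero and
   the value is still below renergy x, unless D = 0. *)
have := min (D / (e + 1)); rewrite renergyB_expand// -/D -/e.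
have -> : renergy x - 2 * (D / (e + 1)) * D + (D / (e + 1)) ^+ 2 * e =
  renergy x - D ^+ 2 * ((e + 2) / (e + 1) ^+ 2).
  by field; rewrite gt_eqF.
rewrite lerBrDr gerDl => hD.
have pos : 0 < (e + 2) / (e + 1) ^+ 2 by rewrite divr_gt0 ?exprn_gt0// ltr_wpDl.
have D2 : D ^+ 2 <= 0 by rewrite -(pmulr_lle0 _ pos).
by apply/eqP; rewrite -sqrf_eq0 eq_le D2 sqr_ge0.
Qed.

Lemma Im_L2inner (k : nat) (x h : signal R k) :
  complex.Im (L2inner x h) = complex.Re (L2inner x (fun t => ('i)%C *: h t)).
Proof.
rewrite /L2inner /=; apply: eq_Rintegral => t _.
rewrite Im_sum Re_sum; apply: eq_bigr => j _; rewrite !mxE.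
by case: (x t j ord0) (h t j ord0) => [? ?] [? ?] /=; ring.
Qed.

Lemma nsq_midpoint (k : nat) (x a b : 'cV[R[i]]_k) :
  nsq ((x - a) + (x - b)) = 4 * nsq (x - (2^-1 : R)%:C%C *: (a + 1 *: b)).
Proof.
rewrite scale1r /nsq mulr_sumr; apply: eq_bigr => j _; rewrite !mxE.
by case: (x j ord0) (a j ord0) (b j ord0) => [? ?] [? ?] [? ?] /=; field.
Qed.

(** A minimizing sequence for the distance to the graph is Cauchy by the
    parallelogram law; its limit lies in the graph and minimizes the distance.
    Real directions kill the real part of the inner product, and multiplying a
    direction by [i] exchanges the two parts. *)
Lemma orth_proj_exists (w : signal R (m + l)) : L2 w -> exists v, is_orth_proj (graph P) w v.
Proof.
move=> w2; have mw := measurable_L2 w2.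
pose S := [set renergy (w \- g) | g in graph P].
have S0 : S !=set0 by exists (renergy (w \- (fun=> 0))), (fun=> 0) => //; exact: graph0.
have lS : has_lbound S by exists 0 => _ [g _ <-]; exact: renergy_ge0.
pose d := inf S.
have dle g : graph P g -> d <= renergy (w \- g).
  by move=> Gg; apply: ge_inf => //; exists g.
(* The excess 8^-n / 4 is what the parallelogram law turns into the Cauchy gap
   8^-n that graph_closed expects. *)
have hg n : exists g, graph P g /\ renergy (w \- g) <= d + 8^-1 ^+ n / 4.
  have e0 : 0 < (8^-1 : R) ^+ n / 4 by rewrite divr_gt0// exprn_gt0.
  by have [_ [g Gg <-] /ltW hg] := inf_adherent e0 (conj S0 lS); exists g.
have [g_ Hg_] := choice hg.
have Gg n : graph P (g_ n) by case: (Hg_ n).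
have dg n : renergy (w \- g_ n) <= d + 8^-1 ^+ n / 4 by case: (Hg_ n).
have g2 n : L2 (g_ n) := graph_L2 (Gg n).
have mg n := measurable_L2 (g2 n).
have FC n k : (n <= k)%N -> (energy (g_ k \- g_ n)%R <= (8^-1 ^+ n)%:E)%E.
  move=> nk; have x2 := L2B w2 (g2 n); have y2 := L2B w2 (g2 k).
  have gG : graph P (fun t => (2^-1 : R)%:C%C *: (g_ n t + 1 *: g_ k t)).
    have := graph_lin (2^-1 : R)%:C%C graph0 (graph_lin 1 (Gg n) (Gg k)).
    by under [X in graph P X -> _]eq_fun do rewrite add0r.
  have := dle _ gG.
  have gm2 := L2B w2 (graph_L2 gG).
  have := renergy_parallelogram x2 y2.
  have -> : (w \- g_ n) \- (w \- g_ k) = g_ k \- g_ n.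
    by apply/funext => t /=; rewrite opprB addrC addrA subrK.
  have -> : renergy (fun t => (w \- g_ n) t + (w \- g_ k) t) =
      4 * renergy (w \- (fun t => (2^-1 : R)%:C%C *: (g_ n t + 1 *: g_ k t))).
    rewrite /renergy -(RintegralZl _ measurableT (integrable_nsq gm2)).
    by apply: eq_Rintegral => t _; exact: nsq_midpoint.
  have nk8 : (8^-1 : R) ^+ k <= 8^-1 ^+ n by rewrite ler_wiXn2l// invf_le1// ler1n.
  have := dg n; have := dg k.
  rewrite renergyE; last exact: L2B.
  rewrite lee_fin; move: nk8; move: (8^-1 ^+ k) (8^-1 ^+ n) (renergy (w \- g_ n))
    (renergy (w \- g_ k)) (renergy (g_ k \- g_ n)) (renergy _) => a b r1 r2 r3 r4.
  by clear; lra.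
have [v [mv av ev]] := energy_complete mg FC.
have ev' n : (energy (v \- g_ n)%R <= ((2 * (m + l)%:R) * 8^-1 ^+ n)%:E)%E by exact: ev.
have av' : {ae mu, forall t, cvg_coords (g_ ^~ t) (v t)}.
  by apply: ae_imply av => t h j; exact: h.
have Gv : graph P v by exact: (graph_closed Gg mv FC ev' av').
have v2 := graph_L2 Gv.
have x2 : L2 (w \- v) by exact: L2B.
have xd : renergy (w \- v) <= d.
  rewrite -lee_fin -renergyE//; apply/lee_addgt0Pr => e e0.
  have [N HN] := small_geometric (4^-1) e0.
  apply: (@fatou_le (fun n t => nsq (w t - g_ (n + N)%N t))).
  - by move=> n; apply: measurable_nsq; exact: (measurable_signalB mw (mg _)).
  - by apply: measurable_nsq; exact: measurable_L2.
  - by move=> n t; exact: nsq_ge0.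
  - by move=> t; exact: nsq_ge0.
  - apply: ae_imply av' => t ht.
    have := cvg_coords_nsq (v := w t) ht; by rewrite -(cvg_shiftn N).
  - move=> n; rewrite -/(energy (w \- g_ (n + N)%N)) renergyE; last exact: L2B.
    rewrite -EFinD lee_fin (le_trans (dg _))// lerD2l (le_trans _ HN)// mulrC ler_wpM2l//.
    by rewrite ler_wiXn2l// ?invf_le1 ?ler1n// leq_addl.
have perp h : graph P h -> complex.Re (L2inner (w \- v) h) = 0.
  move=> Gh; apply: minimizer_orthogonal => //; first exact: graph_L2.
  move=> s; apply: (le_trans xd).
  have := dle _ (graph_lin (s%:C)%C Gv Gh); congr (_ <= renergy _).
  by apply/funext => t /=; rewrite opprD addrA.
exists v; split => // h Gh; apply: complex_eqP; first exact: perp.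
rewrite Im_L2inner; apply: perp.
have := graph_lin ('i)%C graph0 Gh.
by under [X in graph P X -> _]eq_fun do rewrite add0r.
Qed.

End graph.

(** * Triangle inequality for the gap *)

Lemma quadratic_ge0_discr (a b D : R) : 0 <= b ->
  (forall s : R, 0 <= a - 2 * s * D + s ^+ 2 * b) -> D ^+ 2 <= a * b.
Proof.
move=> b0 h; have [b1|] := ltP 0 b.
  have := h (D / b).
  have -> : a - 2 * (D / b) * D + (D / b) ^+ 2 * b = a - D ^+ 2 / b.
    by field; rewrite gt_eqF.
  by rewrite subr_ge0 ler_pdivrMr.
move=> b1; have bE : b = 0 by apply/eqP; rewrite eq_le b1 b0.
have [->|D0] := eqVneq D 0; first by rewrite expr0n bE mulr0.
(* At this point the affine function a - 2 s D takes the value -1. *)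
have := h ((a + 1) / (2 * D)); rewrite bE mulr0 addr0.
have -> : a - 2 * ((a + 1) / (2 * D)) * D = -1 by field.
by rewrite ler0N1.
Qed.

Lemma L2normEr (k : nat) (f : signal R k) : L2 f ->
  L2norm f = (Num.sqrt (renergy f))%:E.
Proof.
move=> f2; rewrite L2normE renergyE// poweR_EFin; congr EFin.
by rewrite -powR12_sqrt ?renergy_ge0.
Qed.

(** Cauchy-Schwarz comes from the discriminant of the energy along a line. *)
Lemma L2norm_triangle (k : nat) (f g h : signal R k) : L2 f -> L2 g -> L2 h ->
  (L2norm (f \- h)%R <= L2norm (f \- g)%R + L2norm (g \- h)%R)%E.
Proof.
move=> f2 g2 h2; have x2 := L2B f2 g2; have y2 := L2B h2 g2.
rewrite !L2normEr//; [|exact: L2B..]; rewrite -EFinD lee_fin.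
have := @renergyB_expand _ _ _ 1 x2 y2.
rewrite (_ : (fun t => _) = f \- h); last first.
  by apply/funext => t /=; rewrite scale1r opprB addrA subrK.
set D := complex.Re _.
have -> : renergy (h \- g) = renergy (g \- h).
  by apply: eq_Rintegral => t _ /=; rewrite -nsqN opprB.
set a := renergy (f \- g); set b := renergy (g \- h); move=> E.
have a0 : 0 <= a by exact: renergy_ge0.
have b0 : 0 <= b by exact: renergy_ge0.
have cs : D ^+ 2 <= a * b.
  apply: quadratic_ge0_discr => // s.
  rewrite /b (_ : renergy (g \- h) = renergy (h \- g)); last first.
    by apply: eq_Rintegral => t _ /=; rewrite -nsqN opprB.
  by rewrite -renergyB_expand// renergy_ge0.
rewrite -ler_sqr ?nnegrE ?addr_ge0 ?sqrtr_ge0// sqr_sqrtr ?renergy_ge0//.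
rewrite sqrrD !sqr_sqrtr// E.
have hD : `|D| <= Num.sqrt a * Num.sqrt b.
  by rewrite -sqrtrM// -sqrtr_sqr ler_wsqrtr.
have arith (x y z u v : R) : y <= x -> - z <= y ->
    u - 2 * 1 * z + 1 ^+ 2 * v <= u + x *+ 2 + v.
  by rewrite (mulr2n x) => *; lra.
by apply: (arith _ `|D|) => //; rewrite -normrN ler_norm.
Qed.

Section gap_metric.
Variables (l m : nat).
Implicit Types P : 'M[{fraction {poly R}}]_(l, m).

(** The zero signal has projections onto both graphs, so the supremum is over a
    nonempty set. *)
Lemma gap_ge0 P1 P2 : (0 <= gap P1 P2)%E.
Proof.
have z2 := @L2_0 (m + l).
have [v1 h1] := orth_proj_exists P1 z2; have [v2 h2] := orth_proj_exists P2 z2.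
apply: (@le_trans _ _ (L2norm (v1 \- v2))); first exact: Lnorm_ge0.
apply: ereal_sup_ubound; exists (fun=> 0), v1, v2; split => //.
- exact: H2_0.
- by rewrite L2normE energy0 poweR0r ?lee_fin// invr_neq0.
Qed.

(** The same [w] is projected onto the middle graph. *)
Lemma gap_triangle P1 P2 P3 : (gap P1 P3 <= gap P1 P2 + gap P2 P3)%E.
Proof.
apply: ge_ereal_sup => _ [w [v1 [v3 [Hw w1 h1 h3 ->]]]].
have w2 : L2 w by case: Hw.
have [v2 h2] := orth_proj_exists P2 w2.
have L1 := graph_L2 h1.1; have L2_ := graph_L2 h2.1; have L3 := graph_L2 h3.1.
apply: (le_trans (L2norm_triangle L1 L2_ L3)); apply: leeD.
  by apply: ereal_sup_ubound; exists w, v1, v2; split.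
by apply: ereal_sup_ubound; exists w, v2, v3; split.
Qed.

End gap_metric.

End signals.

(** * Integrals against image laws *)

Section lower_integral.
Context d (T : measurableType d) (R : realType).
Variable P : {measure set T -> \bar R}.
Import HBNNSimple.
Local Open Scope ereal_scope.

(** The integral of a nonnegative function is the supremum over the simple
    functions below it; each of these is measurable and pulls back along [X] to a
    simple function that is at most [g] almost everywhere. *)
Lemma integral_pushforward_le d' (T' : measurableType d') (X : T -> T')
    (D : set T') (f : T' -> \bar R) (g : T -> \bar R) (Q : {measure set T' -> \bar R}) :
  measurable_fun setT X -> (forall A, measurable A -> Q A = P (X @^-1` A)) ->
  (forall y, 0 <= f y) -> measurable_fun setT g -> (forall x, 0 <= g x) ->
  {ae P, forall x, f (X x) <= g x} ->
  \int[Q]_(y in D) f y <= \int[P]_x g x.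
Proof.
move=> mX QP f0 mg g0 fg; rewrite integral_mkcond ge0_integralTE; last first.
  by move=> y; rewrite patchE; case: ifP.
apply: ge_ereal_sup => _ [h hf <-].
rewrite -integralT_nnsfun.
have mh : measurable_fun setT (EFin \o h) by exact/measurable_EFinP.
have -> : \int[Q]_y (h y)%:E = \int[P]_x (h (X x))%:E.
  transitivity (\int[pushforward P X]_y (h y)%:E).
    by apply: eq_measure_integral => A mA _; exact: QP.
  by rewrite ge0_integral_pushforward//= => y _; rewrite lee_fin.
apply: ae_ge0_le_integral => //.
- by move=> x _; rewrite lee_fin.
- exact: (measurableT_comp mh mX).
- move: fg; apply: filterS => x fgx _; apply: le_trans fgx.
  by apply: (le_trans (hf (X x))); rewrite patchE; case: ifP.
Qed.

End lower_integral.

(** * Borel sets and the support *)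

Section support.
Context (R : realType) (p : nat).
Local Notation V := 'rV[R]_p.

Lemma measurable_open_borel (T : ptopologicalType) (U : set T) :
  open U -> measurable (U : set (borel T)).
Proof. by move=> oU; exact: sub_gen_smallest. Qed.

(** A countable base of the topology of the parameter space. *)
Definition rational_ball (z : 'rV[rat]_p * nat) : set V :=
  ball (map_mx (@ratr R) z.1 : V) (z.2.+1%:R^-1).

Lemma rational_ball_basis (U : set V) (x : V) : open U -> U x ->
  exists z, rational_ball z x /\ rational_ball z `<=` U.
Proof.
move=> oU Ux; have /nbhs_ballP[e /= e0 eU] := open_nbhs_nbhs (conj oU Ux).
have [k ke] : exists k : nat, k.+1%:R^-1 < e / 2.
  have := @cvg_invSn R; move=> /cvgr0Pnorm_lt /(_ (e / 2)) [|n _ hn]; first by rewrite divr_gt0.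
  by exists n; apply: le_lt_trans (hn n (leqnn n)); exact: ler_norm.
have k0 : 0 < k.+1%:R^-1 :> R by rewrite invr_gt0.
have hr j : exists c : rat, `|x ord0 j - ratr c| < k.+1%:R^-1.
  have [|c] := @rat_in_itvoo R (x ord0 j - k.+1%:R^-1) (x ord0 j + k.+1%:R^-1).
    by rewrite ltrD2l -subr_gt0 opprK addr_gt0.
  by rewrite in_itv/= => cx; exists c; rewrite ltr_distlC.
have [c hc] := choice hr.
exists (\row_j c j, k); split.
  split=> // i j; rewrite (ord1 i) !mxE /ball/= distrC; exact: hc.
move=> y yB; apply: eU; rewrite (splitr e).
apply: (@ball_triangle _ _ (map_mx (@ratr R) (\row_j c j) : V)).
  split; first by rewrite divr_gt0.
  by move=> i j; rewrite (ord1 i) !mxE /ball/=; exact: lt_trans (hc j) ke.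
by apply: le_ball yB => /=; exact: ltW.
Qed.

(** The space has a countable base, so the points outside the support form a
    countable union of null sets. *)
Lemma supp_negligible (E : set (borel V)) (P : probability (borel V) R) :
  measurable E -> P E = 1%E -> P.-negligible (~` supp E P).
Proof.
move=> mE PE.
pose B n : set V := if unpickle n is Some z then rational_ball z else set0.
(* The null balls among the base; the others contribute the empty set. *)
pose N n : set (borel V) := if (P (E `&` B n) == 0)%E then E `&` B n else set0.
have mB n : measurable (B n : set (borel V)).
  rewrite /B; case: unpickle => [z|]; last exact: measurable0.
  by apply: measurable_open_borel; exact: ball_open.
have N0 n : P.-negligible (N n).
  rewrite /N; case: ifPn => [/eqP h|_]; last exact: negligible_set0.
  by apply/negligibleP => //; exact: measurableI.
have EC : P.-negligible (~` E).
  apply/negligibleP; first exact: measurableC.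
  by have := probability_setC P mE; rewrite PE subee.
apply: (@negligibleS _ _ _ _ (~` E `|` \bigcup_n N n)); last first.
  by apply: negligibleU => //; exact: negligible_bigcup.
move=> x nx; have [Ex|] := pselect (E x); last by left.
right; apply: contrapT => nN; apply: nx; split=> // U oU Ux.
have [z [zx zU]] := rational_ball_basis oU Ux.
have Bz : B (pickle z) = rational_ball z by rewrite /B pickleK.
rewrite lt_neqAle measure_ge0 andbT eq_sym; apply/negP => /eqP PU.
apply: nN; exists (pickle z) => //; rewrite /N.
have : (P (E `&` B (pickle z)) <= P (E `&` U))%E.
  apply: le_measure; rewrite ?inE.
  - exact: measurableI.
  - by apply: measurableI => //; exact: measurable_open_borel.
  - by apply: setIS; rewrite Bz.
rewrite PU => h.
have -> : (P (E `&` B (pickle z)) == 0)%E by rewrite eq_le h measure_ge0.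
by split => //; rewrite Bz.
Qed.

End support.

Lemma continuous_borel_measurable (R : realType) (T : ptopologicalType) (f : T -> R) :
  continuous f -> measurable_fun setT (f : borel T -> R).
Proof.
move=> cf; apply: (measurability _ (RGenOpens.measurableE R)).
move=> _ [_ [a [b ->] <-]]; rewrite setTI; apply: measurable_open_borel.
by apply: open_comp; [move=> x _; exact: cf|exact: interval_open].
Qed.

Section enorm.
Context (R : realType) (p : nat).

Lemma enorm_ge0 (x : 'rV[R]_p) : 0 <= enorm x. Proof. exact: sqrtr_ge0. Qed.

Lemma enormB (x y : 'rV[R]_p) : enorm (x - y) = enorm (y - x).
Proof.
rewrite /enorm; congr Num.sqrt; apply: eq_bigr => j _.
by rewrite !mxE -sqrrN opprB.
Qed.

Lemma measurable_enormB (c : 'rV[R]_p) :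
  measurable_fun setT ((fun x : 'rV[R]_p => enorm (x - c)) : borel 'rV[R]_p -> R).
Proof.
apply: (measurableT_comp (continuous_measurable_fun (@sqrt_continuous R))).
apply: measurable_sum => j; apply: measurable_funX.
under eq_fun do rewrite !mxE.
apply: measurable_funB => //.
by apply: continuous_borel_measurable; exact: coord_continuous.
Qed.

End enorm.

(** * The independent coupling *)

Section product_moments.
Context d1 d2 (T1 : measurableType d1) (T2 : measurableType d2) (R : realType).
Variables (P1 : probability T1 R) (P2 : probability T2 R).
Local Open Scope ereal_scope.

Lemma integral_prod_fst (f : T1 -> \bar R) : measurable_fun setT f ->
  (forall x, 0 <= f x) -> \int[P1 \x P2]_z f z.1 = \int[P1]_x f x.
Proof.
move=> mf f0; rewrite (fubini_tonelli1 (m1 := P1) (m2 := P2) (fun z => f z.1))//; last first.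
  exact: (measurableT_comp mf measurable_fst).
apply: eq_integral => x _; rewrite /fubini_F/= (integral_cst P2 measurableT (f x)).
rewrite -[RHS]mule1; congr (_ * _); exact: probability_setT.
Qed.

Lemma integral_prod_snd (f : T2 -> \bar R) : measurable_fun setT f ->
  (forall x, 0 <= f x) -> \int[P1 \x P2]_z f z.2 = \int[P2]_x f x.
Proof.
move=> mf f0; rewrite (fubini_tonelli2 (m1 := P1) (m2 := P2) (fun z => f z.2))//; last first.
  exact: (measurableT_comp mf measurable_snd).
apply: eq_integral => x _; rewrite /fubini_G/= (integral_cst P1 measurableT (f x)).
rewrite -[RHS]mule1; congr (_ * _); exact: probability_setT.
Qed.

Variables (X1 : T1 -> R) (X2 : T2 -> R) (c l1 l2 q : R).
Hypotheses (mX1 : measurable_fun setT X1) (mX2 : measurable_fun setT X2).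
Hypotheses (X10 : forall x, (0 <= X1 x)%R) (X20 : forall x, (0 <= X2 x)%R).
Hypotheses (c0 : (0 <= c)%R) (l10 : (0 <= l1)%R) (l20 : (0 <= l2)%R) (q1 : (1 <= q)%R).

(** Minkowski's inequality for three functions on the product, each of which
    depends on at most one coordinate. *)
Lemma product_minkowski :
  \int[P1 \x P2]_z ((c + l1 * X1 z.1 + l2 * X2 z.2) `^ q)%:E <=
  poweR (c%:E + (l1%:E * poweR (\int[P1]_x (X1 x `^ q)%:E) q^-1 +
                 l2%:E * poweR (\int[P2]_x (X2 x `^ q)%:E) q^-1)) q.
Proof.
have q0 : (0 < q)%R by exact: lt_le_trans q1.
have qn0 : q != 0%R by rewrite gt_eqF.
pose mu := (P1 \x P2).
have scaled d (T : measurableType d) (P : {measure set T -> \bar R}) (Y : T -> R) (a : R) :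
    measurable_fun setT Y -> (forall x, 0 <= Y x)%R -> (0 <= a)%R ->
    Lnorm P q%:E (EFin \o (fun x => a * Y x)%R) = a%:E * poweR (\int[P]_x (Y x `^ q)%:E) q^-1.
  move=> mY Y0 a0; rewrite unlock.
  have -> : \int[P]_x (`|(EFin \o (fun x => a * Y x)%R) x| `^ q) =
      (a `^ q)%:E * \int[P]_x (Y x `^ q)%:E.
    rewrite -ge0_integralZl//.
    - apply: eq_integral => x _; rewrite abse_EFin poweR_EFin -EFinM ger0_norm ?mulr_ge0//.
      by rewrite powRM.
    - by apply/measurable_EFinP; exact: (measurableT_comp (measurable_powR q) mY).
    - by move=> x _; rewrite lee_fin powR_ge0.
    - by rewrite lee_fin powR_ge0.
  rewrite poweRM ?lee_fin ?powR_ge0//; last first.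
    by apply: integral_ge0 => x _; rewrite lee_fin powR_ge0.
  by congr (_ * _); rewrite poweR_EFin -powRrM mulfV// powRr1.
have mY1 : measurable_fun setT (fun z : T1 * T2 => X1 z.1) by exact: (measurableT_comp mX1 measurable_fst).
have mY2 : measurable_fun setT (fun z : T1 * T2 => X2 z.2) by exact: (measurableT_comp mX2 measurable_snd).
have N1 : Lnorm mu q%:E (EFin \o (fun z => l1 * X1 z.1)%R) =
    l1%:E * poweR (\int[P1]_x (X1 x `^ q)%:E) q^-1.
  rewrite (scaled _ _ mu (fun z => X1 z.1))//; congr (_ * poweR _ _).
  apply: (integral_prod_fst (f := fun x => (X1 x `^ q)%:E)).
    by apply/measurable_EFinP; exact: (measurableT_comp (measurable_powR q) mX1).
  by move=> x; rewrite lee_fin powR_ge0.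
have N2 : Lnorm mu q%:E (EFin \o (fun z => l2 * X2 z.2)%R) =
    l2%:E * poweR (\int[P2]_x (X2 x `^ q)%:E) q^-1.
  rewrite (scaled _ _ mu (fun z => X2 z.2))//; congr (_ * poweR _ _).
  apply: (integral_prod_snd (f := fun x => (X2 x `^ q)%:E)).
    by apply/measurable_EFinP; exact: (measurableT_comp (measurable_powR q) mX2).
  by move=> x; rewrite lee_fin powR_ge0.
have Nc : Lnorm mu q%:E (EFin \o cst c) = c%:E.
  rewrite (_ : cst c = (fun z : T1 * T2 => c * cst 1 z)%R); last first.
    by apply/funext => z; rewrite /= mulr1.
  rewrite (scaled _ _ mu (cst 1%R))//=.
  have muT : mu setT = 1.
    rewrite /mu -setXTT product_measure1E// -[RHS]mule1.
    by congr (_ * _); exact: probability_setT.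
  have -> : \int[mu]_x (1 `^ q)%:E = 1.
    rewrite powR1 -[RHS]muT -[RHS]mul1e.
    exact: (integral_cst mu measurableT 1).
  by rewrite poweR_EFin powR1 mule1.
have mM1 : measurable_fun setT (fun z : T1 * T2 => l1 * X1 z.1)%R by exact: measurable_funM.
have mM2 : measurable_fun setT (fun z : T1 * T2 => l2 * X2 z.2)%R by exact: measurable_funM.
pose F := (cst c \+ ((fun z => l1 * X1 z.1) \+ (fun z => l2 * X2 z.2)))%R.
have -> : \int[mu]_z ((c + l1 * X1 z.1 + l2 * X2 z.2) `^ q)%:E = poweR (Lnorm mu q%:E (EFin \o F)) q.
  rewrite (powR_Lnorm mu _ qn0); apply: eq_integral => z _.
  rewrite /F abse_EFin poweR_EFin /= addrA ger0_norm//.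
  by rewrite !addr_ge0// mulr_ge0.
have mc : measurable_fun setT (cst c : T1 * T2 -> R) by exact: measurable_cst.
apply: gt0_ler_poweR; rewrite ?(ltW q0)// ?in_itv/= ?leey ?andbT ?Lnorm_ge0//.
  by rewrite !adde_ge0// mule_ge0 ?lee_fin// poweR_ge0.
apply: (le_trans (minkowski_EFin mu mc (measurable_funD mM1 mM2) q1)).
rewrite Nc leeD2l// (le_trans (minkowski_EFin mu mM1 mM2 q1))//.
by rewrite N1 N2.
Qed.

End product_moments.

Section totalization.
Context d d' (T : measurableType d) (T' : measurableType d').

(** A map that is measurable on a measurable set [E] becomes measurable on the
    whole space when it is made constant outside [E]. *)
Definition totalize (E : set T) (f : T -> T') (y : T') (x : T) : T' :=
  if x \in E then f x else y.

Lemma totalizeE E f y x : E x -> totalize E f y x = f x.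
Proof. by move=> Ex; rewrite /totalize mem_set. Qed.

Lemma measurable_totalize E f y : measurable E -> measurable_fun E f ->
  measurable_fun setT (totalize E f y).
Proof.
move=> mE mf _ B mB; rewrite setTI.
have -> : totalize E f y @^-1` B = (E `&` f @^-1` B) `|` (~` E `&` [set x | B y]).
  apply/seteqP; split=> x; rewrite /totalize /preimage /=.
    by case: ifPn => [/set_mem Ex Bx|/negP nEx Bx]; [left|right; split => // Ex; apply: nEx; exact: mem_set].
  by move=> [[Ex Bx]|[nEx Bx]]; [rewrite mem_set|rewrite memNset].
apply: measurableU; first exact: mf.
have [By|nBy] := pselect (B y).
  by rewrite (_ : [set _ | _] = setT) ?setIT; [exact: measurableC|apply/seteqP; split].
by rewrite (_ : [set _ | _] = set0) ?setI0//; apply/seteqP; split.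
Qed.

End totalization.

Section independent_coupling.
Context d1 d2 (T1 : measurableType d1) (T2 : measurableType d2) (R : realType).
Variables (P1 : probability T1 R) (P2 : probability T2 R).

Lemma product_probability_setT : (P1 \x P2)%E setT = 1%E.
Proof.
rewrite -setXTT product_measure1E// -[RHS]mule1.
by congr (_ * _)%E; exact: probability_setT.
Qed.

Context d1' d2' (T1' : measurableType d1') (T2' : measurableType d2').
Variables (f1 : T1 -> T1') (f2 : T2 -> T2').
Hypotheses (mf1 : measurable_fun setT f1) (mf2 : measurable_fun setT f2).

Lemma measurable_fun_map2 : measurable_fun setT (fun z : T1 * T2 => (f1 z.1, f2 z.2)).
Proof.
apply: measurable_fun_pair; first exact: (measurableT_comp mf1 measurable_fst).
exact: (measurableT_comp mf2 measurable_snd).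
Qed.

Definition product_probability : set (T1 * T2) -> \bar R := (P1 \x P2)%E.

HB.instance Definition _ := Measure.on product_probability.

HB.instance Definition _ :=
  Measure_isProbability.Build _ _ _ product_probability product_probability_setT.

Definition map2 (z : T1 * T2) : T1' * T2' := (f1 z.1, f2 z.2).

HB.instance Definition _ := isMeasurableFun.Build _ _ _ _ map2 measurable_fun_map2.

(** The law of the images of independent samples; its marginals are the image
    laws, and moments of functions of one sample are those of that sample. *)
Definition independent_coupling : probability (T1' * T2')%type R :=
  distribution product_probability map2.

End independent_coupling.

Section product_negligible.
Context d1 d2 (T1 : measurableType d1) (T2 : measurableType d2) (R : realType).
Variables (P1 : probability T1 R) (P2 : probability T2 R).

Lemma ae_prod (Q1 : T1 -> Prop) (Q2 : T2 -> Prop) :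
  P1.-negligible (~` Q1) -> P2.-negligible (~` Q2) ->
  {ae (P1 \x P2)%E, forall z, Q1 z.1 /\ Q2 z.2}.
Proof.
move=> [B1 [mB1 B10 QB1]] [B2 [mB2 B20 QB2]].
have n1 : (P1 \x P2)%E.-negligible (B1 `*` setT).
  exists (B1 `*` setT); split => //; first exact: measurableX.
  by rewrite product_measure1E// [X in (X * _)%E]B10 mul0e.
have n2 : (P1 \x P2)%E.-negligible (setT `*` B2).
  exists (setT `*` B2); split => //; first exact: measurableX.
  by rewrite product_measure1E// [X in (_ * X)%E]B20 mule0.
apply: negligibleS (negligibleU n1 n2) => z nz.
have [h1|h1] := pselect (Q1 z.1); last by left; split => //; exact: QB1.
have [h2|h2] := pselect (Q2 z.2); last by right; split => //; exact: QB2.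
by exfalso; apply: nz.
Qed.

Lemma totalize_law d' (T' : measurableType d') (E : set T1) (f : T1 -> T') (y : T') (A : set T') :
  measurable E -> P1 E = 1%E -> measurable_fun E f -> measurable A ->
  P1 (totalize E f y @^-1` A) = P1 (E `&` f @^-1` A).
Proof.
move=> mE PE mf mA; have mt := measurable_totalize y mE mf.
have mtA : measurable (totalize E f y @^-1` A).
  by rewrite -[X in measurable X]setTI; exact: mt.
have mEA : measurable (E `&` f @^-1` A) by exact: mf.
have E0 : P1 (~` E) = 0%E by rewrite (probability_setC P1 mE) PE subee.
rewrite -(setIT (totalize E f y @^-1` A)) -(setUv E) setIUr measureU.
- rewrite [X in (_ + X)%E](_ : _ = 0%E) ?adde0.
    congr (P1 _); apply/seteqP; split=> x [].
      by rewrite /preimage/= => + Ex; rewrite totalizeE.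
    by move=> Ex fx; split=> //; rewrite /preimage/= totalizeE.
  apply/eqP; rewrite eq_le measure_ge0 andbT -E0; apply: le_measure; rewrite ?inE.
  + by apply: measurableI => //; exact: measurableC.
  + exact: measurableC.
  + exact: subIsetr.
- exact: measurableI.
- by apply: measurableI => //; exact: measurableC.
- by rewrite setIACA setICr setI0.
Qed.

End product_negligible.

(** * The transport bound *)

Lemma sum_ord2 (V : nmodType) (F : 'I_2 -> V) : \sum_(i < 2) F i = F ord0 + F ord_max.
Proof. by rewrite big_ord_recl big_ord1; congr (_ + F _); exact/val_inj. Qed.

Theorem mainTheorem6 (R : realType) (n m l p : nat)
    (Sbar : 'I_2 -> plant R n m l)
    (Theta : 'I_2 -> set (borel 'rV[R]_p))
    (ftheta : 'I_2 -> probability (borel 'rV[R]_p) R)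
    (Phi : 'I_2 -> 'rV[R]_p -> plant R n m l)
    (thetabar : 'I_2 -> 'rV[R]_p)
    (N : 'I_2 -> 'rV[R]_p -> 'M[{fraction {poly R}}]_(l, m))
    (D : 'I_2 -> 'rV[R]_p -> 'M[{fraction {poly R}}]_m)
    (L : 'I_2 -> R)
    (hp : (p <= n ^ 2 + n * m + l * n)%N)
    (hTheta : forall i, measurable (Theta i) /\ ftheta i (Theta i) = 1%E)
    (hPhi : forall i, measurable_fun (Theta i)
       (Phi i : borel 'rV[R]_p -> borel (plant R n m l)))
    (hbar : forall i, supp (Theta i) (ftheta i) (thetabar i) /\
       Phi i (thetabar i) = Sbar i)
    (hND : forall i theta, Theta i theta ->
       right_coprime_factorization (transfer (Phi i theta))
         (N i theta) (D i theta))
    (hC1 : forall i, Hinf_C1 (Theta i)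
       (fun theta s => mxeval (col_mx (N i theta) (D i theta)) s))
    (hL : forall i, 0 < L i)
    (hLip : forall i theta theta', supp (Theta i) (ftheta i) theta ->
       supp (Theta i) (ftheta i) theta' ->
       (gap_plant (Phi i theta) (Phi i theta')
        <= (L i * enorm (theta - theta'))%:E)%E)
    (q : R) (hq : 1 <= q) :
  (dist_q q (law_on (Theta ord0) (ftheta ord0) (Phi ord0))
            (law_on (Theta ord_max) (ftheta ord_max) (Phi ord_max))
   <= poweR (gap_plant (Sbar ord0) (Sbar ord_max) +
             \sum_(i < 2) (L i)%:E *
               poweR ('E_(ftheta i)[fun theta =>
                        powR (enorm (theta - thetabar i)) q])
                     (q^-1)) q)%E.
Proof.
have q0 : 0 < q by exact: lt_le_trans hq.
pose X i (theta : borel 'rV[R]_p) : R := enorm ((theta : 'rV[R]_p) - thetabar i).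
have mX i : measurable_fun setT (X i) by exact: measurable_enormB.
have X0 i theta : 0 <= X i theta by exact: enorm_ge0.
pose f i : borel 'rV[R]_p -> borel (plant R n m l) :=
  @totalize _ _ (borel 'rV[R]_p) (borel (plant R n m l)) (Theta i) (Phi i) (Sbar i).
have mf i : measurable_fun setT (f i).
  by apply: measurable_totalize => //; case: (hTheta i).
have law i A : measurable A -> ftheta i (f i @^-1` A) = law_on (Theta i) (ftheta i) (Phi i) A.
  by move=> mA; have [mT T1] := hTheta i; exact: totalize_law.
pose pi := independent_coupling (ftheta ord0) (ftheta ord_max) (mf ord0) (mf ord_max).
have piE A : pi A = ((ftheta ord0) \x (ftheta ord_max))%E ((fun z => (f ord0 z.1, f ord_max z.2)) @^-1` A).
  by [].
have mpre i A : measurable A -> measurable (f i @^-1` A).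
  by move=> mA; rewrite -[X in measurable X]setTI; exact: (mf i).
have pic : couplings (law_on (Theta ord0) (ftheta ord0) (Phi ord0))
    (law_on (Theta ord_max) (ftheta ord_max) (Phi ord_max)) pi.
  move=> A mA; rewrite !piE; split.
    rewrite (_ : _ @^-1` _ = (f ord0 @^-1` A) `*` setT) //.
    rewrite product_measure1E//; last exact: mpre.
    by rewrite -law// -[RHS]mule1; congr (_ * _)%E; exact: probability_setT.
  rewrite (_ : _ @^-1` _ = setT `*` (f ord_max @^-1` A)) //.
  rewrite product_measure1E//; last exact: mpre.
  by rewrite -law// -[RHS]mul1e; congr (_ * _)%E; exact: probability_setT.
apply: (@le_trans _ _ (\int[pi]_(S in supp setT (law_on (Theta ord0) (ftheta ord0) (Phi ord0)) `*`
    supp setT (law_on (Theta ord_max) (ftheta ord_max) (Phi ord_max)))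
    poweR (gap_plant S.1 S.2) q)%E).
  by apply: ereal_inf_lbound; exists pi.
(* With an infinite nominal gap the right-hand side is infinite. *)
have [cy|cfin] := eqVneq (gap_plant (Sbar ord0) (Sbar ord_max)) +oo%E.
  rewrite cy addye; last first.
    rewrite gt_eqF// (lt_le_trans ltNy0)//; apply: sume_ge0 => i _.
    by rewrite mule_ge0 ?lee_fin ?(ltW (hL i))// poweR_ge0.
  by rewrite poweRyr ?gt_eqF// leey.
pose c := fine (gap_plant (Sbar ord0) (Sbar ord_max)).
have gap0 S1 S2 : (0 <= gap_plant S1 S2)%E by exact: gap_ge0.
have cE : gap_plant (Sbar ord0) (Sbar ord_max) = c%:E.
  by rewrite /c fineK// ge0_fin_numE ?gap0// lt_neqAle cfin leey.
have c0 : 0 <= c by exact: fine_ge0.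
have Lge0 i : 0 <= L i by exact: ltW.
rewrite cE.
have -> : (\sum_(i < 2) (L i)%:E * poweR 'E_(ftheta i)[fun theta => powR (enorm (theta - thetabar i)) q] q^-1 =
   (L ord0)%:E * poweR (\int[ftheta ord0]_x (X ord0 x `^ q)%:E) q^-1 +
   (L ord_max)%:E * poweR (\int[ftheta ord_max]_x (X ord_max x `^ q)%:E) q^-1)%E.
  by rewrite sum_ord2 !unlock.
have PM := product_minkowski (ftheta ord0) (ftheta ord_max) (mX ord0) (mX ord_max) (X0 ord0) (X0 ord_max) c0 (Lge0 ord0) (Lge0 ord_max) hq.
apply: le_trans PM.
apply: (@integral_pushforward_le _ _ _ (ftheta ord0 \x ftheta ord_max)%E _ _
  (fun z => (f ord0 z.1, f ord_max z.2))).
- exact: measurable_fun_map2.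
- by [].
- by move=> S; exact: poweR_ge0.
- apply/measurable_EFinP; apply: (measurableT_comp (measurable_powR q)).
  apply: measurable_funD; first apply: measurable_funD => //.
    by apply: measurable_funM => //; exact: (measurableT_comp (mX ord0) measurable_fst).
  by apply: measurable_funM => //; exact: (measurableT_comp (mX ord_max) measurable_snd).
- by move=> z; rewrite lee_fin powR_ge0.
have sn i : (ftheta i).-negligible (~` supp (Theta i) (ftheta i)).
  by have [mT T1] := hTheta i; exact: supp_negligible.
have := ae_prod (sn ord0) (sn ord_max).
apply: filterS => z [s1 s2] /=.
rewrite /f !totalizeE; [|by case: s2|by case: s1].
have [b1 E1] := hbar ord0; have [b2 E2] := hbar ord_max.
(* From one perturbed plant to the other through the two nominal plants. *)
have gz : (gap_plant (Phi ord0 z.1) (Phi ord_max z.2) <=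
    (c + L ord0 * X ord0 z.1 + L ord_max * X ord_max z.2)%:E)%E.
  have t1 := gap_triangle (transfer (Phi ord0 z.1)) (transfer (Sbar ord0)) (transfer (Phi ord_max z.2)).
  have t2 := gap_triangle (transfer (Sbar ord0)) (transfer (Sbar ord_max)) (transfer (Phi ord_max z.2)).
  apply: (le_trans t1); rewrite [c + _]addrC -addrA EFinD; apply: leeD.
    by rewrite -E1; exact: hLip.
  apply: (le_trans t2); rewrite EFinD; apply: leeD; first by rewrite -cE.
  by rewrite -E2 /X enormB; exact: hLip.
rewrite -poweR_EFin; apply: gt0_ler_poweR; rewrite ?(ltW q0)// in_itv/= leey andbT ?gap0//.
by rewrite lee_fin !addr_ge0// mulr_ge0.
Qed.
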